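(* Let $\psi$ denote Dedekind's arithmetic function. As $x\to\infty$, the following three asymptotic formulas hold, where the sums run over positive integers $n\le x$: \[ \sum_{n\le x}\frac{\psi(\psi(n))}{\psi(n)}\sim\frac{6e^\gamma}{\pi^2}\,x\log_3 x, \] \[ \sum_{n\le x}\frac{\psi(n)}{\psi(\psi(n))}\sim\frac{\pi^2e^{-\gamma}}{6}\,\frac{x}{\log_3 x}, \] \[ \sum_{n\le x}\log\frac{\psi(\psi(n))}{\psi(n)}\sim x\log_4 x. \]
   Context: Dedekind's arithmetic function is $\psi(n)=n\prod_{p\mid n}\left(1+\frac1p\right)$ for positive integers $n$, the product being over the distinct primes $p$ dividing $n$ (so $\psi(1)=1$). $\gamma$ denotes Euler's constant. $\log_k x$ denotes the $k$-fold iterate of the natural logarithm (e.g. $\log_3 x=\log\log\log x$), not a logarithm to base $k$. $f(x)\sim g(x)$ means $f(x)/g(x)\to1$ as $x\to\infty$. *)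

(* Defs.v *)
From mathcomp Require Import all_boot all_order all_algebra.
From mathcomp Require Import all_classical all_reals all_analysis.
From mathcomp Require Import lra.
Set Implicit Arguments.
Unset Strict Implicit.
Unset Printing Implicit Defensive.
Import Order.TTheory GRing.Theory Num.Theory.
Import numFieldNormedType.Exports.

Local Open Scope classical_set_scope.
Local Open Scope ring_scope.

(* Dedekind's function is integer-valued, and has to be a natural number for
   psi (psi n) to make sense; the division is exact, see psiE. *)
Definition psi (n : nat) : nat :=
  (n * \prod_(p <- primes n) p.+1 %/ \prod_(p <- primes n) p)%N.

Lemma dvdn_prod_primes n : (\prod_(p <- primes n) p %| n)%N.
Proof.
case: (posnP n) => [->|n0]; first by rewrite dvdn0.
have {2}-> : n = (\prod_(p <- primes n) p ^ logn p n)%N.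
  by rewrite {1}(prod_prime_decomp n0) prime_decompE big_map.
rewrite !(big_seq_cond xpredT) /=.
elim/big_ind2: _ => // [a b c d|p]; first exact: dvdn_mul.
by rewrite andbT => pn; rewrite dvdn_exp ?logn_gt0.
Qed.

Lemma psiE (F : numFieldType) (n : nat) :
  (psi n)%:R = n%:R * \prod_(p <- primes n) (1 + p%:R^-1) :> F.
Proof.
have pN0 p : p \in primes n -> p%:R != 0 :> F.
  by rewrite mem_primes pnatr_eq0 -lt0n => /and3P[/prime_gt0].
have PN0 : \prod_(p <- primes n) p%:R != 0 :> F.
  by rewrite prodf_seq_neq0; apply/allP => p /pN0.
have dv : (\prod_(p <- primes n) p %| n * \prod_(p <- primes n) p.+1)%N.
  exact/dvdn_mulr/dvdn_prod_primes.
apply: (mulIf PN0); rewrite -natr_prod -natrM /psi divnK//.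
rewrite natrM -mulrA !natr_prod -big_split/=; congr (_ * _).
apply: eq_big_seq => p /pN0 p0.
by rewrite mulrDl mul1r mulVf// natr1.
Qed.

Definition euler_gamma (R : realType) : R :=
  limn (fun n => series (@harmonic R) n - ln n%:R).

Lemma is_cvg_euler_gamma (R : realType) :
  cvgn (fun n => series (@harmonic R) n - ln (n%:R : R)).
Proof.
set u := (X in cvgn X).
suff [l ul] : exists l : R, u n.+1 @[n --> \oo] --> l.
  by apply/cvg_ex; exists l; rewrite -cvg_shiftS.
apply/cvg_ex/nonincreasing_is_cvgn.
  apply/nonincreasing_seqP => n; rewrite /u (seriesSr _ n.+1).
  have h : 0 < n.+2%:R :> R by [].
  have := @le_ln1Dx R (- n.+2%:R^-1).
  rewrite ltrN2 invf_lt1// ltr1n => /(_ isT).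
  have -> : 1 - n.+2%:R^-1 = n.+1%:R / n.+2%:R :> R.
    apply: (mulIf (lt0r_neq0 h)).
    by rewrite mulrBl mul1r mulVf ?divfK ?lt0r_neq0// -(natr1 n.+1) addrK.
  rewrite ln_div ?posrE//= => H.
  rewrite /=; move: (series _ _) (ln _) (ln _) (_^-1) H => a b c d; lra.
have lnS n : ln n.+1%:R <= series (@harmonic R) n.
  elim: n => [|n IH]; first by rewrite ln1 /series /= big_geq.
  rewrite seriesSr.
  have h : 0 < n.+1%:R :> R by [].
  have h' : 0 < n.+1%:R^-1 :> R by rewrite invr_gt0.
  have := @le_ln1Dx R (n.+1%:R^-1).
  have -> : 1 + n.+1%:R^-1 = n.+2%:R / n.+1%:R :> R.
    apply: (mulIf (lt0r_neq0 h)).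
    by rewrite mulrDl mul1r mulVf ?divfK ?lt0r_neq0// natr1.
  rewrite ln_div ?posrE//= => /(_ (lt_trans (ltrN10 _) h')) H.
  rewrite /=; move: (series _ _) (ln _) (ln _) (_^-1) IH H => a b c d; lra.
exists 0 => _ [n _ <-]; rewrite /u subr_ge0 (le_trans (lnS n))//.
by rewrite seriesSr lerDl harmonic_ge0.
Qed.

(* k-fold iterate of ln. Since ln is total (ln x = 0 for x <= 0), this has the
   intended meaning only for large x, which is all that matters at +oo. *)
Definition log_iter (R : realType) (k : nat) (x : R) : R := iter k (@ln R) x.

Definition sum_upto (R : realType) (f : nat -> R) (x : R) : R :=
  \sum_(1 <= n < (Num.truncn x).+1) f n.

Definition asymp_equiv (R : realType) (f g : R -> R) : Prop :=
  f x / g x @[x --> +oo] --> (1 : R).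

(* Main.v *)
(* The quotient psi m / m is the product of 1 + 1/p over the primes p | m, so
   log (psi (psi n) / psi n) is the sum of log (1 + 1/p) over the primes p
   dividing psi n. Put t = log log x and l = log t. For most n <= x, the number
   psi n is divisible by all primes p <= t / l^2 and by few primes p > t l^2,
   which makes the sum equal to the sum over all p <= t up to o(1), that is to
   log l + gamma - log (pi^2 / 6) + o(1) by Mertens' theorem.

   Small primes: p divides psi n as soon as n has a prime factor q = -1 mod p.
   By Turan's inequality the exceptions number O(x / S), where S is the sum of
   1/q over such q <= x, and S >= t / (4 p) uniformly for 252 p log (2 p) <= t.
   The latter follows from Dirichlet's argument with explicit lower bounds for
   the L-functions modulo p near 1.

   Large primes: S = O(t log p / p) by a Chebyshev argument, because the product
   of k p - 1 over k <= K is divisible by the part of K! prime to p and by every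
   prime q = -1 mod p with K < q < K p, while it is at most p^K K!. For the
   exponential moments, the primes in (t l^2, t^3] have a bounded total weight,
   and the prime factors of psi n beyond t^3 have total weight at most
   log t + O(1), but they have mean weight O(l / t^2). *)

Require Import Defs.
From mathcomp Require Import all_boot all_order all_algebra.
From mathcomp Require Import all_classical all_reals all_analysis.
From mathcomp Require Import lra ring zify.
From mathcomp Require Import all_solvable all_field.
From mathcomp Require Import complex.
Set Implicit Arguments.
Unset Strict Implicit.
Unset Printing Implicit Defensive.
Import Order.TTheory GRing.Theory Num.Theory.
Import numFieldNormedType.Exports.
Import ComplexField Normc.
Local Open Scope classical_set_scope.
Local Open Scope ring_scope.

(** The obstacle is uniformity: the primes p up to t / l^2 grow with x, and the sum of 1/q over q =
    -1 mod p needs a lower bound valid for all of them. Since p log (2 p) is at most t / 252, x is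
    doubly exponential in p log p, so weak information suffices: real points within exp (- 20 p log
    (2 p)) of 1 are enough, and no zero-free region is required. Only the class of -1 matters, and
    chi(-1) is 1 or -1, hence real. Orthogonality can therefore be applied to log |L| alone, without
    complex logarithms. A non-real character is controlled by its conjugate and a Lipschitz bound,
    the quadratic one by an elementary lower bound for L(1). The constant in Mertens' theorem comes
    from comparing sums over dyadic blocks of primes with zeta (1 + e) as e tends to 0; the weights
    log (1 + 1/p) bring in zeta (2 + 2 e), whence pi^2 / 6. In the mean values the exponentials are
    linearised on bounded ranges, so that only first moments of the exceptional weights are
    needed. *)

Section RealFacts.
Context {R : realType}.
Implicit Types (x y s e : R).

Lemma ln_le_subr1 x : 0 < x -> ln x <= x - 1.
Proof. by move=> x0; have := @le_ln1Dx R (x - 1); rewrite (addrC 1) subrK; apply; lra. Qed.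

Lemma ln_ge_1subV x : 0 < x -> 1 - x^-1 <= ln x.
Proof.
move=> x0; have xi : 0 < x^-1 by rewrite invr_gt0.
by have := ln_le_subr1 xi; rewrite lnV ?posrE//; lra.
Qed.

Lemma invS_le_ln (n : nat) : (0 < n)%N -> (n.+1%:R)^-1 <= ln n.+1%:R - ln n%:R :> R.
Proof.
move=> n0; have nR : 0 < n%:R :> R by rewrite ltr0n.
rewrite -ln_div ?posrE//; apply: le_trans _ (ln_ge_1subV _); last exact: divr_gt0.
rewrite invf_div -(natr1 n) le_eqVlt; apply/orP; left; apply/eqP.
by field; rewrite gt_eqF//; lra.
Qed.

Lemma lnS_sub_le (n : nat) : (0 < n)%N -> ln n.+1%:R - ln n%:R <= (n%:R)^-1 :> R.
Proof.
move=> n0; have nR : 0 < n%:R :> R by rewrite ltr0n.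
rewrite -ln_div ?posrE//; apply: le_trans (ln_le_subr1 _) _; first exact: divr_gt0.
by rewrite -(natr1 n) mulrDl divff ?gt_eqF// addrC addKr mul1r.
Qed.

Lemma powRNE (n : nat) s : (0 < n)%N -> (n%:R : R) `^ (- s) = expR (- (s * ln n%:R)).
Proof. by move=> n0; rewrite /powR pnatr_eq0 (gtn_eqF n0) mulNr. Qed.

Lemma powRN1D (n : nat) s : (0 < n)%N -> (n%:R : R) `^ (- (1 + s)) = n%:R `^ (- s) / n%:R.
Proof.
by move=> n0; rewrite !powRNE// mulrDl mul1r opprD addrC expRB lnK// posrE ltr0n.
Qed.

Lemma telescope_sumr_nat (f : nat -> R) (m n : nat) : (m <= n)%N ->
  \sum_(m <= i < n) (f i - f i.+1) = f m - f n.
Proof.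
move=> mn; rewrite -(opprB (f n)) -(telescope_sumr f mn) -sumrN.
by apply: eq_bigr => i _; rewrite opprB.
Qed.

(** The integral test in telescoping form: the role of the integral is played by differences of
    n^(-e) / e. *)
Lemma powRN_tail (e : R) (M N : nat) : 0 < e -> (0 < M)%N -> (M <= N)%N ->
  \sum_(M.+1 <= n < N.+1) (n%:R : R) `^ (- (1 + e)) <= (M%:R : R) `^ (- e) / e.
Proof.
move=> e0 M0 MN.
suff H : \sum_(M.+1 <= n < N.+1) (n%:R : R) `^ (- (1 + e)) <=
   \sum_(M <= n < N) (((n%:R : R) `^ (- e) / e) - ((n.+1%:R : R) `^ (- e) / e)).
  rewrite (le_trans H)// telescope_sumr_nat// lerBlDr lerDl.
  by rewrite divr_ge0 ?powR_ge0// ltW.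
rewrite big_add1 /= !big_nat; apply: ler_sum => n /andP[Mn _].
have n0 : (0 < n)%N by apply: leq_trans Mn.
have nR : 0 < n%:R :> R by rewrite ltr0n.
rewrite -mulrBl ler_pdivlMr// powRN1D// !powRNE//.
have -> : - (e * ln n%:R) = - (e * ln n.+1%:R) + e * (ln n.+1%:R - ln n%:R) :> R by ring.
rewrite (expRD (- _)) -[X in _ - X]mulr1 -mulrBr -mulrA.
rewrite ler_pM2l ?expR_gt0// [X in X <= _]mulrC.
have h := @expR_ge1Dx R (e * (ln n.+1%:R - ln n%:R)).
have H := ler_wpM2l (ltW e0) (invS_le_ln n0).
by rewrite lerBrDl (le_trans _ h)// lerD2l.
Qed.

Lemma powRN_partial_sum_ge (e : R) (N : nat) : 0 < e ->
  (1 - (N.+1%:R : R) `^ (- e)) / e <= \sum_(1 <= n < N.+1) (n%:R : R) `^ (- (1 + e)).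
Proof.
move=> e0.
suff H : \sum_(1 <= n < N.+1) (((n%:R : R) `^ (- e) / e) - ((n.+1%:R : R) `^ (- e) / e))
  <= \sum_(1 <= n < N.+1) (n%:R : R) `^ (- (1 + e)).
  by rewrite (le_trans _ H)// telescope_sumr_nat// powR1 mulrBl.
rewrite !big_nat; apply: ler_sum => n /andP[n0 _].
have nR : 0 < n%:R :> R by rewrite ltr0n.
rewrite -mulrBl ler_pdivrMr// powRN1D// !powRNE//.
have -> : - (e * ln n.+1%:R) = - (e * ln n%:R) - e * (ln n.+1%:R - ln n%:R) :> R by ring.
rewrite (expRD (- _)) -[X in X - _]mulr1 -mulrBr -mulrA.
rewrite ler_pM2l ?expR_gt0//.
have h := @expR_ge1Dx R (- (e * (ln n.+1%:R - ln n%:R))).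
have H := ler_wpM2l (ltW e0) (lnS_sub_le n0); rewrite lerBlDr -lerBlDl [_^-1 * e]mulrC.
by rewrite (le_trans _ h)// lerD2l lerN2.
Qed.

Lemma powRN_partial_sum_le (e : R) (N : nat) : 0 < e ->
  \sum_(1 <= n < N.+1) (n%:R : R) `^ (- (1 + e)) <= 1 + e^-1.
Proof.
move=> e0; case: N => [|N]; first by rewrite big_geq// addr_ge0// invr_ge0 ltW.
rewrite big_ltn// powR1 lerD2l (le_trans (powRN_tail e0 _ _))//.
by rewrite powR1 div1r.
Qed.

Lemma powRN_le (n : nat) s s' : (0 < n)%N -> s <= s' ->
  (n%:R : R) `^ (- s') <= (n%:R : R) `^ (- s).
Proof. by move=> n0 ss; apply: ler_powR; [rewrite ler1n|rewrite lerN2]. Qed.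

Lemma powRN_nincr (m n : nat) s : (0 < m <= n)%N -> 0 <= s ->
  (n%:R : R) `^ (- s) <= (m%:R : R) `^ (- s).
Proof.
move=> /andP[m0 mn] s0; rewrite !powRNE ?(leq_trans m0)//.
rewrite ler_expR lerN2 ler_wpM2l// ler_ln ?posrE ?ltr0n ?ler_nat ?(leq_trans m0)//.
Qed.

Lemma powRN2_tail (M N : nat) : (0 < M)%N ->
  \sum_(M.+1 <= n < N.+1) (n%:R : R)^-2 <= (M%:R)^-1.
Proof.
move=> M0; case: (leqP M N) => MN; last by rewrite big_geq ?invr_ge0// ltnW.
suff H : \sum_(M.+1 <= n < N.+1) (n%:R : R) ^- 2 <=
   \sum_(M <= n < N) ((n%:R : R)^-1 - (n.+1%:R)^-1).
  by rewrite (le_trans H)// telescope_sumr_nat// lerBlDr lerDl invr_ge0.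
rewrite big_add1 /= !big_nat; apply: ler_sum => n /andP[Mn _].
have nR : 0 < n%:R :> R by rewrite ltr0n (leq_trans M0).
have n1 : 0 < n%:R + 1 :> R by lra.
rewrite -!(natr1 n); set k := n%:R in nR n1 *.
have -> : k^-1 - (k + 1)^-1 = (k * (k+1))^-1 by field; rewrite ?lt0r_neq0//.
rewrite lef_pV2 ?posrE ?mulr_gt0// ?exprn_gt0//.
by rewrite expr2 ler_pM2r//; lra.
Qed.

Lemma abel_summation (K : pzRingType) (c b : nat -> K) (m n : nat) : (m <= n)%N ->
  \sum_(m <= i < n) c i * b i =
  \sum_(m <= i < n) (\sum_(m <= j < i.+1) c j) * (b i - b i.+1)
    + (\sum_(m <= j < n) c j) * b n.
Proof.
move=> /subnK <-; elim: (n - m)%N => [|k IH]; first by rewrite !big_geq// mul0r addr0.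
rewrite addSn !(big_nat_recr (k + m)%N) ?leq_addl//= IH.
by rewrite -[RHS]addrA -mulrDr subrK mulrDl addrA.
Qed.

Lemma ln_prod (I : Type) (r : seq I) (P : pred I) (F : I -> R) :
  (forall i, P i -> 0 < F i) ->
  ln (\prod_(i <- r | P i) F i) = \sum_(i <- r | P i) ln (F i).
Proof.
move=> F0.
suff [] : 0 < \prod_(i <- r | P i) F i /\
  ln (\prod_(i <- r | P i) F i) = \sum_(i <- r | P i) ln (F i) by [].
elim/big_ind2 : _ => [|x a y b [x0 <-] [y0 <-]|i Pi]; first by rewrite ln1.
  by rewrite lnM ?posrE// mulr_gt0.
by split => //; exact: F0.
Qed.

End RealFacts.

(** * Complex series and Euler products *)

Section ComplexLimits.
Context {R : realType}.
Local Notation C := (R[i]%C).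
Implicit Types (u v : nat -> C) (z w l : C).

(** Convergence is phrased with [normc], whose values lie in [R], whereas the norm of R[i] takes its
    values in R[i]. *)
Definition ccvg u l := forall e : R, 0 < e ->
  exists N, forall n, (N <= n)%N -> normc (u n - l) <= e.

Lemma normc_real (x : R) : normc (x%:C)%C = `|x|.
Proof. by rewrite /normc /= expr0n addr0 sqrtr_sqr. Qed.

Lemma normc_ge0 z : 0 <= normc z.
Proof. by case: z => a b; rewrite /normc sqrtr_ge0. Qed.

Lemma normc_distC z w : normc (z - w) = normc (w - z).
Proof. by rewrite -normcN opprB. Qed.

Lemma ler_normc_distD w z l : normc (z - l) <= normc (z - w) + normc (w - l).
Proof. by rewrite (le_trans _ (le_normcD _ _))// addrA subrK. Qed.

Lemma normc_subr_le z w : normc z - normc w <= normc (z - w).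
Proof. by rewrite lerBlDr (le_trans _ (le_normcD _ _))// subrK. Qed.

Lemma normc_sum (I : Type) (r : seq I) (P : pred I) (F : I -> C) :
  normc (\sum_(i <- r | P i) F i) <= \sum_(i <- r | P i) normc (F i).
Proof.
elim/big_ind2 : _ => [|z a w b za wb|//]; first by rewrite normc0.
by rewrite (le_trans (le_normcD _ _))// lerD.
Qed.

Lemma normc_prod (I : Type) (r : seq I) (P : pred I) (F : I -> C) :
  normc (\prod_(i <- r | P i) F i) = \prod_(i <- r | P i) normc (F i).
Proof. by elim/big_ind2 : _ => [|z a w b <- <-|//]; rewrite ?normc1 ?normcM. Qed.

Lemma normcX z n : normc (z ^+ n) = normc z ^+ n.
Proof. by elim: n => [|n IH]; rewrite ?normc1// !exprS normcM IH. Qed.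

Lemma normc_Re z : `|complex.Re z| <= normc z.
Proof.
case: z => a b; rewrite /normc /= -sqrtr_sqr ler_wsqrtr// lerDl sqr_ge0//.
Qed.

Lemma normc_Im z : `|complex.Im z| <= normc z.
Proof.
case: z => a b; rewrite /normc /= -sqrtr_sqr ler_wsqrtr// lerDr sqr_ge0//.
Qed.

Lemma normc_le_ReIm z : normc z <= `|complex.Re z| + `|complex.Im z|.
Proof.
rewrite [z in normc z]complexE (le_trans (le_normcD _ _))//.
by rewrite normcM !normc_real lerD2l /normc expr0n add0r expr1n sqrtr1 mul1r.
Qed.

Lemma ccvgB u v l l' : ccvg u l -> ccvg v l' -> ccvg (fun n => u n - v n) (l - l').
Proof.
move=> ul vl e e0; have e2 : 0 < e / 2 by lra.
have [N1 H1] := ul _ e2; have [N2 H2] := vl _ e2.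
exists (maxn N1 N2) => n; rewrite geq_max => /andP[/H1 h1 /H2 h2].
have -> : u n - v n - (l - l') = (u n - l) - (v n - l') by ring.
by rewrite (le_trans (le_normcD _ _))// normcN (splitr e) lerD.
Qed.

Lemma ccvgMl u l z : ccvg u l -> ccvg (fun n => z * u n) (z * l).
Proof.
move=> ul e e0; have z1 : 0 < normc z + 1 by have := normc_ge0 z; lra.
have [N H] := ul (e / (normc z + 1)) (divr_gt0 e0 z1).
exists N => n /H h; rewrite -mulrBr normcM.
move: h; rewrite ler_pdivlMr// mulrDr mulr1 mulrC.
by have := normc_ge0 (u n - l); lra.
Qed.

Lemma ccvg_divn u l (q : nat) : (0 < q)%N -> ccvg u l -> ccvg (fun n => u (n %/ q)%N) l.
Proof.
move=> q0 ul e /ul[N H]; exists (N * q)%N => n Nn; apply: H.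
by rewrite leq_divRL.
Qed.

Lemma ccvg_real (u : nat -> R) (l : R) : u @ \oo --> l ->
  ccvg (fun n => (u n)%:C%C) (l%:C)%C.
Proof.
move=> /cvgrPdist_le ul e e0; have [N _ H] := ul _ e0; exists N => n /H.
have -> : (u n)%:C%C - l%:C%C = (u n - l)%:C%C by rewrite rmorphB.
by rewrite normc_real distrC.
Qed.

Lemma ccvg_normc_le u l z (b : R) (M : nat) : ccvg u l ->
  (forall n, (M <= n)%N -> normc (u n - z) <= b) -> normc (l - z) <= b.
Proof.
move=> ul H; apply/ler_addgt0Pr => e /ul[N h].
rewrite (le_trans (ler_normc_distD (u (maxn M N)) _ _))// addrC lerD//.
  by rewrite H// leq_maxl.
by rewrite normc_distC h// leq_maxr.
Qed.

Lemma ccvg_ext u v l : u =1 v -> ccvg u l -> ccvg v l.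
Proof. by move=> uv ul e /ul[N H]; exists N => n; rewrite -uv; exact: H. Qed.

Lemma real_cauchy_tail (u : nat -> R) (tau : nat -> R) (M0 : nat) :
  tau @ \oo --> (0 : R) ->
  (forall M N, (M0 <= M <= N)%N -> `|u N - u M| <= tau M) -> cvgn u.
Proof.
move=> /cvgrPdist_le t0 H; apply/cauchy_cvgP/cauchy_exP => e e0.
have [N0 _ h] := t0 (e / 3) (divr_gt0 e0 (ltr0n _ 3)).
pose M := maxn N0 M0.
have tM : tau M <= e / 3.
  by have := h M (leq_maxl _ _); rewrite sub0r normrN; apply: le_trans; exact: ler_norm.
exists (u M); exists M => // n /= Mn; rewrite -ball_normE /ball_ /= distrC.
rewrite (le_lt_trans (H _ _ _)) ?leq_maxr//=; lra.
Qed.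

Lemma ccvg_cauchy u (tau : nat -> R) (M0 : nat) : tau @ \oo --> (0 : R) ->
  (forall M N, (M0 <= M <= N)%N -> normc (u N - u M) <= tau M) ->
  exists l, ccvg u l.
Proof.
move=> t0 H.
have cR : cvgn (fun n => complex.Re (u n)).
  apply: (@real_cauchy_tail _ tau M0 t0) => M N MN; apply: le_trans (H _ _ MN).
  by rewrite (le_trans _ (normc_Re _))// raddfB.
have cI : cvgn (fun n => complex.Im (u n)).
  apply: (@real_cauchy_tail _ tau M0 t0) => M N MN; apply: le_trans (H _ _ MN).
  by rewrite (le_trans _ (normc_Im _))// raddfB.
exists (Complex (limn (fun n => complex.Re (u n))) (limn (fun n => complex.Im (u n)))).
move=> e e0; have e2 : 0 < e / 2 by lra.
have /cvgrPdist_le /(_ _ e2)[N1 _ H1] := cR.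
have /cvgrPdist_le /(_ _ e2)[N2 _ H2] := cI.
exists (maxn N1 N2) => n; rewrite geq_max => /andP[/H1 h1 /H2 h2].
rewrite (le_trans (normc_le_ReIm _))// !raddfB /= (splitr e).
by rewrite lerD// distrC.
Qed.

End ComplexLimits.

Lemma big_nat_dvd (V : nmodType) (q X : nat) (P : pred nat) (F : nat -> V) : (0 < q)%N ->
  \sum_(1 <= n < X.+1 | (q %| n)%N && P n) F n =
  \sum_(1 <= m < (X %/ q).+1 | P (q * m)%N) F (q * m)%N.
Proof.
move=> q0; elim: X => [|X IH]; first by rewrite div0n !big_geq.
rewrite big_mkcond big_nat_recr//= -big_mkcond /= IH divnS//.
case: (boolP (q %| X.+1)%N) => qX /=; last by rewrite add0n addr0.
rewrite add1n [RHS]big_mkcond big_nat_recr//= -big_mkcond /=.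
suff -> : (q * (X %/ q).+1 = X.+1)%N by [].
by have := divnS X q0; rewrite qX add1n => <-; rewrite mulnC divnK.
Qed.

Section EulerProduct.
Context {R : realType}.
Local Notation C := (R[i]%C).
Variable f : nat -> C.
Hypothesis f1 : f 1 = 1.
Hypothesis fM : forall m n, f (m * n)%N = f m * f n.

Definition sifted (S : seq nat) (X : nat) :=
  \sum_(1 <= n < X.+1 | all (fun q => ~~ (q %| n)%N) S) f n.

(** The multiples of q are the q m with m sifted by the remaining primes, so they contribute f q
    times the sifted sum up to X / q, which has the same limit as the one up to X. *)
Lemma sifted_cvg (S : seq nat) l : uniq S -> all prime S ->
  ccvg (fun X => \sum_(1 <= n < X.+1) f n) l ->
  ccvg (sifted S) (l * \prod_(q <- S) (1 - f q)).
Proof.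
elim: S => [|q S IH] /=; first by rewrite big_nil mulr1.
move=> /andP[qS uS] /andP[pq pS] fl; have {}IH := IH uS pS fl.
have q0 := prime_gt0 pq.
rewrite big_cons mulrCA mulrBl mul1r.
apply: (@ccvg_ext _ (fun X => sifted S X - f q * sifted S (X %/ q))); last first.
  by apply: ccvgB => //; apply: ccvgMl; exact: ccvg_divn.
move=> X; rewrite /sifted /= [X in X - _](bigID (fun n => q %| n)%N) /=.
rewrite addrC [X in _ + X - _](eq_bigl (fun n => (q %| n)%N && all (fun q => ~~ (q %| n)%N) S)); last first.
  by move=> n; rewrite andbC.
rewrite big_nat_dvd// mulr_sumr.
rewrite [X in _ + X - _](eq_bigl (fun m => all (fun q => ~~ (q %| m)%N) S)); last first.
  move=> m; apply: eq_in_all => r rS /=; have pr := allP pS _ rS; rewrite Euclid_dvdM// (dvdn_prime2 pr pq).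
  by have -> : (r == q) = false by apply: contraNF qS => /eqP <-.
rewrite [X in _ + X - _](eq_bigr (fun m => f q * f m)); last by move=> m _; rewrite fM.
by rewrite addrK; apply: eq_bigl => n; rewrite andbC.
Qed.

(** An n with 1 < n <= N is removed by its least prime factor; the survivors are 1 and numbers above
    N. *)
Lemma sifted_primes (N X : nat) : (1 < N)%N -> (N <= X)%N ->
  normc (sifted [seq q <- iota 0 N.+1 | prime q] X - 1) <=
  \sum_(N.+1 <= n < X.+1) normc (f n).
Proof.
move=> N0 NX; rewrite /sifted big_ltn_cond ?ltnS; last by lia.
have -> /= : all (fun q => ~~ (q %| 1)%N) [seq q <- iota 0 N.+1 | prime q].
  by apply/allP => q; rewrite mem_filter dvdn1 => /andP[+ _]; apply: contraL => /eqP ->.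
rewrite f1 addrAC subrr add0r (le_trans (normc_sum _ _ _))//.
rewrite (@big_cat_nat _ _ _ N.+1)//=; [|lia].
rewrite big_nat_cond big1 ?add0r; last first.
  move=> n /andP[/andP[n1 nN] /allP /(_ (pdiv n))].
  rewrite mem_filter pdiv_prime// mem_iota /= pdiv_dvd => H; exfalso.
  have pn := leq_ltn_trans (pdiv_leq (ltnW n1)) nN.
  by move: H; rewrite pn pdiv_gt0 => /(_ isT).
by rewrite big_mkcond /=; apply: ler_sum => n _; case: ifP => // _; rewrite normc_ge0.
Qed.

(* Multiplying the series by 1 - f q for the primes q <= N in turn sieves out
   their multiples. *)
Lemma euler_product_bound l (N : nat) (b : R) : (1 < N)%N ->
  ccvg (fun X => \sum_(1 <= n < X.+1) f n) l ->
  (forall X, (N <= X)%N -> \sum_(N.+1 <= n < X.+1) normc (f n) <= b) ->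
  normc (l * \prod_(0 <= q < N.+1 | prime q) (1 - f q) - 1) <= b.
Proof.
move=> N0 fl Hb.
rewrite -big_filter /index_iota subn0; apply: (ccvg_normc_le (M := N)).
  by apply: sifted_cvg => //; [rewrite filter_uniq ?iota_uniq|exact: filter_all].
by move=> X NX; rewrite (le_trans (sifted_primes N0 NX))// Hb.
Qed.

End EulerProduct.

Lemma powRN_div_cvg0 {R : realType} (e : R) : 0 < e ->
  (fun M => (M%:R : R) `^ (- e) / e) @ \oo --> (0 : R).
Proof.
move=> e0.
  rewrite -[0 in X in _ --> X](mul0r e^-1); apply: cvgMl.
  apply/cvgrPdist_le => d d0; near=> n.
  have n0 : (0 < n)%N by near: n; exists 1%N.
  rewrite sub0r normrN ger0_norm ?powR_ge0// powRNE//.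
  rewrite -[leRHS]lnK ?posrE// ler_expR lerNl.
  rewrite mulrC -ler_pdivrMr//.
  rewrite -ler_expR lnK ?posrE ?ltr0n//.
  by near: n; exact: nbhs_infty_ger.
Unshelve. all: by end_near. Qed.

(** * L-series of completely multiplicative functions on the real line *)

Section LSeries.
Context {R : realType}.
Local Notation C := (R[i]%C).
Variable chi : nat -> C.

Definition lterm (s : R) (n : nat) : C := chi n * (((n%:R : R) `^ (- s))%:C)%C.
Definition lpart (s : R) (X : nat) : C := \sum_(1 <= n < X.+1) lterm s n.

Hypothesis chi1 : chi 1 = 1.
Hypothesis chiM : forall m n, chi (m * n)%N = chi m * chi n.
Hypothesis chi_le1 : forall n, normc (chi n) <= 1.

Lemma lterm1 s : lterm s 1 = 1.
Proof. by rewrite /lterm chi1 powR1 mul1r. Qed.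

Lemma ltermM s m n : lterm s (m * n) = lterm s m * lterm s n.
Proof. by rewrite /lterm chiM natrM powRM// rmorphM /=; ring. Qed.

Lemma normc_lterm s n : normc (lterm s n) <= (n%:R : R) `^ (- s).
Proof.
rewrite /lterm normcM normc_real ger0_norm ?powR_ge0//.
by rewrite ler_piMl ?powR_ge0.
Qed.

Lemma lterm_tail (e : R) (M N : nat) : 0 < e -> (0 < M)%N -> (M <= N)%N ->
  \sum_(M.+1 <= n < N.+1) normc (lterm (1 + e) n) <= (M%:R : R) `^ (- e) / e.
Proof.
move=> e0 M0 MN; apply: le_trans (powRN_tail e0 M0 MN).
by apply: ler_sum => n _; exact: normc_lterm.
Qed.

Lemma lpartB s (M N : nat) : (M <= N)%N ->
  lpart s N - lpart s M = \sum_(M.+1 <= n < N.+1) lterm s n.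
Proof.
move=> MN; rewrite /lpart (@big_cat_nat _ _ _ M.+1 _ N.+1)//=.
by rewrite addrAC subrr add0r.
Qed.

Lemma lpart_cvg (e : R) : 0 < e -> exists l, ccvg (lpart (1 + e)) l.
Proof.
move=> e0; apply: (@ccvg_cauchy _ _ (fun M => (M%:R : R) `^ (- e) / e) 1).
  exact: powRN_div_cvg0.
move=> M N /andP[M0 MN]; rewrite lpartB// (le_trans (normc_sum _ _ _))//.
exact: lterm_tail.
Qed.

Lemma lseries_euler (e : R) l (N : nat) : 0 < e -> (1 < N)%N ->
  ccvg (lpart (1 + e)) l ->
  normc (l * \prod_(0 <= q < N.+1 | prime q) (1 - lterm (1 + e) q) - 1)
    <= (N%:R : R) `^ (- e) / e.
Proof.
move=> e0 N1 le; apply: euler_product_bound => //; first exact: lterm1.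
  exact: ltermM.
by move=> X NX; apply: lterm_tail => //; exact: ltnW.
Qed.

Variable B : R.
Hypothesis chi_sum : forall N, normc (\sum_(0 <= n < N) chi n) <= B.

Lemma lseries_B0 : 0 <= B.
Proof. exact: le_trans (normc_ge0 _) (chi_sum 0). Qed.

Lemma chi_interval (m n : nat) : normc (\sum_(m <= i < n) chi i) <= 2 * B.
Proof.
have B0 := lseries_B0.
case: (leqP m n) => mn; last by rewrite big_geq ?normc0 ?mulr_ge0 1?ltnW.
have -> : \sum_(m <= i < n) chi i = \sum_(0 <= i < n) chi i - \sum_(0 <= i < m) chi i.
  by rewrite (@big_cat_nat _ _ _ m 0 n)//= addrAC subrr add0r.
by rewrite (le_trans (le_normcD _ _))// normcN mulr2n mulrDl mul1r lerD.
Qed.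

(** Dirichlet's test: Abel summation against decreasing weights. It uses only the bound on the
    partial sums of [chi], and is applied again to a Lambert series and to blocks of primes. *)
Lemma chi_weighted_sum (b : nat -> R) (m n : nat) :
  (forall i, (m <= i)%N -> 0 <= b i) ->
  (forall i, (m <= i)%N -> b i.+1 <= b i) ->
  normc (\sum_(m <= i < n) chi i * (b i)%:C%C) <= 2 * B * b m.
Proof.
have B0 := lseries_B0.
move=> b0 bd; case: (leqP m n) => mn; last first.
  by rewrite big_geq ?normc0 ?mulr_ge0 ?b0// ltnW.
rewrite abel_summation// (le_trans (le_normcD _ _))//.
have -> : 2 * B * b m = \sum_(m <= i < n) (2 * B) * (b i - b i.+1) + 2 * B * b n.
  by rewrite -mulr_sumr telescope_sumr_nat// -mulrDr subrK.
rewrite lerD//; last first.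
  rewrite normcM normc_real ger0_norm ?b0// ler_wpM2r ?b0//.
  exact: chi_interval.
rewrite (le_trans (normc_sum _ _ _))// !big_nat; apply: ler_sum => i /andP[mi _].
rewrite normcM -rmorphB normc_real ger0_norm ?subr_ge0 ?bd//.
by rewrite ler_wpM2r ?subr_ge0 ?bd//; exact: chi_interval.
Qed.

Lemma lterm_interval s (m n : nat) : 0 <= s -> (0 < m)%N ->
  normc (\sum_(m <= i < n) lterm s i) <= 2 * B * (m%:R : R) `^ (- s).
Proof.
move=> s0 m0; apply: chi_weighted_sum => i mi; first exact: powR_ge0.
by apply: powRN_nincr => //; lia.
Qed.

Lemma lseries_le s l : 0 <= s -> ccvg (lpart s) l -> normc l <= 2 * B.
Proof.
move=> s0 sl; rewrite -[l]subr0; apply: (ccvg_normc_le (M := 0) sl) => n _.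
by rewrite subr0 (le_trans (lterm_interval _ _ _))// powR1 mulr1.
Qed.

Lemma lpart_cvg1 : exists l, ccvg (lpart 1) l.
Proof.
apply: (@ccvg_cauchy _ _ (fun M => 2 * B * (M.+1%:R)^-1) 0).
  rewrite -[0 in X in _ --> X](mulr0 (2 * B)); apply: cvgMr; exact: cvg_harmonic.
move=> M N /= MN; rewrite lpartB// (le_trans (lterm_interval _ _ _))//.
by rewrite powR_inv1.
Qed.

Lemma powRN_step (d : R) (i : nat) : 0 <= d -> (0 < i)%N ->
  (i%:R : R) `^ (- d) - (i.+1%:R : R) `^ (- d) <= d / i%:R.
Proof.
move=> d0 i0; rewrite !powRNE//.
have -> : - (d * ln i.+1%:R) = - (d * ln i%:R) - d * (ln i.+1%:R - ln i%:R) :> R by ring.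
rewrite (expRD (- _)) -[X in X - _]mulr1 -mulrBr.
have h := @expR_ge1Dx R (- (d * (ln i.+1%:R - ln i%:R))).
have h1 : expR (- (d * ln i%:R)) <= 1 :> R.
  by rewrite -[leRHS]expR0 ler_expR oppr_le0 mulr_ge0// ln_ge0 ?ler1n.
have h2 := @lnS_sub_le R i i0.
have h3 : 0 <= ln i.+1%:R - ln i%:R :> R by rewrite subr_ge0 ler_ln ?posrE ?ltr0n ?ler_nat.
set a := ln _ - ln _ in h h2 h3 *.
have da : 0 <= d * a by rewrite mulr_ge0.
have h4 : 1 - expR (- (d * a)) <= d * a by lra.
have h5 : 0 <= 1 - expR (- (d * a)).
  by rewrite subr_ge0 -[leRHS]expR0 ler_expR oppr_le0.
apply: (@le_trans _ _ (d * a)); last exact: ler_wpM2l.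
by rewrite (le_trans _ h4)// ler_piMl.
Qed.

(** The difference has terms [lterm s n] times 1 - n^(-d), a factor increasing from 0 at n = 1.
    Summation by parts leaves tails, at most 2 B / (i + 1), times increments, at most d / i, and the
    sum of 1 / (i (i + 1)) telescopes to at most 1. *)
Lemma lseries_lipschitz s s' l l' : 1 <= s -> s <= s' ->
  ccvg (lpart s) l -> ccvg (lpart s') l' -> normc (l - l') <= 2 * B * (s' - s).
Proof.
move=> s1 ss sl sl'; have B0 := lseries_B0.
rewrite -[l - l']subr0; apply: (ccvg_normc_le (M := 0) (ccvgB sl sl')) => X _.
rewrite subr0; set d := s' - s; have d0 : 0 <= d by rewrite subr_ge0.
pose e n : R := 1 - (n%:R : R) `^ (- d).
have -> : lpart s X - lpart s' X = \sum_(1 <= n < X.+1) lterm s n * (e n)%:C%C.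
  rewrite /lpart -sumrB; apply: eq_big_nat => n /andP[n0 _].
  rewrite /lterm /e -mulrBr -mulrA -rmorphM -rmorphB /=; congr (_ * (_)%:C%C).
  rewrite mulrBr mulr1; congr (_ - _).
  rewrite -powRD; last by rewrite pnatr_eq0 (gtn_eqF n0) implybT.
  by rewrite /d; congr (_ `^ _); ring.
have -> : \sum_(1 <= n < X.+1) lterm s n * (e n)%:C%C =
   \sum_(1 <= i < X.+1) (\sum_(i.+1 <= n < X.+1) lterm s n) * (e i.+1 - e i)%:C%C.
  have e1 : e 1%N = 0 by rewrite /e powR1 subrr.
  rewrite abel_summation//.
  have -> : (e X.+1)%:C%C = \sum_(1 <= i < X.+1) (e i.+1 - e i)%:C%C.
    by rewrite -rmorph_sum /= telescope_sumr// e1 subr0.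
  rewrite mulr_sumr -big_split /=; apply: eq_big_nat => i /andP[i0 iX].
  rewrite (@big_cat_nat _ _ _ i.+1 1 X.+1)//= mulrDl addrA -rmorphB -mulrDr -rmorphD /=.
  by rewrite addrA subrK subrr mulr0 add0r.
rewrite (le_trans (normc_sum _ _ _))//.
have step i : (0 < i)%N ->
    normc ((\sum_(i.+1 <= n < X.+1) lterm s n) * (e i.+1 - e i)%:C%C)
    <= 2 * B * d * ((i%:R)^-1 - (i.+1%:R)^-1).
  move=> i0; have iR : 0 < i%:R :> R by rewrite ltr0n.
  rewrite normcM normc_real.
  have -> : e i.+1 - e i = (i%:R : R) `^ (- d) - (i.+1%:R : R) `^ (- d).
    by rewrite /e; ring.
  rewrite ger0_norm; last by rewrite subr_ge0 powRN_nincr// i0 /=.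
  have -> : 2 * B * d * ((i%:R)^-1 - (i.+1%:R)^-1) = 2 * B * (i.+1%:R)^-1 * (d / i%:R).
    rewrite -natr1; field; rewrite gt_eqF//= gt_eqF//; lra.
  apply: ler_pM; [exact: normc_ge0|by rewrite subr_ge0 powRN_nincr// i0 /=| |exact: powRN_step].
  rewrite (le_trans (lterm_interval _ _ _)) ?(le_trans _ s1)//.
  rewrite ler_wpM2l ?mulr_ge0// -[X in _ <= X]powR_inv1//.
  by rewrite powRN_le.
rewrite (@le_trans _ _ (\sum_(1 <= i < X.+1) 2 * B * d * ((i%:R)^-1 - (i.+1%:R)^-1)))//.
  by rewrite !big_nat; apply: ler_sum => i /andP[i0 _]; exact: step.
rewrite -mulr_sumr telescope_sumr_nat// invr1 ler_piMr ?mulr_ge0//.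
Qed.

End LSeries.

(** * Quadratic characters: a lower bound at 1 *)

Section QuadraticCharacter.
Context {R : realType}.
Variable x : nat -> R.
Hypothesis x1 : x 1 = 1.
Hypothesis xM : forall m n, x (m * n)%N = x m * x n.
Hypothesis x_val : forall n, [\/ x n = 0, x n = 1 | x n = -1].

Definition divsum (X n : nat) : R := \sum_(1 <= d < X.+1 | (d %| n)%N) x d.

(* Monsky's argument: the Lambert series of x at t is the power series of
   divsum, whose coefficients are >= 0, and >= 1 at squares; it is compared with
   (sum of x n / n) / (1 - t) by Abel summation, and t = 1 - 1/K with K of order
   B^2. *)
Lemma divsum_prime_power (q a m X : nat) : prime q -> coprime q m -> (0 < m)%N ->
  divsum X (q ^ a.+1 * m) = divsum X m + x q * divsum (X %/ q) (q ^ a * m).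
Proof.
move=> pq qm m0; have q0 := prime_gt0 pq.
rewrite /divsum (bigID (fun d => q %| d)%N) /= addrC; congr (_ + _).
  apply: eq_bigl => d; case: (boolP (q %| d)%N) => /= qd.
    rewrite andbF; apply/esym/negbTE; apply: contraL qm => dm.
    by rewrite prime_coprime// negbK (dvdn_trans qd).
  by rewrite andbT Gauss_dvdr// coprime_sym coprimeXl// prime_coprime.
rewrite (eq_bigl (fun d => (q %| d)%N && (d %| q ^ a.+1 * m)%N)); last first.
  by move=> d; rewrite andbC.
rewrite big_nat_dvd// mulr_sumr.
rewrite (eq_bigl (fun d => (d %| q ^ a * m)%N)); last first.
  by move=> d; rewrite expnS -mulnA dvdn_pmul2l.
by apply: eq_bigr => d _; rewrite xM.
Qed.

Lemma divsum_bound (X Y n : nat) : (0 < n)%N -> (n <= X)%N -> (n <= Y)%N ->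
  divsum X n = divsum Y n.
Proof.
move=> n0.
suff H Z : (n <= Z)%N -> divsum Z n = divsum n n by move=> /H -> /H ->.
move=> nZ; rewrite /divsum (@big_cat_nat _ _ _ n.+1)//= addrC big_nat_cond big1 ?add0r//.
by move=> d /andP[/andP[nd _] /(dvdn_leq n0)]; lia.
Qed.

(** [divsum n n] is the product over primes q of 1 + x q + ... + (x q)^a with a = [logn q n]. For x
    q = 0, 1, -1 the factor is 1, a + 1, and the indicator of even a. The induction removes the
    least prime factor. *)
Lemma divsum_ge (n : nat) : (0 < n)%N ->
  0 <= divsum n n /\ ((forall r, ~~ odd (logn r n)) -> 1 <= divsum n n).
Proof.
have N01 : (0 : R) <> -1 by lra.
have N11 : (1 : R) <> -1 by lra.
have [k] := ubnP n; elim: k n => // k IH n nk n0.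
case: (leqP n 1) => n1.
  have -> : n = 1%N by lia.
  by rewrite /divsum big_mkcond big_nat1 dvd1n x1 ler01; split.
pose q := pdiv n; have pq : prime q by exact: pdiv_prime.
have [m qm nE] := pfactor_coprime pq n0.
have m0 : (0 < m)%N by move: n0; rewrite nE muln_gt0 => /andP[].
have lq : (0 < logn q n)%N by rewrite logn_gt0 mem_primes pq n0 pdiv_dvd.
have mn : (m < n)%N.
  by rewrite nE -[ltnLHS]muln1 ltn_mul2l m0 -[1%N](expn0 q) ltn_exp2l// prime_gt1.
have [IH0 IH1] := IH m (leq_trans mn nk) m0.
(* The last two clauses serve x q = -1, where the value alternates between [divsum m m] and 0 as a
   grows; inequalities alone would not survive the recursion. *)
have key a : divsum (q ^ a * m) (q ^ a * m) >= 0 /\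
   (~~ odd a -> divsum (q ^ a * m) (q ^ a * m) >= divsum m m) /\
   (x q = -1 -> odd a -> divsum (q ^ a * m) (q ^ a * m) = 0) /\
   (x q = -1 -> ~~ odd a -> divsum (q ^ a * m) (q ^ a * m) = divsum m m).
  elim: a => [|a [A0 [A1 [A2 A3]]]]; first by rewrite mul1n; do !split.
  have -> : divsum (q ^ a.+1 * m) (q ^ a.+1 * m) =
       divsum m m + x q * divsum (q ^ a * m) (q ^ a * m).
    rewrite divsum_prime_power// expnS -mulnA mulKn ?prime_gt0//.
    congr (_ + _); apply: divsum_bound => //.
    by rewrite mulnA leq_pmull// muln_gt0 prime_gt0//= expn_gt0 prime_gt0.
  rewrite /=; move: A0 A1 A2 A3; set D := divsum _ (q ^ a * m)%N; set E := divsum m m.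
  move=> A0 A1 A2 A3; case: (x_val q) => xq; rewrite xq.
  - rewrite mul0r addr0; split; first exact: IH0.
    by split=> [_|]; [exact: lexx|split=> /N01].
  - rewrite mul1r; split; first exact: addr_ge0.
    by split=> [_|]; [rewrite lerDl|split=> /N11].
  - have := A3 xq; have := A2 xq; case: (odd a) => /= B2 B3.
    + by rewrite B2// mulr0 addr0; split=> //; split=> //; split.
    + by rewrite B3// mulN1r subrr; split=> //; split=> //; split.
have nE' : n = (q ^ logn q n * m)%N by rewrite {1}nE mulnC.
have [K0 [K1 _]] := key (logn q n).
rewrite -nE' in K0 K1; split => // sq.
apply: le_trans (K1 (sq q)); apply: IH1 => r.
have := sq r; rewrite {1}nE lognM// ?expn_gt0 ?prime_gt0// lognX (logn_prime _ pq).
case: eqVneq => [->|_] /=; last by rewrite muln0 addn0.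
by move=> _; rewrite logn_coprime.
Qed.

Lemma divsum_sqr (n : nat) : (0 < n)%N -> 1 <= divsum (n ^ 2) (n ^ 2).
Proof.
move=> n0; have n20 : (0 < n ^ 2)%N by rewrite expn_gt0 n0.
by have [_] := divsum_ge n20; apply => r; rewrite lognX oddM.
Qed.

(** Only the M squares up to M^2 are counted; all other terms are nonnegative. *)
Lemma sum_divsum_ge (M : nat) : M%:R <= \sum_(1 <= n < (M ^ 2).+1) divsum n n.
Proof.
elim: M => [|M IH]; first by rewrite big_geq.
rewrite (@big_cat_nat _ _ _ (M ^ 2).+1)//=; last by rewrite ltnS leq_exp2r.
rewrite -natr1 lerD// big_nat_recr /=; last by rewrite ltn_exp2r.
apply: ler_wpDl; last exact: divsum_sqr.
by rewrite big_nat; apply: sumr_ge0 => i /andP[iM _]; apply: (divsum_ge _).1; lia.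
Qed.

Lemma sum_divsum_exp (t : R) (M X : nat) : 0 <= t <= 1 -> (M ^ 2 <= X)%N ->
  M%:R * t ^+ (M ^ 2) <= \sum_(1 <= n < X.+1) divsum X n * t ^+ n.
Proof.
move=> /andP[t0 t1] MX.
have -> : \sum_(1 <= n < X.+1) divsum X n * t ^+ n = \sum_(1 <= n < X.+1) divsum n n * t ^+ n.
  by apply: eq_big_nat => n /andP[n0 nX]; rewrite (@divsum_bound X n).
rewrite (@big_cat_nat _ _ _ (M ^ 2).+1)//=; apply: ler_wpDr.
  rewrite big_nat; apply: sumr_ge0 => i /andP[iM _].
  by rewrite mulr_ge0 ?exprn_ge0//; apply: (divsum_ge _).1; lia.
apply: (@le_trans _ _ (\sum_(1 <= n < (M ^ 2).+1) divsum n n * t ^+ (M ^ 2))).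
  by rewrite -mulr_suml ler_wpM2r ?exprn_ge0// sum_divsum_ge.
rewrite !big_nat; apply: ler_sum => i /andP[i1 iM].
rewrite ler_wpM2l ?(divsum_ge i1).1//.
by rewrite ler_wiXn2l.
Qed.

Lemma lambert_expand (t : R) (X d : nat) : 0 < t < 1 -> (0 < d)%N ->
  t ^+ d / (1 - t ^+ d) =
  \sum_(1 <= n < X.+1 | (d %| n)%N) t ^+ n + t ^+ (d * (X %/ d).+1) / (1 - t ^+ d).
Proof.
move=> /andP[t0 t1] d0.
have td : 1 - t ^+ d != 0.
  by rewrite subr_eq0 eq_sym lt_eqF// exprn_ilt1// -?lt0n// ltW.
rewrite (eq_bigl (fun n => (d %| n)%N && true)); last by move=> n; rewrite andbT.
rewrite big_nat_dvd//; elim: (X %/ d)%N => [|k IH].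
  by rewrite big_geq// muln1 add0r.
rewrite IH [in RHS]big_nat_recr//= -[RHS]addrA; congr (_ + _).
by rewrite (mulnS d k.+1) exprD; field.
Qed.

(** Arithmetic-geometric mean: the terms of index i and n - i are paired. *)
Lemma geom_mean (u : R) (n : nat) : 0 <= u ->
  n.+1%:R * u ^+ n <= \sum_(i < n.+1) (u ^+ 2) ^+ i.
Proof.
move=> u0.
have E : \sum_(i < n.+1) (u ^+ 2) ^+ i = \sum_(i < n.+1) (u ^+ 2) ^+ (n - i).
  rewrite (reindex_inj rev_ord_inj) /=; apply: eq_bigr => i _.
  by rewrite subSS.
suff : 2 * (n.+1%:R * u ^+ n) <= \sum_(i < n.+1) (u ^+ 2) ^+ i + \sum_(i < n.+1) (u ^+ 2) ^+ (n - i).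
  by rewrite -E; lra.
rewrite -big_split /=.
have -> : 2 * (n.+1%:R * u ^+ n) = \sum_(i < n.+1) 2 * u ^+ n.
  by rewrite sumr_const card_ord -mulr_natl; ring.
apply: ler_sum => i _; have ->: u ^+ n = u ^+ i * u ^+ (n - i).
  by rewrite -exprD subnKC// -ltnS.
rewrite -!exprM ![(2 * _)%N]mulnC !exprM.
by have := sqr_ge0 (u ^+ i - u ^+ (n - i)); lra.
Qed.

(** After clearing denominators the claim is n (n + 1) t^n <= s_n s_(n+1), where s_k = 1 + t + ... +
    t^(k-1). With u the square root of t, [geom_mean] gives s_k >= k u^(k-1), and u^(2n-1) >=
    t^n. *)
Lemma monsky_monotone (t : R) (n : nat) : 0 < t < 1 -> (0 < n)%N ->
  (n.+1%:R)^-1 / (1 - t) - t ^+ n.+1 / (1 - t ^+ n.+1) <=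
  (n%:R)^-1 / (1 - t) - t ^+ n / (1 - t ^+ n).
Proof.
move=> /andP[t0 t1]; case: n => // n _.
have s_gt0 k : 0 < \sum_(i < k.+1) t ^+ i.
  by rewrite big_ord_recl /= expr0 ltr_pwDl// sumr_ge0// => i _; rewrite exprn_ge0// ltW.
pose u := Num.sqrt t; have u0 : 0 <= u by exact: sqrtr_ge0.
have u1 : u <= 1 by rewrite -sqrtr1 ler_wsqrtr// ltW.
have uE : u ^+ 2 = t by rewrite sqr_sqrtr// ltW.
have h1 := geom_mean n u0; have h2 := geom_mean n.+1 u0.
rewrite uE in h1 h2.
have := s_gt0 n; have := s_gt0 n.+1.
set s1 := \sum_(i < n.+1) _ in h1 *; set s2 := \sum_(i < n.+2) _ in h2 *.
move=> s20 s10.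
have E1 : 1 - t ^+ n.+1 = (1 - t) * s1 by rewrite -opprB subrX1 -mulNr opprB.
have E2 : 1 - t ^+ n.+2 = (1 - t) * s2 by rewrite -opprB subrX1 -mulNr opprB.
have a0 : 0 < 1 - t by rewrite subr_gt0.
have sE : s2 = 1 + t * s1.
  rewrite /s2 /s1 mulr_sumr big_ord_recl /= expr0.
  by congr (_ + _); apply: eq_bigr => i _; rewrite -exprS.
have prod : n.+1%:R * n.+2%:R * t ^+ n.+1 <= s1 * s2.
  apply: (@le_trans _ _ ((n.+1%:R * u ^+ n) * (n.+2%:R * u ^+ n.+1))); last first.
    by apply: ler_pM => //; rewrite mulr_ge0 ?exprn_ge0.
  rewrite [leRHS]mulrACA ler_wpM2l ?mulr_ge0// -exprD -uE -exprM.
  by rewrite ler_wiXn2l//; lia.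
have n10 : 0 < n.+1%:R :> R by [].
have n20 : 0 < n.+2%:R :> R by [].
have nE : n.+2%:R = n.+1%:R + 1 :> R by rewrite natr1.
rewrite E1 E2 (exprS t n.+1); set T := t ^+ n.+1 in prod *.
set p := n.+1%:R in prod n10 nE *; set q := n.+2%:R in prod n20 nE *.
rewrite -subr_ge0.
have -> : p^-1 / (1 - t) - T / ((1 - t) * s1) - (q^-1 / (1 - t) - t * T / ((1 - t) * s2)) =
   ((s1 * s2 - p * q * T) / (p * q * (s1 * s2))) / (1 - t).
  rewrite nE in n20 *; rewrite sE in s20 *.
  by field; rewrite !gt_eqF.
apply: divr_ge0; last exact: ltW.
apply: divr_ge0; first by rewrite subr_ge0.
by apply/ltW; rewrite !mulr_gt0.
Qed.

Lemma monsky_ge0 (t : R) (n : nat) : 0 < t < 1 -> (0 < n)%N ->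
  0 <= (n%:R)^-1 / (1 - t) - t ^+ n / (1 - t ^+ n).
Proof.
move=> /andP[t0 t1]; case: n => // n _.
have a0 : 0 < 1 - t by rewrite subr_gt0.
set s := \sum_(i < n.+1) t ^+ i.
have E1 : 1 - t ^+ n.+1 = (1 - t) * s by rewrite -opprB subrX1 -mulNr opprB.
have sge : n.+1%:R * t ^+ n.+1 <= s.
  have -> : n.+1%:R * t ^+ n.+1 = \sum_(i < n.+1) t ^+ n.+1.
    by rewrite sumr_const card_ord mulr_natl.
  by apply: ler_sum => i _; rewrite ler_wiXn2l ?ltW// ltnW.
have n10 : 0 < n.+1%:R :> R by [].
have s0 : 0 < s by rewrite (lt_le_trans _ sge)// mulr_gt0// exprn_gt0.
rewrite E1 subr_ge0 invfM mulrA mulrAC ler_pM2r ?invr_gt0//.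
by rewrite ler_pdivrMr// [leRHS]mulrC ler_pdivlMr// mulrC.
Qed.

Variable B : nat.
Hypothesis B0 : (0 < B)%N.
Hypothesis x_sum : forall N, `|\sum_(0 <= n < N) x n| <= B%:R.

(** The real sequence is viewed in R[i] in order to apply [chi_weighted_sum]. *)
Let chi (n : nat) : R[i]%C := ((x n)%:C)%C.

Lemma exp_power_decay (K : R) (X : nat) : 1 < K -> (0 < X)%N ->
  X%:R * (1 - K^-1) ^+ X <= 4 * K ^+ 2 / X%:R.
Proof.
move=> K1 X0; have XR : 0 < X%:R :> R by rewrite ltr0n.
have K0 : 0 < K by lra.
have k0 : 0 <= 1 - K^-1 by rewrite subr_ge0 invf_le1// ltW.
have h : (1 - K^-1) ^+ X <= expR (- (X%:R / K)).
  have -> : - (X%:R / K) = X%:R * - K^-1 :> R by rewrite mulrN.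
  rewrite expRM_natl lerXn2r ?nnegrE ?expR_ge0//; exact: expR_ge1Dx.
have y0 : 0 < X%:R / K by rewrite divr_gt0.
have h2 : (X%:R / K) ^+ 2 / 4 <= expR (X%:R / K).
  have := expR_ge1Dxn 1 (ltW y0).
  have := sqr_ge0 (X%:R / K); rewrite (_ : 2`! = 2)//.
  by move: (expR _) (_ ^+ 2) => a b; lra.
rewrite -ler_pdivlMl// (le_trans h)// expRN -[leRHS]invrK lef_pV2 ?posrE ?expR_gt0//; last first.
  by rewrite invr_gt0 mulr_gt0 ?invr_gt0// divr_gt0// mulr_gt0// exprn_gt0.
rewrite (le_trans _ h2)// le_eqVlt; apply/orP; left; apply/eqP.
by field; rewrite !gt_eqF.
Qed.

(** At t = 1 - 1/K one has 1 / (1 - t) = K, so the right-hand side is the Lambert sum plus a sum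
    against the weights b, at most 2 B in absolute value. The Lambert sum is the power sum of
    [divsum], bounded below by its M squares and Bernoulli's inequality, up to a truncation error of
    order K^3 / X. *)
Lemma quadratic_partial_lower (K : R) (X M : nat) : 1 < K -> (M ^ 2 <= X)%N ->
  (0 < X)%N ->
  M%:R * (1 - (M ^ 2)%:R / K) - 4 * K ^+ 2 / X%:R * K  - 2 * B%:R <=
  (\sum_(1 <= n < X.+1) x n * (n%:R)^-1) * K.
Proof.
move=> K1 MX X0; have K0 : 0 < K by lra.
pose t := 1 - K^-1.
have Ki0 : 0 < K^-1 by rewrite invr_gt0.
have Ki1 : K^-1 < 1 by rewrite invf_lt1.
have t01 : 0 < t < 1 by rewrite /t; lra.
have /andP[t0 t1] := t01.
have tK : 1 - t = K^-1 by rewrite /t; ring.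
have tX d : (0 < d)%N -> 0 < 1 - t ^+ d.
  by move=> d0; rewrite subr_gt0 exprn_ilt1 ?ltW// -lt0n.
have bern : 1 - (M ^ 2)%:R / K <= t ^+ (M ^ 2).
  elim: (M ^ 2)%N => [|k IH]; first by rewrite mul0r subr0.
  rewrite exprS -natr1 mulrDl mul1r.
  have : t * t ^+ k = t ^+ k - K^-1 * t ^+ k by rewrite /t; ring.
  have : K^-1 * t ^+ k <= K^-1 by apply: ler_piMr; [exact: ltW|apply: exprn_ile1; exact: ltW].
  by move: IH; set a := t ^+ k; set c := K^-1; set b := k%:R / K; lra.
pose b n := (n%:R)^-1 / (1 - t) - t ^+ n / (1 - t ^+ n).
have Hb : `|\sum_(1 <= n < X.+1) x n * b n| <= 2 * B%:R.
  have H : forall N, normc (\sum_(0 <= n < N) chi n) <= B%:R.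
    move=> N; have -> : \sum_(0 <= n < N) chi n = ((\sum_(0 <= n < N) x n)%:C)%C.
      by rewrite rmorph_sum.
    by rewrite normc_real.
  have := @chi_weighted_sum R chi B%:R H b 1 X.+1.
  have -> : \sum_(1 <= i < X.+1) chi i * (b i)%:C%C = ((\sum_(1 <= i < X.+1) x i * b i)%:C)%C.
    by rewrite rmorph_sum /=; apply: eq_bigr => i _; rewrite rmorphM.
  rewrite normc_real => /(_ _ _)/le_trans; apply.
  - by move=> i i1; exact: monsky_ge0.
  - by move=> i i1; exact: monsky_monotone.
  - by rewrite /b invr1 mul1r !expr1 -{1}[(1 - t)^-1]mul1r -mulrBl divff ?mulr1// gt_eqF// subr_gt0.
have split_sum : (\sum_(1 <= n < X.+1) x n * (n%:R)^-1) * K =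
  \sum_(1 <= n < X.+1) x n * b n + \sum_(1 <= n < X.+1) x n * (t ^+ n / (1 - t ^+ n)).
  rewrite mulr_suml -big_split /=; apply: eq_bigr => n _.
  by rewrite -mulrDr /b subrK tK invrK mulrA.
have lam : \sum_(1 <= n < X.+1) x n * (t ^+ n / (1 - t ^+ n)) =
   \sum_(1 <= n < X.+1) divsum X n * t ^+ n +
   \sum_(1 <= d < X.+1) x d * (t ^+ (d * (X %/ d).+1) / (1 - t ^+ d)).
  rewrite (eq_big_nat _ _ (F2 := fun d => x d * \sum_(1 <= n < X.+1 | (d %| n)%N) t ^+ n
       + x d * (t ^+ (d * (X %/ d).+1) / (1 - t ^+ d)))); last first.
    by move=> d /andP[d0 _]; rewrite (lambert_expand X t01 d0) mulrDr.
  rewrite big_split /=; congr (_ + _).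
  under eq_bigr do rewrite mulr_sumr big_mkcond.
  rewrite exchange_big /=; apply: eq_bigr => n _.
  by rewrite /divsum mulr_suml [RHS]big_mkcond.
have rem : `|\sum_(1 <= d < X.+1) x d * (t ^+ (d * (X %/ d).+1) / (1 - t ^+ d))|
    <= 4 * K ^+ 2 / X%:R * K.
  rewrite (le_trans (ler_norm_sum _ _ _))//.
  apply: (@le_trans _ _ (\sum_(1 <= d < X.+1) t ^+ X * K)).
    rewrite !big_nat; apply: ler_sum => d /andP[d0 dX].
    rewrite normrM; have x1' : `|x d| <= 1.
      by case: (x_val d) => ->; rewrite ?normrN ?normr0 ?normr1.
    have q0 : 0 <= t ^+ (d * (X %/ d).+1) / (1 - t ^+ d).
      by rewrite divr_ge0 ?exprn_ge0 ?ltW ?tX.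
    rewrite (ger0_norm q0) (le_trans (ler_piMl q0 x1'))//.
    apply: ler_pM; [by rewrite exprn_ge0// ltW|by rewrite invr_ge0 ltW// tX| |].
      apply: ler_wiXn2l; [exact: ltW|exact: ltW|].
      by apply: ltnW; rewrite mulnC ltn_ceil.
    rewrite -[leRHS]invrK lef_pV2 ?posrE ?tX// -tK lerD2l lerN2.
    by rewrite -[leRHS]expr1; apply: ler_wiXn2l => //; exact: ltW.
  rewrite sumr_const_nat subSS subn0.
  by rewrite -mulrnAl -mulr_natl ler_pM2r// exp_power_decay.
have t01' : 0 <= t <= 1 by rewrite !ltW.
have sq := sum_divsum_exp t01' MX.
have mb : M%:R * (1 - (M ^ 2)%:R / K) <= M%:R * t ^+ (M ^ 2) by rewrite ler_wpM2l.
rewrite split_sum lam.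
move: Hb rem; rewrite !ler_norml => /andP[Hb _] /andP[rem _].
by move: Hb rem mb sq; lra.
Qed.

Lemma quadratic_lower (l : R) :
  (fun X => \sum_(1 <= n < X.+1) x n * (n%:R)^-1) @ \oo --> l ->
  (64 * B%:R)^-1 <= l.
Proof.
(* With M = 8 B, M^2 is half of K, so the main term is 4 B; subtracting 2 B and dividing by K leaves
   2 B / K = 1 / (64 B). *)
move=> xl; pose K : R := 128 * B%:R ^+ 2.
have BR : 1 <= B%:R :> R by rewrite ler1n.
have K1 : 1 < K by rewrite /K expr2; nra.
have K0 : 0 < K by lra.
have H X : ((8 * B) ^ 2 <= X)%N -> (0 < X)%N ->
   2 * B%:R / K - 4 * K ^+ 2 / X%:R <= \sum_(1 <= n < X.+1) x n * (n%:R)^-1.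
  move=> MX X0; have := quadratic_partial_lower K1 MX X0.
  have -> : (8 * B)%:R * (1 - ((8 * B) ^ 2)%:R / K) = 4 * B%:R :> R.
    by rewrite natrX natrM /K; field; rewrite pnatr_eq0 -lt0n.
  rewrite -ler_pdivrMr// => /(le_trans _); apply.
  rewrite ler_pdivlMr// mulrBl divfK ?gt_eqF//; lra.
suff : 2 * B%:R / K <= l.
  apply: le_trans; rewrite /K le_eqVlt; apply/orP; left; apply/eqP.
  by field; rewrite pnatr_eq0 -lt0n.
apply/ler_addgt0Pr => e e0.
have /cvgrPdist_le/(_ _ (divr_gt0 e0 (ltr0n _ 2)))[N1 _ h1] := xl.
pose N2 := (Num.truncn (8 * K ^+ 2 / e)).+1.
pose X := maxn N1 (maxn N2 ((8 * B) ^ 2)).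
have X0 : (0 < X)%N by rewrite /X !leq_max /N2 /= orbT.
have := h1 X (leq_maxl _ _).
have := H X; rewrite {1}/X !leq_max leqnn !orbT => /(_ isT isT).
have : 4 * K ^+ 2 / X%:R <= e / 2.
  rewrite ler_pdivrMr ?ltr0n//.
  have : 8 * K ^+ 2 / e <= X%:R.
    apply: (@le_trans _ _ N2%:R); first by rewrite /N2 ltW// truncnS_gt.
    by rewrite ler_nat /X leq_max leq_maxl orbT.
  by rewrite ler_pdivrMr//; lra.
by rewrite ler_norml => h2 h3 /andP[h4 h5]; lra.
Qed.

End QuadraticCharacter.

(** * Characters modulo a prime *)

Lemma complex_prim_root (R : realType) (n : nat) : (0 < n)%N ->
  exists w : R[i]%C, n.-primitive_root w.
Proof.
move=> n0; have [r Dp] := closed_field_poly_normal ('X^n - 1 : {poly R[i]%C}).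
have nm : ('X^n - 1 : {poly R[i]%C}) \is monic by apply: monicXnsubC.
rewrite (monicP nm) scale1r in Dp.
have rn1 : all n.-unity_root r by apply/allP => z; rewrite -root_prod_XsubC -Dp.
have sr : (n < (size r).+1)%N.
  by rewrite -(size_prod_XsubC r id) -Dp size_XnsubC.
have [|w /= _ pw] := hasP (has_prim_root n0 rn1 _ sr); last by exists w.
by rewrite -separable_prod_XsubC -Dp separable_Xn_sub_1// pnatr_eq0 -lt0n.
Qed.

Lemma prim_root_neq0 (K : nzRingType) (n : nat) (z : K) :
  (0 < n)%N -> n.-primitive_root z -> z != 0.
Proof.
move=> n0 pz; apply/eqP => z0; have := prim_expr_order pz.
by rewrite z0 expr0n gtn_eqF// => /esym/eqP; rewrite oner_eq0.
Qed.

Section DirichletCharacters.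
Context {R : realType}.
Variable p : nat.
Hypothesis pr_p : prime p.
Local Notation C := (R[i]%C).
Local Notation n := p.-1.

Lemma predp_gt0 : (0 < n)%N.
Proof. by have := prime_gt1 pr_p; lia. Qed.

Lemma Fp_prim_root : exists g : 'F_p, n.-primitive_root g.
Proof.
have n0 := predp_gt0.
pose rs := [seq x <- enum 'F_p | x != 0].
have rn1 : all n.-unity_root rs.
  apply/allP => x; rewrite mem_filter => /andP[x0 _]; apply/unity_rootP.
  apply: (mulfI x0); rewrite -exprS prednK ?prime_gt0// mulr1.
  by have := expf_card x; rewrite card_Fp.
have us : uniq rs by rewrite filter_uniq// enum_uniq.
have ss : (n <= size rs)%N.
  rewrite size_filter -(leq_add2r 1) addn1 prednK ?prime_gt0//.
  have := count_predC (fun x : 'F_p => x != 0) (enum 'F_p).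
  rewrite -cardE card_Fp// [X in (_ + X)%N](eq_count (a2 := pred1 0)); last first.
    by move=> x /=; rewrite negbK.
  by rewrite [X in (_ + X)%N]count_uniq_mem ?enum_uniq ?mem_enum// => ->.
by have [g /= _ pg] := hasP (has_prim_root n0 rn1 us ss); exists g.
Qed.

Definition Fp_gen : 'F_p := sval (cid Fp_prim_root).
Definition C_root : C := sval (cid (complex_prim_root R predp_gt0)).

Lemma Fp_genP : n.-primitive_root Fp_gen.
Proof. exact: (svalP (cid Fp_prim_root)). Qed.

Lemma C_rootP : n.-primitive_root C_root.
Proof. exact: (svalP (cid (complex_prim_root R predp_gt0))). Qed.

(** The discrete logarithm to base [Fp_gen], with the value 0 at a = 0. *)
Definition Fp_index (a : 'F_p) : nat :=
  if [pick i : 'I_n | a == Fp_gen ^+ i] is Some i then val i else 0%N.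

Lemma Fp_indexP (a : 'F_p) : a != 0 -> a = Fp_gen ^+ Fp_index a.
Proof.
move=> a0; rewrite /Fp_index; case: pickP => [i /eqP//|H].
have an : a ^+ n = 1.
  apply: (mulfI a0); rewrite -exprS prednK ?prime_gt0// mulr1.
  by have := expf_card a; rewrite card_Fp.
have [i ai] := prim_rootP Fp_genP an.
by have := H i; rewrite -ai eqxx.
Qed.

(** Numbering the characters by exponents makes k = 0 principal, n - k conjugate to k, and k = n / 2
    the quadratic one. *)
Definition Fp_char (k : nat) (a : 'F_p) : C :=
  if a == 0 then 0 else C_root ^+ (k * Fp_index a).

Lemma Fp_gen_expr_char (k i : nat) : C_root ^+ (k * Fp_index (Fp_gen ^+ i)) = C_root ^+ (k * i).
Proof.
have g0 : Fp_gen ^+ i != 0.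
  by rewrite expf_neq0// (prim_root_neq0 _ Fp_genP) ?predp_gt0.
have /eqP := Fp_indexP g0; rewrite (eq_prim_root_expr Fp_genP) => /eqP h.
apply/eqP; rewrite (eq_prim_root_expr C_rootP) -modnMmr -[in X in _ == X]modnMmr.
by rewrite -h.
Qed.

Lemma Fp_charM k a b : Fp_char k (a * b) = Fp_char k a * Fp_char k b.
Proof.
rewrite /Fp_char mulf_eq0; case: eqP => [_|/eqP a0]; first by rewrite mul0r.
case: eqP => [_|/eqP b0] /=; first by rewrite mulr0.
by rewrite {1}(Fp_indexP a0) {1}(Fp_indexP b0) -exprD Fp_gen_expr_char mulnDr exprD.
Qed.

Lemma Fp_char1 k : Fp_char k 1 = 1.
Proof.
by rewrite /Fp_char oner_eq0 -[X in Fp_index X](expr0 Fp_gen) Fp_gen_expr_char muln0.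
Qed.

Lemma normc_C_root : normc C_root = 1.
Proof.
have : normc C_root ^+ n = 1 by rewrite -normcX (prim_expr_order C_rootP) normc1.
move/eqP; rewrite pexpr_eq1 ?normc_ge0 ?predp_gt0//.
by move/eqP.
Qed.

Lemma normc_Fp_char k a : normc (Fp_char k a) <= 1.
Proof.
rewrite /Fp_char; case: ifP => _; first by rewrite normc0 ler01.
by rewrite normcX normc_C_root expr1n.
Qed.

Lemma Fp_char_orth (a : 'F_p) :
  \sum_(0 <= k < n) Fp_char k a = if a == 1 then n%:R else 0.
Proof.
rewrite /Fp_char; have [->|a0] := eqVneq a 0.
  by rewrite eq_sym oner_eq0 big1.
have E : \sum_(0 <= k < n) C_root ^+ (k * Fp_index a) =
    \sum_(k < n) (C_root ^+ Fp_index a) ^+ k.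
  by rewrite big_mkord; apply: eq_bigr => i _; rewrite mulnC exprM.
rewrite E; set z := C_root ^+ _.
have [a1|a1] := eqVneq a 1.
  have -> : z = 1.
    by rewrite /z a1 -[X in Fp_index X](expr0 Fp_gen) -[Fp_index _]mul1n Fp_gen_expr_char.
  by under eq_bigr do rewrite expr1n; rewrite sumr_const card_ord.
have z1 : z - 1 != 0.
  rewrite subr_eq0 /z -(prim_order_dvd C_rootP) (prim_order_dvd Fp_genP).
  by rewrite -Fp_indexP.
apply: (mulfI z1); rewrite -subrX1 mulr0 /z -exprM mulnC exprM.
by rewrite (prim_expr_order C_rootP) expr1n subrr.
Qed.

Lemma Fp_char_sum0 k : (0 < k < n)%N -> \sum_(a : 'F_p) Fp_char k a = 0.
Proof.
move=> /andP[k0 kn].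
have g0 : Fp_gen != 0 := prim_root_neq0 predp_gt0 Fp_genP.
have E : \sum_a Fp_char k a = Fp_char k Fp_gen * \sum_a Fp_char k a.
  rewrite {1}(reindex_inj (mulfI g0)) /= mulr_sumr.
  by apply: eq_bigr => a _; rewrite Fp_charM.
have z1 : Fp_char k Fp_gen - 1 != 0.
  rewrite subr_eq0 /Fp_char (negPf g0) -{1}[Fp_gen]expr1 Fp_gen_expr_char muln1.
  by rewrite -(prim_order_dvd C_rootP) gtnNdvd.
apply: (mulfI z1); rewrite mulr0 mulrBl mul1r -E subrr//.
Qed.

Definition dchar (k m : nat) : C := Fp_char k (m%:R : 'F_p).

Lemma natr_Fp_eq0 (m : nat) : ((m%:R : 'F_p) == 0) = (p %| m)%N.
Proof. by rewrite -(dvdn_pcharf (pchar_Fp pr_p)). Qed.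

Lemma dchar1 k : dchar k 1 = 1. Proof. exact: Fp_char1. Qed.

Lemma dcharM k i j : dchar k (i * j) = dchar k i * dchar k j.
Proof. by rewrite /dchar natrM Fp_charM. Qed.

Lemma normc_dchar k m : normc (dchar k m) <= 1. Proof. exact: normc_Fp_char. Qed.

Lemma dchar_principal m : dchar 0 m = if (p %| m)%N then 0 else 1.
Proof. by rewrite /dchar /Fp_char natr_Fp_eq0 mul0n expr0. Qed.

Lemma dchar_orth (m : nat) :
  \sum_(0 <= k < n) dchar k m = if (m%:R : 'F_p) == 1 then n%:R else 0.
Proof. exact: Fp_char_orth. Qed.

Lemma dchar_period k m : dchar k (m + p) = dchar k m.
Proof. by rewrite /dchar natrD (pchar_Fp_0 pr_p) addr0. Qed.

Lemma dchar_sum_period k j : (0 < k < n)%N ->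
  \sum_(0 <= i < j * p) dchar k i = 0.
Proof.
move=> kn; elim: j => [|j IH]; first by rewrite big_geq.
rewrite mulSn addnC (@big_cat_nat _ _ _ (j * p)) ?leq_addr//= IH add0r.
rewrite -{1}[(j * p)%N]add0n big_addn addKn.
rewrite (eq_bigr (fun i => dchar k i)); last first.
  move=> i _; elim: (j) => [|j' IH']; first by rewrite mul0n addn0.
  by rewrite mulSn addnCA addnC dchar_period.
rewrite -[RHS](Fp_char_sum0 kn).
have pE : (p = (Zp_trunc (pdiv p)).+2)%N by rewrite Fp_cast.
rewrite [in X in X = _]pE big_mkord; apply: eq_bigr => i _.
by rewrite /dchar natr_Zp.
Qed.

Lemma dchar_sum_le k N : (0 < k < n)%N ->
  normc (\sum_(0 <= i < N) dchar k i) <= p%:R.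
Proof.
move=> kn; rewrite {1}(divn_eq N p) (@big_cat_nat _ _ _ (N %/ p * p)) ?leq_addr//=.
rewrite dchar_sum_period// add0r (le_trans (normc_sum _ _ _))//.
rewrite (le_trans (ler_sum _ (fun i _ => normc_dchar k i)))//.
rewrite sumr_const_nat addKn ler_nat ltnW// ltn_mod prime_gt0//.
Qed.

Lemma dchar_conj k m : (k <= n)%N -> dchar (n - k) m = conjc (dchar k m).
Proof.
move=> kn; rewrite /dchar /Fp_char; case: ifP => _; first by rewrite conjc0.
set i := Fp_index _; have z0 : C_root != 0 := prim_root_neq0 predp_gt0 C_rootP.
have cz : conjc (C_root ^+ (k * i)) = (C_root ^+ (k * i))^-1.
  rewrite invc_norm -[LHS]mul1r; congr (_ * _).
  suff -> : `|C_root ^+ (k * i)| = 1 by rewrite expr1n invr1.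
  by rewrite -[1]/(1%:C)%C -[in RHS](expr1n _ (k * i)) -normc_C_root -normcX.
rewrite cz mulnBl expfB_cond; last by rewrite (negPf z0) add0n leq_mul2r kn orbT.
by rewrite exprM (prim_expr_order C_rootP) expr1n mul1r.
Qed.

Lemma dchar_quadratic k m : (k + k = n)%N ->
  [\/ dchar k m = 0, dchar k m = 1 | dchar k m = -1].
Proof.
move=> kk; rewrite /dchar /Fp_char; case: ifP => _; first by apply: Or31.
set i := Fp_index _.
have : (C_root ^+ (k * i)) ^+ 2 == 1.
  by rewrite -exprM mulnAC muln2 -addnn kk exprM (prim_expr_order C_rootP) expr1n.
rewrite sqrf_eq1 => /orP[] /eqP ->; [exact: Or32|exact: Or33].
Qed.

Lemma dchar_opp1 k : dchar k n = 1 \/ dchar k n = -1.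
Proof.
have : dchar k n ^+ 2 == 1.
  rewrite expr2 -dcharM /dchar -[X in _ == X](Fp_char1 k); apply/eqP; congr Fp_char.
  have -> : ((n * n)%:R : 'F_p) = (n%:R) ^+ 2 by rewrite natrM.
  have -> : (n%:R : 'F_p) = -1.
    apply/eqP; rewrite -subr_eq0 opprK natr1 prednK ?prime_gt0//.
    by rewrite (pchar_Fp_0 pr_p).
  by rewrite sqrrN expr1n.
by rewrite sqrf_eq1 => /orP[] /eqP ->; [left|right].
Qed.

Lemma dchar_opp_orth (q : nat) :
  \sum_(0 <= k < n) dchar k n * dchar k q = if (p %| q.+1)%N then n%:R else 0.
Proof.
under eq_bigr do rewrite -dcharM.
rewrite dchar_orth natrM.
have -> : (n%:R : 'F_p) = -1.
  apply/eqP; rewrite -subr_eq0 opprK natr1 prednK ?prime_gt0//.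
  by rewrite (pchar_Fp_0 pr_p).
by rewrite mulN1r -natr_Fp_eq0 -(natr1 q) addr_eq0 eqr_oppLR.
Qed.

End DirichletCharacters.

(** * L-functions near 1 *)

Section LValues.
Context {R : realType}.
Local Notation C := (R[i]%C).

(** |1 - z|^2 = 1 + u with u = |z|^2 - 2 Re z, so a real logarithm suffices. As 1 + u >= 1/4, ln (1
    + u) is within 4 u^2 of u, and half of this is at most 2 (5/2)^2 |z|^2 = (25/2) |z|^2. *)
Lemma ln_normc_1sub (z : C) : normc z <= 2^-1 ->
  `| - ln (normc (1 - z)) - complex.Re z| <= 13 * normc z ^+ 2.
Proof.
move=> z2; have z0 := normc_ge0 z; have zRe := normc_Re z.
set a := complex.Re z in zRe *.
pose u := normc z ^+ 2 - 2 * a.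
have h1 : normc (1 - z) ^+ 2 = 1 + u.
  rewrite /u /a; case: (z) => x y.
  rewrite /normc /= !sqr_sqrtr ?addr_ge0 ?sqr_ge0//; ring.
have h2 : 2^-1 <= normc (1 - z).
  by have := normc_subr_le 1 z; rewrite normc1; lra.
have h3 : 0 < normc (1 - z) by lra.
have h4 : 4^-1 <= 1 + u by rewrite -h1; nra.
have u0 : 0 < 1 + u by lra.
have h5 : ln (1 + u) = 2 * ln (normc (1 - z)) by rewrite -h1 lnXn// mulr_natl.
have h6 : ln (1 + u) <= u by have := ln_le_subr1 u0; lra.
have h7 : u - 4 * u ^+ 2 <= ln (1 + u).
  apply: le_trans (ln_ge_1subV u0).
  have -> : 1 - (1 + u)^-1 = u - u ^+ 2 * (1 + u)^-1 by field; rewrite gt_eqF.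
  rewrite lerD2l lerN2 mulrC ler_wpM2r ?sqr_ge0//.
  by rewrite -[leRHS]invrK lef_pV2 ?posrE.
move: zRe; rewrite ler_norml => /andP[zR1 zR2].
have u2 : u ^+ 2 <= (5 / 2 * normc z) ^+ 2.
  rewrite -[u ^+ 2]real_normK ?num_real// lerXn2r ?nnegrE ?mulr_ge0//.
  by rewrite ler_norml /u; apply/andP; split; nra.
rewrite exprMn in u2.
set c := ln (1 + u) in h5 h6 h7; set d := ln _ in h5 *.
rewrite ler_norml; move: h5 h6 h7 u2; rewrite {1 2}/u.
set v := u ^+ 2; set w := normc z ^+ 2 => h5 h6 h7 u2.
have w0 : 0 <= w by exact: sqr_ge0.
by rewrite /u in h6 h7; apply/andP; split; lra.
Qed.

Lemma ln_abs_le (y b : R) : `|y - 1| <= b -> b <= 2^-1 -> 0 < y /\ `|ln y| <= 2 * b.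
Proof.
rewrite ler_norml => /andP[h1 h2] b2; have y0 : 0 < y by lra.
split => //; rewrite ler_norml; have := ln_le_subr1 y0; have := ln_ge_1subV y0.
have : y^-1 <= 1 + 2 * b.
  rewrite -[leRHS]invrK lef_pV2 ?posrE ?invr_gt0//; last by lra.
  by rewrite invf_ple ?posrE//; last lra; rewrite -[leLHS]mul1r ler_pdivrMr//; nra.
by lra.
Qed.

Variable p : nat.
Hypothesis pr_p : prime p.
Local Notation n := p.-1.
Local Notation chi := (@dchar R p pr_p).

(* The value of the L-function at 1 + e; 0 is a junk value, not reached when
   0 < e. *)
Definition Lval (k : nat) (e : R) : C :=
  if pselect (exists l, ccvg (lpart (chi k) (1 + e)) l) is left h
  then sval (cid h) else 0.

Lemma Lval_cvg k e : 0 < e -> ccvg (lpart (chi k) (1 + e)) (Lval k e).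
Proof.
move=> e0; rewrite /Lval; case: pselect => [h|]; first exact: (svalP (cid h)).
by case; apply: lpart_cvg => //; exact: normc_dchar.
Qed.

Definition lnL k e : R := ln (normc (Lval k e)).

Definition lnEuler k e N : R :=
  - \sum_(0 <= q < N.+1 | prime q) ln (normc (1 - lterm (chi k) (1 + e) q)).

Lemma normc_lterm_prime k e q : 0 < e -> prime q ->
  normc (lterm (chi k) (1 + e) q) <= (q%:R)^-1.
Proof.
move=> e0 pq; rewrite (le_trans (normc_lterm _ _ _))//; first exact: normc_dchar.
rewrite -[leRHS]powR_inv1//; apply: powRN_le; last by lra.
exact: prime_gt0.
Qed.

Lemma invr_prime_le2 q : prime q -> (q%:R)^-1 <= 2^-1 :> R.
Proof. by move=> /prime_gt1 q1; rewrite lef_pV2 ?posrE ?ltr0n ?ler_nat//; exact: ltnW. Qed.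

(** If P is the finite product of the factors 1 - chi(q) q^(-1-e), then L P is close to 1: this
    forces L to be nonzero and ln |L| to be close to - ln |P|. *)
Lemma lnL_euler k e : 0 < e -> 0 < normc (Lval k e) /\
  forall eta, 0 < eta -> \forall N \near \oo, `|lnL k e - lnEuler k e N| <= eta.
Proof.
move=> e0.
have key N b : (1 < N)%N -> (N%:R : R) `^ (- e) / e <= b -> b <= 2^-1 ->
    0 < normc (Lval k e) /\ `|lnL k e - lnEuler k e N| <= 2 * b.
  move=> N1 Nb b2.
  have := lseries_euler (dchar1 pr_p k) (dcharM pr_p k) (normc_dchar pr_p k) e0 N1 (Lval_cvg k e0).
  set P := \prod_(0 <= q < N.+1 | prime q) _ => h.
  have hP : 0 < normc P.
    rewrite /P normc_prod big_seq_cond; apply: prodr_gt0 => q /andP[_ pq].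
    have := normc_subr_le 1 (lterm (chi k) (1 + e) q).
    have := normc_lterm_prime k e0 pq; have := invr_prime_le2 pq.
    by rewrite normc1; lra.
  have h' : `|normc (Lval k e) * normc P - 1| <= b.
    rewrite -normcM (le_trans _ Nb)// (le_trans _ h)// ler_norml; apply/andP; split.
      by have := normc_subr_le 1 (Lval k e * P); rewrite normc1 normc_distC; lra.
    by have := normc_subr_le (Lval k e * P) 1; rewrite normc1.
  have [y0 yb] := ln_abs_le h' b2.
  have L0 : 0 < normc (Lval k e) by move: y0; rewrite pmulr_lgt0.
  split => //; move: yb; rewrite lnM ?posrE// /lnL /lnEuler opprK.
  have H : forall q, prime q -> 0 < normc (1 - lterm (chi k) (1 + e) q).
    move=> q pq; have := normc_subr_le 1 (lterm (chi k) (1 + e) q).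
    have := normc_lterm_prime k e0 pq; have := invr_prime_le2 pq.
    by rewrite normc1; lra.
  by rewrite /P normc_prod ln_prod.
have tail0 : (fun N => (N%:R : R) `^ (- e) / e) @ \oo --> (0 : R).
  exact: powRN_div_cvg0.
split.
  have /cvgrPdist_le/(_ 2^-1)[|N _ H] := tail0; first by rewrite invr_gt0.
  have [] // := key (N.+2) 2^-1; have := H N.+2; rewrite sub0r normrN ger0_norm; first by apply; rewrite /=; lia.
  by rewrite divr_ge0 ?powR_ge0// ltW.
move=> eta eta0.
pose b := Num.min 2^-1 (eta / 2).
have b0 : 0 < b by rewrite lt_min invr_gt0 ltr0n divr_gt0.
have b1 : b <= 2^-1 by rewrite ge_min lexx.
have b2 : 2 * b <= eta.
  have : b <= eta / 2 by rewrite ge_min lexx orbT.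
  by lra.
have /cvgrPdist_le/(_ b b0) H := tail0.
near=> N; have N1 : (1 < N)%N by near: N; exists 2%N.
have Nb : (N%:R : R) `^ (- e) / e <= b.
  have : `|0 - (N%:R : R) `^ (- e) / e| <= b by near: N.
  by rewrite sub0r normrN => /(le_trans (ler_norm _)).
have [_ h] := key N b N1 Nb b1; exact: le_trans h b2.
Unshelve. all: by end_near. Qed.
End LValues.

Section LBounds.
Context {R : realType}.
Local Notation C := (R[i]%C).
Variable p : nat.
Hypothesis pr_p : prime p.
Local Notation n := p.-1.
Local Notation chi := (@dchar R p pr_p).
Local Notation Lval := (@Lval R p pr_p).
Local Notation lnL := (@lnL R p pr_p).
Local Notation lnEuler := (@lnEuler R p pr_p).

Lemma sum_prime_invsq (N : nat) :
  \sum_(0 <= q < N.+1 | prime q) ((q%:R)^-1) ^+ 2 <= 1 :> R.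
Proof.
case: (ltnP N 2) => N2.
  rewrite big_nat_cond big1 ?ler01// => q /andP[/andP[_ qN] /prime_gt1]; lia.
rewrite (@big_cat_nat _ _ _ 2)//=; last by lia.
rewrite big_nat_cond big1 ?add0r => [|q /andP[/andP[_ q2] /prime_gt1]]; last by lia.
rewrite big_mkcond (le_trans (ler_sum _ (G := fun q => (q%:R : R) ^- 2) _))//.
  by move=> q _; case: ifP => _; rewrite ?exprVn// invr_ge0 exprn_ge0.
by rewrite (le_trans (powRN2_tail _ _))// invr1.
Qed.

(** Each logarithm is replaced by its first-order term, with error 13 / q^2, and the sum of 1/q^2
    over primes is at most 1. The weights c will be 1 or chi_k(-1), which select the classes of 1
    and -1. *)
Lemma weighted_lnEuler (c : nat -> R) e N : 0 < e -> (forall k, `|c k| <= 1) ->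
  `|\sum_(0 <= k < n) c k * lnEuler k e N -
    \sum_(0 <= q < N.+1 | prime q)
       complex.Re (\sum_(0 <= k < n) (c k)%:C%C * chi k q) * (q%:R `^ (- (1 + e)))|
   <= 13 * n%:R.
Proof.
move=> e0 c1.
pose z k q := lterm (chi k) (1 + e) q.
have -> : \sum_(0 <= k < n) c k * lnEuler k e N =
   \sum_(0 <= q < N.+1 | prime q) \sum_(0 <= k < n) c k * - ln (normc (1 - z k q)).
  rewrite [RHS]exchange_big /=; apply: eq_bigr => k _.
  by rewrite /lnEuler -sumrN mulr_sumr.
have zRe k q : complex.Re (z k q) = complex.Re (chi k q) * (q%:R `^ (- (1 + e))).
  by rewrite /z /lterm; case: (chi k q) => a b /=; rewrite mulr0 subr0.
have -> : \sum_(0 <= q < N.+1 | prime q)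
       complex.Re (\sum_(0 <= k < n) (c k)%:C%C * chi k q) * (q%:R `^ (- (1 + e)))
   = \sum_(0 <= q < N.+1 | prime q) \sum_(0 <= k < n) c k * complex.Re (z k q).
  apply: eq_bigr => q _; rewrite raddf_sum /= mulr_suml; apply: eq_bigr => k _.
  by rewrite zRe mulrA; congr (_ * _); case: (chi k q) => a b /=; rewrite mul0r subr0.
rewrite -sumrB (le_trans (ler_norm_sum _ _ _))//.
apply: (@le_trans _ _ (\sum_(0 <= q < N.+1 | prime q) 13 * n%:R * ((q%:R)^-1) ^+ 2)).
  apply: ler_sum => q pq; rewrite -sumrB (le_trans (ler_norm_sum _ _ _))//.
  apply: (@le_trans _ _ (\sum_(0 <= k < n) 13 * ((q%:R)^-1) ^+ 2)); last first.
    by rewrite sumr_const_nat subn0 -[leLHS]mulr_natr mulrAC.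
  apply: ler_sum => k _; rewrite -mulrBr normrM.
  have zq := normc_lterm_prime pr_p k e0 pq.
  have := @ln_normc_1sub _ _ (le_trans zq (invr_prime_le2 pq)).
  set A := `|_ - _| => hA; rewrite (le_trans (ler_piMl _ (c1 k))) ?normr_ge0//.
  rewrite (le_trans hA)// ler_wpM2l// lerXn2r// ?nnegrE ?normc_ge0// invr_ge0//.
rewrite -mulr_sumr ler_piMr ?mulr_ge0//; exact: sum_prime_invsq.
Qed.

Lemma near_lnEuler e : 0 < e ->
  \forall N \near \oo, forall k, (k < n)%N -> `|lnL k e - lnEuler k e N| <= 1.
Proof.
move=> e0; elim: n => [|m IH]; first by near=> N.
have [_ /(_ 1 ltr01) H] := lnL_euler pr_p m e0.
near=> N => k; rewrite ltnS leq_eqVlt => /orP[/eqP ->|]; first by near: N.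
by move: k; near: N.
Unshelve. all: by end_near. Qed.

Lemma weighted_lnL (c : nat -> R) e : 0 < e -> (forall k, `|c k| <= 1) ->
  exists N,
  `|\sum_(0 <= k < n) c k * lnL k e -
    \sum_(0 <= q < N.+1 | prime q)
       complex.Re (\sum_(0 <= k < n) (c k)%:C%C * chi k q) * (q%:R `^ (- (1 + e)))|
   <= 14 * n%:R.
Proof.
move=> e0 c1; have [N _ H] := near_lnEuler e0; exists N.
have := weighted_lnEuler N e0 c1; set A := (X in `|_ - X|) => h.
rewrite (le_trans (ler_distD (\sum_(0 <= k < n) c k * lnEuler k e N) _ _))//.
have -> : 14 * n%:R = 1 * n%:R + 13 * n%:R :> R by ring.
rewrite lerD// -sumrB (le_trans (ler_norm_sum _ _ _))//.
have -> : 1 * n%:R = \sum_(0 <= k < n) (1 : R) by rewrite sumr_const_nat subn0 mul1r.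
rewrite !big_nat.
apply: ler_sum => k /andP[_ kn]; rewrite -mulrBr normrM.
by rewrite -[leRHS]mulr1 ler_pM// H//=.
Qed.

(** With weights 1 the prime sum becomes n times a sum over q = 1 mod p, which is nonnegative; hence
    the product of all |L_k| cannot be small. *)
Lemma sum_lnL_ge e : 0 < e -> - (14 * n%:R) <= \sum_(0 <= k < n) lnL k e.
Proof.
move=> e0; have [|N] := @weighted_lnL (fun=> 1) e e0; first by move=> k; rewrite normr1.
under eq_bigr do rewrite mul1r.
set A := (X in `|_ - X|) => h.
have A0 : 0 <= A.
  rewrite /A; apply: sumr_ge0 => q _; rewrite mulr_ge0 ?powR_ge0//.
  have -> : \sum_(0 <= k < n) (1%:C)%C * chi k q = \sum_(0 <= k < n) chi k q.
    by apply: eq_bigr => k _; rewrite mul1r.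
  rewrite dchar_orth; case: ifP => _//.
  by rewrite -[n%:R](rmorph_nat (real_complex R)) /=.
by move: h; rewrite ler_norml => /andP[h _]; lra.
Qed.

(* As p.-1 = -1 mod p, this is chi_k(-1). *)
Definition eps (k : nat) : R := complex.Re (chi k n).

Lemma epsE k : (eps k)%:C%C = chi k n.
Proof.
rewrite /eps; case: (@dchar_opp1 R p pr_p k) => ->; apply/eqP.
  by rewrite eq_complex /= !eqxx.
by rewrite eq_complex /= oppr0 !eqxx.
Qed.

Lemma eps_val k : eps k = 1 \/ eps k = -1.
Proof. by rewrite /eps; case: (@dchar_opp1 R p pr_p k) => ->; [left|right]. Qed.

Lemma eps_lnL_le e : 0 < e -> exists N, \sum_(0 <= k < n) eps k * lnL k e <=
  n%:R * \sum_(0 <= q < N.+1 | prime q && (p %| q.+1)%N) (q%:R `^ (- (1 + e))) + 14 * n%:R.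
Proof.
move=> e0; have [|N] := @weighted_lnL eps e e0.
  by move=> k; case: (eps_val k) => ->; rewrite ?normrN normr1.
set A := (X in `|_ - X|) => h; exists N.
suff <- : A = n%:R * \sum_(0 <= q < N.+1 | prime q && (p %| q.+1)%N) (q%:R `^ (- (1 + e))).
  by move: h; rewrite ler_norml => /andP[_ h]; lra.
rewrite /A mulr_sumr big_mkcondr /=; apply: eq_bigr => q _.
under eq_bigr do rewrite epsE.
rewrite dchar_opp_orth; case: ifP => _; last by rewrite mul0r.
by congr (_ * _); rewrite -[n%:R in LHS](rmorph_nat (real_complex R)).
Qed.

Lemma eps0 : eps 0 = 1.
Proof.
rewrite /eps dchar_principal gtnNdvd//; have := prime_gt1 pr_p; lia.
Qed.

(** A partial sum of zeta (1 + e) reaches 3 / (4 e); the multiples of p account for at most half of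
    it, since p^(-1-e) <= 1/2; the approximation of L costs 1 / (8 e). What remains is 1 / (4 e). *)
Lemma lnL0_ge e : 0 < e -> ln e^-1 - ln 4 <= lnL 0 e.
Proof.
move=> e0; rewrite -ln_div ?posrE ?invr_gt0// /lnL ler_ln ?posrE ?divr_gt0 ?invr_gt0//; last first.
  exact: (lnL_euler pr_p 0 e0).1.
have p1 := prime_gt1 pr_p; have p0 := prime_gt0 pr_p.
pose f m : R := m%:R `^ (- (1 + e)).
have f0 m : 0 <= f m by exact: powR_ge0.
have lpE X : lpart (chi 0) (1 + e) X = ((\sum_(1 <= m < X.+1 | ~~ (p %| m)%N) f m)%:C)%C.
  rewrite /lpart rmorph_sum big_mkcond [RHS]big_mkcond; apply: eq_bigr => m _.
  by rewrite /lterm dchar_principal; case: ifP => _; rewrite ?mul0r ?mul1r.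
have ei0 : 0 < e^-1 by rewrite invr_gt0.
have e8 : 0 < e^-1 / 8 by lra.
have [N HN] := Lval_cvg pr_p 0 e0 e8.
have /cvgrPdist_le/(_ _ (divr_gt0 ei0 (ltr0n _ 4)))[N2 _ HN2] := powRN_div_cvg0 e0.
pose X := maxn N N2.
have {HN} h1 := HN X (leq_maxl _ _).
have {HN2} h2 : (X.+1%:R : R) `^ (- e) / e <= e^-1 / 4.
  have := HN2 X.+1; rewrite /= sub0r normrN => /(_ _)/(le_trans (ler_norm _)); apply.
  by rewrite leqW// leq_maxr.
have h3 := powRN_partial_sum_ge X e0; rewrite mulrBl mul1r in h3.
have hp : f p <= 2^-1.
  rewrite (le_trans _ (invr_prime_le2 pr_p))// -[leRHS]powR_inv1//.
  by apply: powRN_le => //; lra.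
have h4 : (\sum_(1 <= m < X.+1) f m) / 2 <= \sum_(1 <= m < X.+1 | ~~ (p %| m)%N) f m.
  have E : \sum_(1 <= m < X.+1 | (p %| m)%N) f m <= (\sum_(1 <= m < X.+1) f m) / 2.
    rewrite (eq_bigl (fun m => (p %| m)%N && true)); last by move=> m; rewrite andbT.
    rewrite big_nat_dvd// (eq_bigr (fun m => f p * f m)); last first.
      by move=> m _; rewrite /f natrM powRM.
    rewrite -mulr_sumr mulrC ler_pM ?sumr_ge0//.
    rewrite [leRHS](@big_cat_nat _ _ _ (X %/ p).+1)//=; last by rewrite ltnS leq_div.
    by rewrite lerDl sumr_ge0.
  have T : \sum_(1 <= m < X.+1) f m = \sum_(1 <= m < X.+1 | (p %| m)%N) f m +
      \sum_(1 <= m < X.+1 | ~~ (p %| m)%N) f m by rewrite (bigID (fun m => p %| m)%N).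
  by move: E T; lra.
have h5 := normc_subr_le (lpart (chi 0) (1 + e) X) (Lval 0 e).
rewrite {1}lpE normc_real in h5.
have h6 := ler_norm (\sum_(1 <= m < X.+1 | ~~ (p %| m)%N) f m).
have h7 := le_trans h5 h1.
have h8 : (4 : R)^-1 * e^-1 = e^-1 / 4 by rewrite mulrC.
by move: h2 h3 h4 h6 h7; rewrite /f; set a := e^-1; set b := _ / e; lra.
Qed.

Lemma lnL0_le e : 0 < e -> lnL 0 e <= ln (1 + e^-1).
Proof.
move=> e0; rewrite /lnL ler_ln ?posrE; last 2 first.
- exact: (lnL_euler pr_p 0 e0).1.
- by rewrite addr_gt0// invr_gt0.
rewrite -[Lval 0 e]subr0; apply: (ccvg_normc_le (M := 0) (Lval_cvg pr_p 0 e0)) => X _.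
rewrite subr0 (le_trans (normc_sum _ _ _))//.
rewrite (le_trans (ler_sum _ (fun i _ => normc_lterm (normc_dchar pr_p 0) (1 + e) i)))//.
exact: powRN_partial_sum_le.
Qed.

Lemma lnL_le k e : (0 < k < n)%N -> 0 < e -> lnL k e <= ln (2 * p%:R).
Proof.
move=> kn e0; have p0 := prime_gt0 pr_p.
rewrite /lnL ler_ln ?posrE ?mulr_gt0 ?ltr0n//; last exact: (lnL_euler pr_p k e0).1.
apply: (lseries_le (fun N => @dchar_sum_le R p pr_p k N kn) _ (Lval_cvg pr_p k e0)); lra.
Qed.

Lemma Lval_lipschitz k e e' : (0 < k < n)%N -> 0 < e -> e <= e' ->
  normc (Lval k e - Lval k e') <= 2 * p%:R * (e' - e).
Proof.
move=> kn e0 ee.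
have -> : e' - e = (1 + e') - (1 + e) by ring.
by apply: (lseries_lipschitz (fun N => @dchar_sum_le R p pr_p k N kn) _ _
  (Lval_cvg pr_p k e0) (Lval_cvg pr_p k (lt_le_trans e0 ee))); lra.
Qed.

Lemma Lval_conj k e : (0 < k < n)%N -> 0 < e -> lnL (n - k) e = lnL k e.
Proof.
move=> /andP[k0 kn] e0; rewrite /lnL; congr ln.
have nJ (z : C) : normc (conjc z) = normc z by case: z => a b; rewrite /normc /= sqrrN.
have H := Lval_cvg pr_p k e0.
have H' : ccvg (lpart (chi (n - k)) (1 + e)) (conjc (Lval k e)).
  move=> d d0; have [N HN] := H d d0; exists N => m /HN.
  have -> : lpart (chi (n - k)) (1 + e) m = conjc (lpart (chi k) (1 + e) m).
    rewrite /lpart rmorph_sum /=; apply: eq_bigr => i _.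
    by rewrite /lterm dchar_conj ?(ltnW kn)// rmorphM /= oppr0.
  by rewrite -rmorphB nJ.
suff -> : Lval (n - k) e = conjc (Lval k e) by rewrite nJ.
apply/eqP; rewrite -subr_eq0; apply/eqP/eq0_normc/eqP.
rewrite eq_le normc_ge0 andbT; apply/ler_addgt0Pr => d d0; rewrite add0r.
have d2 : 0 < d / 2 by lra.
have [N HN] := H' _ d2.
apply: (ccvg_normc_le (M := N) (Lval_cvg pr_p (n - k) e0)) => m Nm.
by rewrite (le_trans (HN m Nm))//; lra.
Qed.

(** At 1 the value is at least 1 / (64 p) by [quadratic_lower], and the Lipschitz bound 2 p e loses
    at most half of that in the given range of e. *)
Lemma Lval_quadratic k e : (0 < k < n)%N -> (k + k = n)%N ->
  0 < e -> e <= (256 * p%:R ^+ 2)^-1 -> - ln (128 * p%:R) <= lnL k e.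
Proof.
move=> kn kk e0 eB.
have p0 := prime_gt0 pr_p; have pR : 0 < p%:R :> R by rewrite ltr0n.
rewrite -lnV ?posrE ?mulr_gt0// /lnL ler_ln ?posrE ?invr_gt0 ?mulr_gt0//; last first.
  exact: (lnL_euler pr_p k e0).1.
have [l lP] := lpart_cvg1 (fun N => @dchar_sum_le R p pr_p k N kn).
pose x m : R := complex.Re (chi k m).
have xE m : chi k m = (x m)%:C%C.
  rewrite /x; case: (dchar_quadratic pr_p m kk (R := R)) => ->; apply/eqP;
    by rewrite eq_complex /= ?oppr0 !eqxx.
have xv m : [\/ x m = 0, x m = 1 | x m = -1].
  by rewrite /x; case: (dchar_quadratic pr_p m kk (R := R)) => ->; [apply: Or31|apply: Or32|apply: Or33].
have x1 : x 1%N = 1 by rewrite /x dchar1.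
have xM i j : x (i * j)%N = x i * x j.
  by apply: complexI; rewrite rmorphM /= -!xE dcharM.
have xs N : `|\sum_(0 <= i < N) x i| <= p%:R.
  rewrite (le_trans _ (dchar_sum_le pr_p N kn))// (le_trans _ (normc_Re _))//.
  by rewrite raddf_sum.
have lRe : (fun X => \sum_(1 <= m < X.+1) x m * (m%:R)^-1) @ \oo --> complex.Re l.
  apply/cvgrPdist_le => d d0; have [N HN] := lP d d0; exists N => // m /= /HN.
  apply: le_trans; rewrite distrC (le_trans _ (normc_Re _))// raddfB /=.
  suff -> : \sum_(1 <= i < m.+1) x i * (i%:R)^-1 = complex.Re (lpart (chi k) 1 m) by [].
  rewrite /lpart raddf_sum /=; apply: eq_big_nat => i /andP[i0 _].
  by rewrite /lterm xE powR_inv1//= mulr0 subr0.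
have lge : (64 * p%:R)^-1 <= complex.Re l := quadratic_lower x1 xM xv p0 xs lRe.
have h1 := le_trans lge (le_trans (ler_norm _) (normc_Re l)).
have h2 : normc (l - Lval k e) <= 2 * p%:R * ((1 + e) - 1).
  by apply: (lseries_lipschitz (fun N => @dchar_sum_le R p pr_p k N kn) _ _ lP (Lval_cvg pr_p k e0)); lra.
have h3 := normc_subr_le l (Lval k e).
have h4 : 2 * p%:R * ((1 + e) - 1) <= (128 * p%:R)^-1.
  rewrite addrC addKr; apply: (le_trans (ler_wpM2l _ eB)); first by rewrite mulr_ge0// ltW.
  by rewrite le_eqVlt; apply/orP; left; apply/eqP; field; rewrite gt_eqF.
have h5 : (64 * p%:R)^-1 = (128 * p%:R)^-1 + (128 * p%:R)^-1 :> R.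
  by field; rewrite gt_eqF.
by lra.
Qed.

End LBounds.

(** * Reciprocals of the primes congruent to -1 *)

Lemma ln2_ge_half {R : realType} : 2^-1 <= ln 2 :> R.
Proof. have := @ln_ge_1subV R 2 (ltr0n _ 2); lra. Qed.

Lemma ln2_le1 {R : realType} : ln 2 <= 1 :> R.
Proof. have := @ln_le_subr1 R 2 (ltr0n _ 2); lra. Qed.

Section PrimesCongruentToMinusOne.
Context {R : realType}.
Variable p : nat.
Hypothesis pr_p : prime p.
Local Notation n := p.-1.
Local Notation Lval := (@Lval R p pr_p).
Local Notation lnL := (@lnL R p pr_p).
Local Notation Lam := (ln (2 * p%:R) : R).

Let pR2 : 2 <= p%:R :> R. Proof. by rewrite ler_nat prime_gt1. Qed.
Let pR0 : 0 < p%:R :> R. Proof. by rewrite ltr0n prime_gt0. Qed.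
Let nR : n%:R = p%:R - 1 :> R.
Proof. by rewrite -subn1 natrB// prime_gt0. Qed.

Lemma ln2_le_Lam : ln 2 *+ 2 <= Lam.
Proof.
rewrite -lnXn// ler_ln ?posrE ?exprn_gt0 ?mulr_gt0//.
by rewrite expr2 ler_pM2l.
Qed.

Lemma Lam_ge1 : 1 <= Lam.
Proof. by have := ln2_le_Lam; have := @ln2_ge_half R; lra. Qed.

Lemma ln_pow2_mul (j : nat) : ln (2 ^+ j.+1 * p%:R) = Lam + ln 2 *+ j.
Proof.
rewrite exprSr -mulrA lnM ?posrE ?exprn_gt0 ?mulr_gt0// lnXn//.
by rewrite addrC.
Qed.

(** The constant 20 is chosen for [lnL_Ldelta_complex]: two conjugate values below 4 p [Ldelta]
    would count [ln Ldelta] twice, while [sum_lnL_nonprincipal_ge] allows it once, up to 14 p and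
    about p [Lam]. *)
Definition Ldelta : R := expR (- (20 * p%:R * Lam)).

Lemma ln_Ldelta : ln Ldelta = - (20 * p%:R * Lam).
Proof. exact: expRK. Qed.

Lemma Ldelta_small : Ldelta <= (256 * p%:R ^+ 2)^-1.
Proof.
have L1 := Lam_ge1; have l2 := ln2_le_Lam.
rewrite /Ldelta expRN lef_pV2 ?posrE ?expR_gt0 ?mulr_gt0 ?exprn_gt0//.
have -> : 256 * p%:R ^+ 2 = (2 ^+ 4 * p%:R) ^+ 2 :> R by ring.
rewrite -[leLHS]lnK ?posrE ?exprn_gt0 ?mulr_gt0 ?exprn_gt0//.
rewrite ler_expR lnXn ?mulr_gt0 ?exprn_gt0// ln_pow2_mul.
have pl : 2 * Lam <= p%:R * Lam by rewrite ler_wpM2r//; lra.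
lra.
Qed.

Lemma sum_lnL_nonprincipal_ge e : 0 < e -> e <= 1 ->
  - (14 * p%:R) - Lam + ln e <= \sum_(1 <= k < n) lnL k e.
Proof.
move=> e0 e1; have := sum_lnL_ge pr_p e0.
have n0 : (0 < n)%N by have := prime_gt1 pr_p; lia.
rewrite big_ltn// => h; have := lnL0_le pr_p e0.
have : ln (1 + e^-1) <= ln 2 - ln e.
  rewrite -ln_div ?posrE// ler_ln ?posrE ?addr_gt0 ?divr_gt0 ?invr_gt0//.
  by rewrite mulrDl mul1r lerD2r -[leLHS]invr1 lef_pV2 ?posrE.
have := ln2_le_Lam; have := @ln2_ge_half R; move: h; rewrite nR; lra.
Qed.

(* For a non-real character, a small |L_k| would occur twice in the sum of
   sum_lnL_nonprincipal_ge, for k and for its conjugate n - k. *)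
Lemma lnL_Ldelta_complex k : (0 < k < n)%N -> (k + k != n)%N ->
  ln (4 * p%:R * Ldelta) <= lnL k Ldelta.
Proof.
move=> kn kk; have /andP[k0 kn'] := kn.
have d0 : 0 < Ldelta by exact: expR_gt0.
have d1 : Ldelta <= 1.
  by rewrite expR_le1 oppr_le0 !mulr_ge0 ?ltW//; have := Lam_ge1; lra.
have := sum_lnL_nonprincipal_ge d0 d1.
have H : \sum_(1 <= j < n) lnL j Ldelta <=
    \sum_(1 <= j < n) (Lam + ((if j == k then lnL k Ldelta - Lam else 0) +
       (if (j == n - k)%N then lnL k Ldelta - Lam else 0))).
  rewrite !big_nat; apply: ler_sum => j jn.
  case: eqP => [->|_]; first by case: eqP => [h|_]; [move: kk; lia|lra].
  case: eqP => [->|_]; first by rewrite Lval_conj//; lra.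
  by rewrite !addr0; apply: lnL_le.
move: H; rewrite big_split /= big_split /= -!big_mkcond !big_nat1_eq kn.
have -> : (0 < n - k < n)%N by lia.
rewrite sumr_const_nat.
have -> : Lam *+ (n - 1) = (p%:R - 2) * Lam.
  rewrite -[LHS]mulr_natl natrB ?nR; last by have := prime_gt1 pr_p; lia.
  by congr (_ * _); ring.
have -> : ln (4 * p%:R * Ldelta) = Lam + ln 2 - 20 * p%:R * Lam.
  rewrite [LHS]lnM ?posrE ?mulr_gt0// ln_Ldelta.
  have := ln_pow2_mul 1; rewrite (_ : 2 ^+ 2 = 4 :> R); last by ring.
  by move=> ->; rewrite mulr1n.
rewrite ln_Ldelta; have l2 := ln2_le_Lam; have L1 := Lam_ge1; have l1 := @ln2_ge_half R.
have pl : 2 * Lam <= p%:R * Lam by rewrite ler_wpM2r//; lra.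
have pl' : p%:R <= p%:R * Lam by rewrite ler_peMr// ltW.
by move=> H1 H2; lra.
Qed.

(** Lower bounds at the single point [Ldelta] pass to all smaller e. For a non-real character |L| >=
    4 p [Ldelta] there, and the Lipschitz bound changes it by at most 2 p [Ldelta], half of it. The
    quadratic character is bounded at e directly, and 8 [Lam] covers the loss. *)
Lemma lnL_ge_Ldelta k e : (0 < k < n)%N -> 0 < e -> e <= Ldelta ->
  lnL k Ldelta - Lam - (if (k == n./2)%N then 8 * Lam else 0) <= lnL k e.
Proof.
move=> kn e0 ed.
have d0 : 0 < Ldelta by exact: expR_gt0.
have L1 := Lam_ge1; have l2 := ln2_le_Lam; have l1 := @ln2_ge_half R.
have [kk|kk] := eqVneq (k + k)%N n.
  have -> : k == n./2 by rewrite -kk addnn doubleK.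
  have h1 := Lval_quadratic pr_p kn kk e0 (le_trans ed Ldelta_small).
  have h2 := lnL_le pr_p kn d0.
  have h3 := ln_pow2_mul 6; rewrite (_ : 2 ^+ 7 = 128 :> R) in h3; last by ring.
  rewrite h3 in h1; move: h1 h2 L1 l2.
  by move: (lnL k Ldelta) (lnL k e) Lam (ln 2) => a b c d; lra.
have h1 := lnL_Ldelta_complex kn kk.
have Ld0 : 0 < normc (Lval k Ldelta) by exact: (lnL_euler pr_p k d0).1.
have Le0 : 0 < normc (Lval k e) by exact: (lnL_euler pr_p k e0).1.
move: h1; rewrite /lnL ler_ln ?posrE ?mulr_gt0// => h1.
have h2 := Lval_lipschitz pr_p kn e0 ed.
have h3 := normc_subr_le (Lval k Ldelta) (Lval k e).
rewrite normc_distC in h3.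
have h4 : normc (Lval k Ldelta) / 2 <= normc (Lval k e).
  have : 2 * p%:R * (Ldelta - e) <= 2 * p%:R * Ldelta by rewrite ler_wpM2l ?mulr_ge0//; lra.
  by lra.
have h5 : ln (normc (Lval k Ldelta)) - ln 2 <= ln (normc (Lval k e)).
  by rewrite -ln_div ?posrE ?ltr0n// ler_ln// posrE divr_gt0// ltr0n.
move: h5 L1 l2; rewrite -/(lnL k Ldelta) -/(lnL k e).
by case: ifP => _; move: (lnL k Ldelta) (lnL k e) Lam (ln 2) => a b c d; lra.
Qed.

(** In the sum of chi_k(-1) ln |L_k| the principal character supplies ln (1/e). The other terms are
    bounded below independently of e, by comparing their sum with the one at [Ldelta]. *)
Lemma prime_class_lower e : 0 < e -> e <= Ldelta ->
  exists N, ln e^-1 <=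
  p%:R * \sum_(0 <= q < N.+1 | prime q && (p %| q.+1)%N) (q%:R `^ (- (1 + e)))
    + 62 * p%:R * Lam.
Proof.
move=> e0 ed; have [N HN] := eps_lnL_le pr_p e0; exists N.
have d0 : 0 < Ldelta by exact: expR_gt0.
have d1 : Ldelta <= 1.
  by rewrite expR_le1 oppr_le0 !mulr_ge0 ?ltW//; have := Lam_ge1; lra.
have L1 := Lam_ge1; have l2 := ln2_le_Lam; have l1 := @ln2_ge_half R.
have n0 : (0 < n)%N by have := prime_gt1 pr_p; lia.
have S1 : \sum_(1 <= k < n) lnL k Ldelta - n%:R * Lam - 8 * Lam <= \sum_(1 <= k < n) lnL k e.
  apply: (@le_trans _ _ (\sum_(1 <= k < n) (lnL k Ldelta - Lam - (if (k == n./2)%N then 8 * Lam else 0)))).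
    rewrite sumrB sumrB -big_mkcond big_nat1_eq sumr_const_nat.
    rewrite -[Lam *+ _]mulr_natl.
    have : (n - 1)%:R * Lam <= n%:R * Lam by rewrite ler_wpM2r ?ler_nat ?leq_subr//; lra.
    by case: ifP => _; lra.
  by rewrite !big_nat; apply: ler_sum => k kn; exact: lnL_ge_Ldelta.
have S2 := sum_lnL_nonprincipal_ge d0 d1.
rewrite ln_Ldelta in S2.
(* If [eps] is -1, the bound x <= [Lam] gives - x >= x - 2 [Lam]; so the signs cost 2 [Lam] per
   character. *)
have S3 : \sum_(1 <= k < n) lnL k e - n%:R * (2 * Lam) <= \sum_(1 <= k < n) eps pr_p k * lnL k e.
  apply: (@le_trans _ _ (\sum_(1 <= k < n) (lnL k e - 2 * Lam))).
    rewrite sumrB sumr_const_nat -[(2 * Lam) *+ _]mulr_natl lerD2l lerN2.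
    by rewrite ler_wpM2r ?ler_nat ?leq_subr//; lra.
  rewrite !big_nat; apply: ler_sum => k kn.
  have := lnL_le pr_p kn e0.
  by case: (@eps_val R p pr_p k) => ->; move: (lnL k e) Lam L1 => a b; lra.
rewrite big_ltn// eps0 mul1r in HN.
have S4 := lnL0_ge pr_p e0.
have l4 : ln 4 = ln 2 *+ 2 :> R by rewrite -lnXn//; congr ln; ring.
set T := \sum_(0 <= q < _ | _) _ in HN *.
have T0 : 0 <= T by apply: sumr_ge0 => q _; exact: powR_ge0.
move: HN S1 S2 S3 S4; rewrite l4 nR.
move: (\sum_(1 <= k < n) _) (\sum_(1 <= k < n) _) (\sum_(1 <= k < n) _) => a b c.
have pl : 2 * Lam <= p%:R * Lam by rewrite ler_wpM2r//; lra.
have pl' : p%:R <= p%:R * Lam by rewrite ler_peMr// ltW.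
move: pl pl' l1 l2 L1 T0; rewrite -!mulrA.
move: Lam (lnL 0 e) (ln e^-1) (ln 2) (p%:R : R) T => L x y l P T.
by move=> *; lra.
Qed.

Lemma recip_class_lower (N : nat) : 252 * p%:R * Lam <= ln (ln N%:R) ->
  ln (ln N%:R) / (4 * p%:R) <=
  \sum_(0 <= q < N.+1 | prime q && (p %| q.+1)%N) (q%:R)^-1 :> R.
Proof.
set t := ln (ln N%:R) => Ht; have L1 := Lam_ge1.
have pL : 2 <= p%:R * Lam by rewrite -[leLHS]mulr1 ler_pM.
have t8 : 504 <= t by move: pL Ht; rewrite -mulrA; move: (p%:R * Lam) => v; lra.
have N0 : 1 < ln N%:R :> R.
  by rewrite ltNge; apply/negP => /ln_le0; rewrite -/t; lra.
have NR : 1 < N%:R :> R by rewrite ltNge; apply/negP => /ln_le0; lra.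
have Npos : (0 < N)%N by rewrite -(ltr0n R); lra.
have lnN : ln N%:R = expR t by rewrite /t lnK ?posrE//; lra.
(* This makes N^(-e) = exp (- 2 t), so the primes beyond N contribute at most 1, while ln (1/e) = t
   - ln (2 t) >= t / 2. The hypothesis constant is 252 = 4 (62 + 1): the errors 62 p [Lam] and p
   then take at most t / 4. *)
pose e := 2 * t / ln N%:R.
have e0 : 0 < e by rewrite divr_gt0//; lra.
have lne : ln e^-1 = t - ln (2 * t).
  by rewrite /e invf_div ln_div ?posrE -/t//; lra.
have l2t : ln (2 * t) <= t / 2.
  have -> : 2 * t = 2 ^+ 3 * (t / 4) by field.
  have t4 : 0 < t / 4 by lra.
  rewrite [ln _]lnM ?posrE ?exprn_gt0// lnXn//.
  by have := ln_le_subr1 t4; have := @ln2_le1 R; lra.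
have ed : e <= Ldelta.
  rewrite /Ldelta expRN -[leLHS]invrK lef_pV2 ?posrE ?expR_gt0 ?invr_gt0//.
  rewrite -[leRHS]lnK ?posrE ?invr_gt0// ler_expR lne; lra.
have [N' HN'] := prime_class_lower e0 ed.
set S := \sum_(0 <= q < N.+1 | _) _.
have S0 : 0 <= S by apply: sumr_ge0 => q _; rewrite invr_ge0.
have tail : \sum_(0 <= q < N'.+1 | prime q && (p %| q.+1)%N) (q%:R `^ (- (1 + e))) <= S + 1.
  have tr M : (M <= N)%N -> \sum_(0 <= q < M.+1 | prime q && (p %| q.+1)%N) (q%:R `^ (- (1 + e)))
      <= S.
    move=> MN; apply: (@le_trans _ _ (\sum_(0 <= q < M.+1 | prime q && (p %| q.+1)%N) (q%:R)^-1)).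
      apply: ler_sum => q /andP[pq _]; rewrite -[leRHS]powR_inv1//.
      by apply: powRN_le; [exact: prime_gt0|lra].
    rewrite /S (@big_cat_nat _ _ _ M.+1 0 N.+1)//= lerDl.
    by apply: sumr_ge0 => q _; rewrite invr_ge0.
  case: (leqP N' N) => NN; first by have := tr _ NN; lra.
  rewrite (@big_cat_nat _ _ _ N.+1)//=; last by rewrite ltnS ltnW.
  rewrite lerD ?tr//.
  rewrite big_mkcond (le_trans (ler_sum _ (G := fun q => (q%:R : R) `^ (- (1 + e))) _))//.
    by move=> q _; case: ifP => _//; exact: powR_ge0.
  rewrite (le_trans (powRN_tail e0 _ (ltnW NN)))//.
  rewrite ler_pdivrMr// mul1r powRNE// {1}/e divfK ?gt_eqF//; last by lra.
  rewrite expRN -[leRHS]invrK lef_pV2 ?posrE ?expR_gt0 ?invr_gt0//.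
  rewrite -[leLHS]lnK ?posrE ?invr_gt0// ler_expR lne.
  have : 0 <= ln (2 * t) by rewrite ln_ge0//; lra.
  by lra.
rewrite ler_pdivrMr ?mulr_gt0//.
have : p%:R * \sum_(0 <= q < N'.+1 | prime q && (p %| q.+1)%N) (q%:R `^ (- (1 + e)))
   <= p%:R * (S + 1) by rewrite ler_wpM2l// ltW.
have : p%:R <= p%:R * Lam by rewrite ler_peMr// ltW.
move: HN'; rewrite lne; set A := _ * \sum_(0 <= q < _ | _) _.
move: l2t Ht; set u := ln (2 * t); rewrite -[62 * _ * _]mulrA -[252 * _ * _]mulrA.
by set v := p%:R * Lam => *; rewrite mulrCA; lra.
Qed.

End PrimesCongruentToMinusOne.

(** * A Chebyshev upper bound for the primes congruent to -1 *)

Section ChebyshevNat.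
Local Open Scope nat_scope.

(** Keeping the term K / p^m on the left makes the bound inductive: it pays for the next term of the
    sum. *)
Lemma sum_divn_expn_le (p K m : nat) : 0 < p ->
  p.-1 * \sum_(1 <= k < m.+1) K %/ p ^ k + K %/ p ^ m <= K.
Proof.
move=> p0; elim: m => [|m IH]; first by rewrite big_geq// expn0 divn1 muln0.
rewrite big_nat_recr//= mulnDr -addnA; apply: leq_trans IH; rewrite leq_add2l.
rewrite expnSr divnMA addnC -mulSn prednK// mulnC.
exact: leq_divM.
Qed.

Lemma logn_fact_ub (p K : nat) : prime p -> p.-1 * logn p K`! <= K.
Proof.
move=> pp; rewrite logn_fact//.
by apply: leq_trans (sum_divn_expn_le K K (prime_gt0 pp)); exact: leq_addr.
Qed.

Lemma logn_fact_le (p K : nat) : prime p -> logn p K`! <= K.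
Proof.
move=> pp; apply: leq_trans (logn_fact_ub K pp).
by rewrite leq_pmull//; have := prime_gt1 pp; case: (p) => [|[|]].
Qed.

Lemma logn_fact_lb (p K : nat) : prime p -> K %/ p <= logn p K`!.
Proof.
move=> pp; rewrite logn_fact//; case: K => [|K]; first by rewrite div0n.
by rewrite big_ltn// expn1 leq_addr.
Qed.

Lemma dvdn_prod_uniq_primes (s : seq nat) (A : nat) : uniq s -> all prime s ->
  (forall q, q \in s -> q %| A) -> \prod_(q <- s) q %| A.
Proof.
elim: s => [|q s IH] /=; first by rewrite big_nil dvd1n.
move=> /andP[qs us] /andP[pq ps] H; rewrite big_cons Gauss_dvd.
  by rewrite H ?mem_head//= IH// => r rs; rewrite H// inE rs orbT.
rewrite big_seq; apply big_ind => //= [|x y cx cy|r rs]; first by rewrite coprimen1.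
  by rewrite coprimeMr cx.
by rewrite prime_coprime// dvdn_prime2// ?(allP ps)//; apply: contraNN qs => /eqP ->.
Qed.

Lemma fact_mul_prod_shift (u K : nat) :
  u`! * \prod_(1 <= k < K.+1) (k + u) = (K + u)`!.
Proof.
elim: K => [|K IH]; first by rewrite big_geq// muln1.
by rewrite big_nat_recr//= mulnA IH addSn factS mulnC.
Qed.

Lemma prime_dvd_fact (q K : nat) : prime q -> q %| K`! -> q <= K.
Proof.
move=> pq; elim: K => [|K IH]; first by rewrite dvdn1 => /eqP q1; rewrite q1 in pq.
rewrite factS Euclid_dvdM// => /orP[/dvdn_leq -> //|/IH qK]; exact: leqW.
Qed.

(* With p u = -1 mod M one has k p - 1 = p (k + u), and K! divides the product
   of the K consecutive integers k + u. *)
Lemma partn_fact_dvd_prod_class (p K : nat) : prime p ->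
  (K`!)`_p^' %| \prod_(1 <= k < K.+1) (k * p - 1).
Proof.
move=> pp; set M := (K`!)`_p^'.
have M0 : 0 < M by exact: part_gt0.
have cMp : coprime p M.
  by rewrite coprime_sym; apply: (@p'nat_coprime p); [exact: part_pnat|rewrite pnat_id].
(* Bezout gives km p = kn M + 1; multiplying km by M - 1, which is -1 mod M, changes the sign of the
   residue. *)
have [u Mu] : exists u, M %| (p * u).+1.
  case: (egcdnP M (prime_gt0 pp)) => km kn E _.
  rewrite (eqP cMp) in E; exists (km * M.-1).
  have -> : (p * (km * M.-1)).+1 = kn * M.-1 * M + M by nia.
  by rewrite dvdn_add// dvdn_mull.
have E K' : \prod_(1 <= k < K'.+1) (k * p - 1) = \prod_(1 <= k < K'.+1) (p * (k + u)) %[mod M].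
  elim: K' => [|k IH]; first by rewrite !big_geq.
  rewrite !(big_nat_recr k.+1)//= -modnMm IH modnMm -modnMmr -[RHS]modnMmr.
  congr ((_ * _) %% _).
  have -> : p * (k.+1 + u) = (k.+1 * p - 1) + (p * u).+1.
    by have := prime_gt0 pp; nia.
  by rewrite -modnDmr (eqP Mu) addn0.
rewrite /dvdn E -/(dvdn _ _) big_split /=.
apply: dvdn_mull; apply: (@dvdn_trans K`!); first exact: dvdn_part.
rewrite -(@dvdn_pmul2l u`!) ?fact_gt0// fact_mul_prod_shift.
by rewrite -(@bin_fact (K + u) K) ?leq_addr// addKn mulnC dvdn_mull.
Qed.

Lemma prod_class_primes_le (p K : nat) : prime p ->
  \prod_(K.+1 <= q < K * p | prime q && (p %| q.+1)) q <= p ^ (2 * K).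
Proof.
move=> pp; have p1 := prime_gt1 pp; set M := (K`!)`_p^'.
have M0 : 0 < M by exact: part_gt0.
set A := \prod_(1 <= k < K.+1) (k * p - 1).
have A0 : 0 < A.
  rewrite /A big_nat_cond prodn_cond_gt0// => k /andP[/andP[k1 _] _].
  by nia.
pose s := [seq q <- index_iota K.+1 (K * p) | prime q && (p %| q.+1)].
have us : uniq s by rewrite filter_uniq// iota_uniq.
have sP q : q \in s -> [/\ K < q, q < K * p, prime q & p %| q.+1].
  by rewrite mem_filter mem_index_iota => /andP[/andP[? ?] /andP[? ?]].
have ps : all prime s by apply/allP => q /sP[].
have sA : \prod_(q <- s) q %| A.
  apply: dvdn_prod_uniq_primes => // q /sP[Kq qK pq /dvdnP[k kE]].
  have k1 : 0 < k by case: k kE.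
  have kK : k < K.+1.
    have : k * p <= K * p by rewrite -kE.
    by rewrite leq_pmul2r// ltnW.
  rewrite /A (big_cat_nat (n := k))//=; last by rewrite ltnW.
  rewrite [X in _ * X]big_ltn// -kE subn1 /=.
  by rewrite dvdn_mull// dvdn_mulr.
have cMs : coprime M (\prod_(q <- s) q).
  rewrite big_seq; apply big_ind => //= [|x y cx cy|q /sP[Kq _ pq _]].
  - by rewrite coprimen1.
  - by rewrite coprimeMr cx.
  rewrite coprime_sym prime_coprime//; apply/negP => qM.
  have : q %| K`! by apply: dvdn_trans qM (dvdn_part _ _).
  by move=> /(prime_dvd_fact pq); rewrite leqNgt Kq.
have MQ : M * \prod_(q <- s) q <= A.
  by apply: dvdn_leq => //; rewrite Gauss_dvd// partn_fact_dvd_prod_class.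
have AK : A <= p ^ K * K`!.
  have -> : p ^ K * K`! = \prod_(1 <= k < K.+1) (k * p).
    by rewrite big_split /= prod_nat_const_nat subn1 fact_prod mulnC.
  by apply: leq_prod => k _; exact: leq_subr.
(* The p-part of K! is at most p^K, so M cancels and leaves the bound p^(2 K). *)
have KE : K`! <= M * p ^ K.
  rewrite -[leqLHS](partnC p (fact_gt0 K)) mulnC leq_mul2l p_part.
  by rewrite leq_pexp2l ?logn_fact_le ?orbT// prime_gt0.
rewrite -(leq_pmul2l M0) -big_filter (leq_trans MQ)// (leq_trans AK)//.
by rewrite mulnC (leq_trans (leq_mul KE (leqnn _)))// mul2n -addnn expnD mulnA.
Qed.
End ChebyshevNat.

Section ChebyshevReal.
Context {R : realType}.

Lemma harmonic_sum_le (n : nat) : (0 < n)%N ->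
  \sum_(1 <= j < n.+1) (j%:R)^-1 <= 1 + ln n%:R :> R.
Proof.
elim: n => // -[|n] IH _; first by rewrite big_nat1 invr1 ln1 addr0.
rewrite big_nat_recr//= (le_trans (lerD (IH isT) (@invS_le_ln R n.+1 isT)))//.
by rewrite -addrA subrKC.
Qed.

Variable p : nat.
Hypothesis pr_p : prime p.
Let pR2 : 2 <= p%:R :> R. Proof. by rewrite ler_nat prime_gt1. Qed.
Let pR0 : 0 < p%:R :> R. Proof. by rewrite ltr0n prime_gt0. Qed.
Let lnp0 : 0 <= ln p%:R :> R. Proof. by rewrite ln_ge0// ler1n prime_gt0. Qed.

Definition theta_class (N : nat) : R :=
  \sum_(0 <= q < N.+1 | prime q && (p %| q.+1)%N) ln q%:R.

Lemma ln_nat_ge0 (q : nat) : 0 <= ln q%:R :> R.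
Proof. by case: q => [|q]; [rewrite ln0|rewrite ln_ge0// ler1n]. Qed.

Lemma theta_class_step (K N : nat) : (0 < K)%N -> (N <= K * p)%N ->
  theta_class N <= theta_class K + 2 * K%:R * ln p%:R.
Proof.
move=> K0 NK; have p0 := prime_gt0 pr_p.
apply: (@le_trans _ _ (theta_class (K * p))).
  rewrite /theta_class [leRHS](@big_cat_nat _ _ _ N.+1)//= lerDl.
  by apply: sumr_ge0 => q _; exact: ln_nat_ge0.
rewrite /theta_class (@big_cat_nat _ _ _ K.+1 _ (K * p).+1)//= ?ltnS ?leq_pmulr// lerD2l.
have -> : \sum_(K.+1 <= q < (K * p).+1 | prime q && (p %| q.+1)%N) ln q%:R =
   \sum_(K.+1 <= q < K * p | prime q && (p %| q.+1)%N) ln q%:R :> R.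
  case: (leqP (K * p) K) => KK; first by rewrite !big_geq// ltnW.
  rewrite big_mkcond big_nat_recr//= -big_mkcond /=.
  have -> : (p %| (K * p).+1)%N = false.
    rewrite -addn1 dvdn_addr ?dvdn_mull// dvdn1; apply/negbTE.
    by rewrite neq_ltn prime_gt1// orbT.
  by rewrite andbF addr0.
rewrite -ln_prod; last by move=> q /andP[/prime_gt0 q0 _]; rewrite ltr0n.
have -> : 2 * K%:R * ln p%:R = ln ((p ^ (2 * K))%:R) :> R.
  by rewrite natrX lnXn// -[RHS]mulr_natl natrM.
rewrite -natr_prod ler_ln ?posrE ?ltr0n ?expn_gt0 ?p0//.
  by rewrite ler_nat prod_class_primes_le.
by rewrite prodn_cond_gt0// => q /andP[/prime_gt0].
Qed.

(** Strong induction through [theta_class_step] with K the ceiling of N / p. If N < 2 or N + 1 < p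
    the sum is empty. *)
Lemma theta_class_le (N : nat) : theta_class N <= 12 * N%:R * ln p%:R / p%:R.
Proof.
have p1 := prime_gt1 pr_p; have p0 := prime_gt0 pr_p.
have [m] := ubnP N; elim: m N => // m IH N Nm.
have [small|] := boolP ((N < 2) || (N.+1 < p))%N.
  rewrite /theta_class big_nat_cond big1 ?divr_ge0 ?mulr_ge0// ?ltW//.
  by move=> q /andP[/andP[_ qN] /andP[/prime_gt1 q1 /(dvdn_leq (ltn0Sn _))]]; lia.
rewrite negb_or -!leqNgt => /andP[N2 pN].
pose K := ((N + p.-1) %/ p)%N.
have Kp : (K * p <= N + p.-1)%N by exact: leq_divM.
have KN : (N <= K * p)%N.
  have := ltn_ceil (N + p.-1) p0; rewrite -/K mulSn; lia.
have K0 : (0 < K)%N by rewrite lt0n; apply/eqP => K0; rewrite K0 in KN; lia.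
have KltN : (K < N)%N.
  rewrite -(ltn_pmul2r p0) (leq_ltn_trans Kp)//.
  have : (0 < N.-1 * p.-1)%N by rewrite muln_gt0; lia.
  by nia.
have h1 := theta_class_step K0 KN.
have h2 := IH K (leq_trans KltN (ltnSE Nm)).
apply: (le_trans h1); apply: (le_trans (lerD h2 (lexx _))).
have KR : K%:R * p%:R <= N%:R + p%:R - 1 :> R.
  have : (K * p)%:R <= (N + p.-1)%:R :> R by rewrite ler_nat.
  by rewrite natrM natrD -subn1 natrB//; lra.
have -> : 12 * K%:R * ln p%:R / p%:R + 2 * K%:R * ln p%:R =
   (K%:R * p%:R) * (12 + 2 * p%:R) / p%:R * (ln p%:R / p%:R) :> R.
  by field; rewrite gt_eqF.
have -> : 12 * N%:R * ln p%:R / p%:R = 12 * N%:R * (ln p%:R / p%:R) :> R by rewrite mulrA.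
apply: ler_wpM2r; first by rewrite divr_ge0 // ?ltW.
rewrite ler_pdivrMr//.
have N2R : 2 <= N%:R :> R by rewrite ler_nat.
have pNR : p%:R <= N%:R + 1 :> R by rewrite natr1 ler_nat.
(* It remains to show K p (12 + 2 p) <= 12 N p. For p = 2, K p <= N + 1 is needed; for p >= 3 the
   cruder K p <= 2 N is enough. *)
have [p2|p2] := leqP p 2.
  have pE : p%:R = 2 :> R by have -> : p = 2 by lia.
  by rewrite pE in KR *; lra.
have p3 : 3 <= p%:R :> R by rewrite ler_nat.
apply: (@le_trans _ _ (2 * N%:R * (12 + 2 * p%:R))).
  by rewrite ler_wpM2r//; lra.
have : 3 * N%:R <= N%:R * p%:R :> R by rewrite mulrC ler_wpM2l.
lra.
Qed.

Lemma class_recip_dyadic (J : nat) :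
  \sum_(0 <= q < 2 ^ J.+1 | prime q && (p %| q.+1)%N) (q%:R)^-1
   <= 48 * (ln p%:R / p%:R) * \sum_(1 <= j < J.+1) (j%:R)^-1 :> R.
Proof.
elim: J => [|J IH].
  rewrite big_nat_cond big1 ?(@big_geq _ _ _ 1 1)// ?mulr0//.
  by move=> q /andP[/andP[_ q2] /andP[/prime_gt1 q1 _]]; move: q2 q1; rewrite expn1; lia.
rewrite (@big_cat_nat _ _ _ (2 ^ J.+1))//=; last by rewrite leq_exp2l.
rewrite big_nat_recr//= mulrDr lerD//.
have l2 := @ln2_ge_half R.
have J0 : 0 < J.+1%:R :> R by [].
(* A lower bound for q ln q on the block, so that 1/q <= ln q / c. The constant 48 is 12 times 2,
   for the upper end of the block, divided by the bound 1/2 for ln 2. *)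
pose c : R := (2 ^ J.+1)%:R * (J.+1%:R * ln 2).
have c0 : 0 < c by rewrite !mulr_gt0 ?ltr0n ?expn_gt0//; lra.
apply: (@le_trans _ _ (theta_class (2 ^ J.+2) / c)).
  apply: (@le_trans _ _ (\sum_(2 ^ J.+1 <= q < 2 ^ J.+2 | prime q && (p %| q.+1)%N) ln q%:R / c)).
    rewrite big_nat_cond [leRHS]big_nat_cond; apply: ler_sum => q /andP[/andP[qJ _] /andP[pq _]].
    have q0 := prime_gt0 pq.
    rewrite ler_pdivlMr// mulrC ler_pdivrMr ?ltr0n// mulrC.
    rewrite /c; apply: ler_pM => //.
      by rewrite mulr_ge0//; lra.
      by rewrite ler_nat.
    have -> : J.+1%:R * ln 2 = ln ((2 ^ J.+1)%:R) :> R.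
      by rewrite natrX lnXn// -[RHS]mulr_natl.
    by rewrite ler_ln ?posrE ?ltr0n ?expn_gt0// ler_nat.
  rewrite -mulr_suml ler_pM2r ?invr_gt0// /theta_class.
  rewrite [leRHS](@big_cat_nat _ _ _ (2 ^ J.+2))//=.
  rewrite [X in _ <= X + _](@big_cat_nat _ _ _ (2 ^ J.+1))//= ?leq_exp2l//.
  rewrite addrAC lerDr addr_ge0//;
    by apply: sumr_ge0 => q _; exact: ln_nat_ge0.
rewrite ler_pdivrMr// (le_trans (theta_class_le _))//.
have -> : (2 ^ J.+2)%:R = 2 * (2 ^ J.+1)%:R :> R by rewrite expnS natrM.
rewrite /c; set A := (2 ^ J.+1)%:R; set B := ln p%:R / p%:R.
have -> : 48 * B * J.+1%:R^-1 * (A * (J.+1%:R * ln 2)) = 48 * B * A * ln 2 :> R.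
  by field; rewrite gt_eqF.
have -> : 12 * (2 * A) * ln p%:R / p%:R = 48 * B * A * 2^-1 :> R.
  by rewrite /B; field; rewrite gt_eqF.
by rewrite ler_wpM2l// !mulr_ge0// ?divr_ge0// ltW.
Qed.

Lemma class_recip_upper (N : nat) : 1 <= ln (ln N%:R) :> R ->
  \sum_(0 <= q < N.+1 | prime q && (p %| q.+1)%N) (q%:R)^-1
   <= 192 * (ln p%:R / p%:R) * ln (ln N%:R) :> R.
Proof.
set t := ln (ln _) => t1.
have N0 : 1 < ln N%:R :> R.
  by rewrite ltNge; apply/negP => /ln_le0; rewrite -/t; lra.
have NR : 1 < N%:R :> R by rewrite ltNge; apply/negP => /ln_le0; lra.
have N1 : (1 < N)%N by rewrite -(ltr1n R).
have lnN : ln N%:R = expR t by rewrite /t lnK ?posrE//; lra.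
pose J := trunc_log 2 N.
have /andP[JN NJ] : (2 ^ J <= N < 2 ^ J.+1)%N by apply: trunc_log_bounds => //; lia.
have J0 : (0 < J)%N by rewrite trunc_log_gt0.
have B0 : 0 <= ln p%:R / p%:R :> R by rewrite divr_ge0 // ?ltW.
apply: (@le_trans _ _ (\sum_(0 <= q < 2 ^ J.+1 | prime q && (p %| q.+1)%N) (q%:R)^-1)).
  by rewrite [leRHS](@big_cat_nat _ _ _ N.+1)//= lerDl sumr_ge0.
rewrite (le_trans (class_recip_dyadic J))//.
have hJ : ln J%:R <= ln 2 + t.
  rewrite -[t]expRK -lnM ?posrE ?expR_gt0// ler_ln ?posrE ?ltr0n ?mulr_gt0 ?expR_gt0//.
  rewrite -lnN; have : ln ((2 ^ J)%:R) <= ln N%:R :> R.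
    by rewrite ler_ln ?posrE ?ltr0n ?expn_gt0//; [rewrite ler_nat|lia].
  rewrite natrX lnXn// -[ln 2 *+ J]mulr_natl.
  have := @ln2_ge_half R; have : 0 <= J%:R :> R by [].
  by move: (ln 2) J%:R (ln N%:R) => a b c; nra.
have h := harmonic_sum_le J0; have := @ln2_le1 R => l2.
have -> : 192 * (ln p%:R / p%:R) * t = 48 * (ln p%:R / p%:R) * (4 * t) :> R by ring.
by rewrite ler_wpM2l ?mulr_ge0//; lra.
Qed.

End ChebyshevReal.

(** * The Basel problem *)

Section Basel.
Context {R : realType}.
Implicit Types x : R.

Lemma sin_le_id x : 0 < x -> sin x <= x.
Proof.
move=> x0.
have [|c _] := @MVT R (@sin R) (@cos R) 0 x x0 (fun y _ => is_derive_sin y).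
  exact/continuous_subspaceT/continuous_sin.
by rewrite sin0 !subr0 => ->; rewrite ler_piMl ?cos_le1// ltW.
Qed.

Lemma id_le_tan x : 0 < x < pi / 2 -> x <= tan x.
Proof.
move=> /andP[x0 x1].
have cosn0 y : y \in `[0, x] -> cos y != 0.
  rewrite in_itv /= => /andP[y0 yx]; rewrite gt_eqF// cos_gt0_pihalf//; lra.
have [||c cx] := @MVT R (@tan R) (fun y => (cos y)^-2) 0 x x0.
- by move=> y yx; apply: is_derive_tan; apply: cosn0; apply: subset_itv_oo_cc.
- apply: continuous_in_subspaceT => y; rewrite in_setE /= => yx.
  by apply: continuous_tan; apply: cosn0.
rewrite tan0 !subr0 => ->; apply: ler_peMl; first exact: ltW.
have c0 : cos c != 0 by apply: cosn0; apply: subset_itv_oo_cc.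
have c2 : 0 < cos c ^+ 2 by rewrite exprn_even_gt0.
by rewrite /= invf_ge1// -(cos2Dsin2 c) lerDl sqr_ge0.
Qed.

Lemma inv_sin_sqr_bounds x : 0 < x < pi / 2 ->
  x ^- 2 <= (sin x) ^- 2 <= x ^- 2 + 1.
Proof.
move=> x01; have /andP[x0 x1] := x01.
have s0 : 0 < sin x by exact: sin_gt0_pihalf.
have c0 : 0 < cos x by rewrite cos_gt0_pihalf//; lra.
have h1 := sin_le_id x0; have h2 := id_le_tan x01.
apply/andP; split.
  by rewrite lef_pV2 ?posrE ?exprn_gt0// lerXn2r// nnegrE ltW.
have -> : (sin x) ^- 2 = (cos x / sin x) ^+ 2 + 1.
  rewrite expr_div_n; apply: (mulIf (x := sin x ^+ 2)); first by rewrite expf_neq0 ?gt_eqF.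
  rewrite mulVf ?expf_neq0 ?gt_eqF// mulrDl divfK ?expf_neq0 ?gt_eqF// mul1r.
  by rewrite cos2Dsin2.
have h3 : cos x / sin x <= x^-1.
  by rewrite -[leLHS]invrK lef_pV2 ?posrE ?invr_gt0 ?divr_gt0// invf_div.
have h4 : 0 <= cos x / sin x by apply: divr_ge0; exact: ltW.
by rewrite lerD2r -exprVn lerXn2r// nnegrE invr_ge0 ltW.
Qed.

(** For k < 2^n these are the odd multiples of pi / 2^(n+2) below pi / 2. Halving one of them, or
    subtracting the half from pi / 2, gives those of the next level. *)
Definition theta_ang (n k : nat) : R := k.*2.+1%:R * pi / (2 ^ n.+2)%:R.

Definition sinsum (n : nat) : R := \sum_(0 <= k < 2 ^ n) (sin (theta_ang n k)) ^- 2.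

Lemma theta_ang_bounds n k : (k < 2 ^ n)%N -> 0 < theta_ang n k < pi / 2.
Proof.
move=> kn; have p0 : 0 < pi :> R := pi_gt0 R.
have E0 : 0 < (2 ^ n.+2)%:R :> R by rewrite ltr0n expn_gt0.
rewrite /theta_ang; apply/andP; split; first by rewrite !mulr_gt0 ?invr_gt0.
rewrite ltr_pdivrMr//.
have -> : pi / 2 * (2 ^ n.+2)%:R = (2 ^ n.+1)%:R * pi :> R.
  by rewrite (expnS _ n.+1) natrM; field.
rewrite ltr_pM2r// ltr_nat expnS; lia.
Qed.

Lemma inv_sin_sqr_half x : sin (x / 2) != 0 -> cos (x / 2) != 0 ->
  (sin x) ^- 2 = ((sin (x / 2)) ^- 2 + (sin (pi / 2 - x / 2)) ^- 2) / 4.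
Proof.
move=> s0 c0.
have -> : sin (pi / 2 - x / 2) = cos (x / 2) by rewrite addrC sinDpihalf cosN.
have -> : sin x = 2 * cos (x / 2) * sin (x / 2).
  have {1}-> : x = (x / 2) *+ 2 by rewrite -mulr_natr divfK.
  by rewrite sin_mulr2n -mulr_natl mulrA.
have := cos2Dsin2 (x / 2); move: s0 c0; set s := sin _; set c := cos _ => s0 c0 h.
have -> : s ^- 2 + c ^- 2 = (s ^+ 2 * c ^+ 2)^-1.
  rewrite -[RHS]mul1r -h; field; rewrite c0 s0//.
by field; rewrite s0 c0.
Qed.

(* Hofbauer's proof: inv_sin_sqr_half turns each term into two. *)
Lemma sinsumE n : sinsum n = 2 * 4 ^+ n.
Proof.
elim: n => [|n IH].
  rewrite /sinsum expn0 big_nat1 /theta_ang mul1r.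
  have -> : sin (pi / (2 ^ 2)%:R) ^- 2 = 2 :> R.
    have := cos2Dsin2 (pi / 4 : R); have := cos_pihalf R.
    have -> : pi / 2 = (pi / 4) *+ 2 :> R by rewrite -mulr_natr; field.
    rewrite cos_mulr2n => h1 h2.
    have -> : sin (pi / (2 ^ 2)%:R) ^+ 2 = 2^-1 :> R by move: h1 h2; rewrite -mulr_natr; lra.
    by rewrite invrK.
  by rewrite expr0 mulr1.
have -> : sinsum n.+1 = 4 * sinsum n; last by rewrite IH exprS; ring.
rewrite /sinsum (@big_cat_nat _ _ _ (2 ^ n))//= ?leq_exp2l//.
have -> : \sum_(2 ^ n <= i < 2 ^ n.+1) sin (theta_ang n.+1 i) ^- 2 =
   \sum_(0 <= i < 2 ^ n) sin (theta_ang n.+1 (2 ^ n.+1 - i.+1)) ^- 2.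
  have E : (2 ^ n.+1 = 2 ^ n + 2 ^ n)%N by rewrite expnS mul2n addnn.
  rewrite [LHS]big_nat_rev /= -[X in \sum_(X <= _ < _) _]add0n big_addn.
  rewrite [X in \sum_(_ <= _ < X) _ = _](_ : _ = 2 ^ n)%N; last by rewrite E addnK.
  apply: eq_big_nat => i /andP[_ iN]; congr (sin (theta_ang _ _) ^- 2).
  by rewrite E; lia.
rewrite -big_split mulr_sumr /=; apply: eq_big_nat => k /andP[_ kn].
have /andP[t0 t1] := theta_ang_bounds kn.
have tE : theta_ang n.+1 k = theta_ang n k / 2.
  rewrite /theta_ang (expnS _ n.+2) natrM; field.
  by rewrite pnatr_eq0 -lt0n expn_gt0.
have tE' : theta_ang n.+1 (2 ^ n.+1 - k.+1) = pi / 2 - theta_ang n k / 2.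
  rewrite -tE /theta_ang.
  have -> : ((2 ^ n.+1 - k.+1).*2.+1)%:R = (2 ^ n.+2)%:R - k.*2.+1%:R :> R.
    rewrite -natrB; last by rewrite !expnS; lia.
    by congr (_ %:R); rewrite !expnS; lia.
  rewrite (expnS _ n.+2) natrM; field.
  by rewrite pnatr_eq0 -lt0n expn_gt0.
have p0 : 0 < pi :> R := pi_gt0 R.
rewrite tE tE' [in RHS]inv_sin_sqr_half.
- by rewrite mulrCA divff ?mulr1.
- by rewrite gt_eqF// sin_gt0_pihalf//; lra.
- by rewrite gt_eqF// cos_gt0_pihalf//; lra.
Qed.

(** Replacing 1 / sin^2 by the inverse square of the angle changes each of the 2^n terms by at most
    1, against a total of 2 4^n. *)
Lemma odd_inv_sqr_bounds n :
  pi ^+ 2 / 8 * (1 - (2 ^+ n)^-1 / 2) <=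
  \sum_(0 <= k < 2 ^ n) (k.*2.+1%:R : R) ^- 2 <= pi ^+ 2 / 8.
Proof.
have p0 : 0 < pi :> R := pi_gt0 R.
have tE k : (theta_ang n k) ^- 2 = (16 * 4 ^+ n / pi ^+ 2) * (k.*2.+1%:R) ^- 2.
  rewrite /theta_ang natrX (_ : 4 ^+ n = (2 ^+ n) ^+ 2 :> R); last first.
    by rewrite -exprM mulnC exprM -[4]/(2 * 2)%:R natrM.
  rewrite (_ : 2 ^+ n.+2 = 4 * 2 ^+ n :> R); last by rewrite !exprS; ring.
  have w0 : 2 ^+ n != 0 :> R by rewrite expf_neq0.
  have k0 : k.*2.+1%:R != 0 :> R by rewrite pnatr_eq0.
  move: w0 k0 (gt_eqF p0); move: pi (2 ^+ n) (k.*2.+1%:R) => y w v w0 v0 y0.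
  by field; rewrite w0 v0 y0.
set c := 16 * 4 ^+ n / pi ^+ 2 in tE.
have c0 : 0 < c by rewrite divr_gt0 ?mulr_gt0 ?exprn_gt0.
have S1 : c * \sum_(0 <= k < 2 ^ n) (k.*2.+1%:R : R) ^- 2 <= 2 * 4 ^+ n.
  rewrite -sinsumE mulr_sumr /sinsum !big_nat; apply: ler_sum => k /andP[_ kn].
  by rewrite -tE; have /andP[] := inv_sin_sqr_bounds (theta_ang_bounds kn).
have S2 : 2 * 4 ^+ n <= c * \sum_(0 <= k < 2 ^ n) (k.*2.+1%:R : R) ^- 2 + 2 ^+ n.
  have -> : 2 ^+ n = \sum_(0 <= k < 2 ^ n) (1 : R) by rewrite sumr_const_nat subn0 natrX.
  rewrite -sinsumE mulr_sumr -big_split /=.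
  rewrite /sinsum !big_nat; apply: ler_sum => k /andP[_ kn].
  by rewrite -tE; have /andP[] := inv_sin_sqr_bounds (theta_ang_bounds kn).
have cE : pi ^+ 2 / 8 = 2 * 4 ^+ n / c.
  have : 4 ^+ n != 0 :> R by rewrite expf_neq0.
  rewrite /c; move: (gt_eqF p0); move: pi (4 ^+ n) => y w y0 w0.
  by field; rewrite w0 y0.
rewrite cE; apply/andP; split; last by rewrite ler_pdivlMr// mulrC.
rewrite mulrAC ler_pdivrMr// [leRHS]mulrC.
have E4 : 4 ^+ n = 2 ^+ n * 2 ^+ n :> R by rewrite -exprMn; congr (_ ^+ n); ring.
have -> : 2 * 4 ^+ n * (1 - (2 ^+ n)^-1 / 2) = 2 * 4 ^+ n - 2 ^+ n :> R.
  by rewrite E4; field; rewrite expf_neq0.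
by lra.
Qed.

Lemma sum_inv_sqr_double N :
  \sum_(1 <= m < N.*2.+1) (m%:R : R) ^- 2 =
  \sum_(0 <= k < N) (k.*2.+1%:R : R) ^- 2 + (\sum_(1 <= m < N.+1) (m%:R : R) ^- 2) / 4.
Proof.
elim: N => [|N IH]; first by rewrite !big_geq// mul0r addr0.
rewrite doubleS (@big_nat_recr _ _ _ N.*2.+2 1)//= (@big_nat_recr _ _ _ N.*2.+1 1)//= IH.
rewrite (@big_nat_recr _ _ _ N 0)//= (@big_nat_recr _ _ _ N.+1 1)//=.
have -> : N.*2.+2%:R = 2 * N.+1%:R :> R by rewrite -doubleS -mul2n natrM.
have n1 : N.+1%:R != 0 :> R by rewrite pnatr_eq0.
have n2 : N.*2.+1%:R != 0 :> R by rewrite pnatr_eq0.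
move: n1 n2; move: N.+1%:R N.*2.+1%:R (\sum_(0 <= k < N) _) (\sum_(1 <= k < N.+1) _).
by move=> a b c d a0 b0; field; rewrite a0 b0.
Qed.

Lemma basel : (fun N => \sum_(1 <= m < N.+1) (m%:R : R) ^- 2) @ \oo --> (pi ^+ 2 / 6 : R).
Proof.
pose z N : R := \sum_(1 <= m < N.+1) m%:R ^- 2.
have zc : cvgn z.
  apply: (@real_cauchy_tail R z (fun M => (M%:R)^-1) 1).
    by rewrite -cvg_shiftS; exact: cvg_harmonic.
  move=> M N /andP[M0 MN]; rewrite /z (@big_cat_nat _ _ _ M.+1 _ N.+1)//=.
  rewrite addrAC subrr add0r ger0_norm; last first.
    by apply: sumr_ge0 => i _; rewrite invr_ge0 exprn_ge0.
  by apply: powRN2_tail; lia.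
have [Z zZ] : exists Z : R, z @ \oo --> Z by exists (limn z).
suff <- : Z = pi ^+ 2 / 6 by [].
pose o n : R := \sum_(0 <= k < 2 ^ n) (k.*2.+1%:R : R) ^- 2.
have expoo : (fun n => 2 ^ n)%N @ \oo --> \oo.
  apply/cvgnyPge => A; near=> n; apply: (@leq_trans n); last by rewrite ltnW// ltn_expl.
  by near: n; exists A.
have h1 : (fun n => z (2 ^ n)%N) @ \oo --> Z by apply: cvg_comp expoo zZ.
have h2 : (fun n => z (2 ^ n.+1)%N) @ \oo --> Z.
  by have := h1; rewrite -cvg_shiftS.
have h3 : o @ \oo --> (pi ^+ 2 / 8 : R).
  have sq : \forall n \near \oo, pi ^+ 2 / 8 * (1 - (2 ^+ n)^-1 / 2) <= o n <= pi ^+ 2 / 8.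
    by near=> n; exact: odd_inv_sqr_bounds.
  apply: (squeeze_cvgr sq).
  - rewrite -[X in _ --> X]mulr1; apply: cvgMr; rewrite -[X in _ --> X]subr0.
    apply: cvgB; first exact: cvg_cst.
    rewrite -[X in _ --> X](mul0r 2^-1); apply: cvgMl.
    under eq_fun do rewrite -exprVn.
    by apply: cvg_expr; rewrite ger0_norm ?invr_ge0// invf_lt1// ltr1n.
  - exact: cvg_cst.
have h4 : (fun n => z (2 ^ n.+1)%N) @ \oo --> pi ^+ 2 / 8 + Z / 4.
  have -> : (fun n => z (2 ^ n.+1)%N) = (fun n => o n + z (2 ^ n)%N / 4).
    by apply/funext => n; rewrite /z /o expnS mul2n sum_inv_sqr_double.
  by apply: cvgD => //; apply: cvgMl.
(* The odd terms tend to pi^2 / 8 and the even ones are a quarter of the whole series. *)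
have E : Z = pi ^+ 2 / 8 + Z / 4 by rewrite -[LHS](cvg_lim _ h2)// -[RHS](cvg_lim _ h4).
by lra.
Unshelve. all: by end_near. Qed.

End Basel.

(** * Mertens' theorems *)

Section MertensFirst.
Context {R : realType}.

Lemma sum_ln_inv_sqr_tail (M N : nat) : (0 < M)%N ->
  \sum_(M.+1 <= m < N.+1) ln m%:R / (m%:R) ^+ 2 <= (ln M%:R + 2) / M%:R :> R.
Proof.
move=> M0; have fM : 0 <= (ln M%:R + 2) / M%:R :> R.
  by rewrite divr_ge0// addr_ge0// ln_nat_ge0.
case: (leqP M N) => MN; last by rewrite big_geq// ltnW.
(* - (ln x + 1) / x is a primitive of ln x / x^2; the 2 in place of 1 pays for the discrete step. *)
pose f (m : nat) : R := (ln m%:R + 2) / m%:R.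
suff H : \sum_(M.+1 <= m < N.+1) ln m%:R / (m%:R) ^+ 2 <= \sum_(M <= m < N) (f m - f m.+1).
  rewrite (le_trans H)// telescope_sumr_nat// /f lerBlDr lerDl.
  by rewrite divr_ge0// addr_ge0// ln_nat_ge0.
rewrite big_add1 /= !big_nat; apply: ler_sum => m /andP[Mm _].
have m0 : (0 < m)%N by apply: leq_trans Mm.
have mR : 0 < m%:R :> R by rewrite ltr0n.
have mS : 0 < m.+1%:R :> R by [].
have l0 := @ln_nat_ge0 R m.
have l1 := @lnS_sub_le R m m0.
have i1 : m%:R^-1 <= 1 :> R by rewrite invf_le1// ler1n.
have -> : f m - f m.+1 = (ln m%:R + 2 - m%:R * (ln m.+1%:R - ln m%:R)) / (m%:R * m.+1%:R).
  rewrite /f; have E : m.+1%:R = m%:R + 1 :> R by rewrite natr1.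
  move: mR mS; rewrite E; move: (ln (m%:R + 1 : R)) (ln (m%:R : R)) (m%:R : R) => a b c c0 c1.
  by field; rewrite ?gt_eqF.
apply: (@le_trans _ _ ((ln m%:R + 1) / (m%:R * m.+1%:R))); last first.
  rewrite ler_pM2r ?invr_gt0 ?mulr_gt0//.
  have : m%:R * (ln m.+1%:R - ln m%:R) <= 1 :> R.
    by rewrite -ler_pdivlMl// mulr1.
  by lra.
rewrite expr2; apply: ler_pM; rewrite ?invr_ge0 ?mulr_ge0 ?ln_nat_ge0//; first by lra.
by rewrite lef_pV2 ?posrE ?mulr_gt0// ler_pM2r// ler_nat.
Qed.

Lemma ln_fact_ub (n : nat) : ln n`!%:R <= n%:R * ln n%:R :> R.
Proof.
elim: n => [|n IH]; first by rewrite fact0 ln1 mul0r.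
rewrite factS natrM lnM ?posrE ?ltr0n ?fact_gt0// -natr1 mulrDl mul1r addrC lerD2r.
apply: (le_trans IH); rewrite ler_wpM2l//.
rewrite natr1; case: n {IH} => [|n]; first by rewrite ln0 ?ln_nat_ge0.
by rewrite ler_ln ?posrE ?ler_nat.
Qed.

Lemma ln_fact_lb (n : nat) : n%:R * ln n%:R - n%:R <= ln n`!%:R :> R.
Proof.
elim: n => [|[|n] IH]; first by rewrite fact0 ln1 mul0r subr0.
  by rewrite ln1 mulr0 sub0r; lra.
rewrite (factS n.+1) natrM lnM ?posrE ?ltr0n ?fact_gt0//.
have h : n.+1%:R * (ln n.+2%:R - ln n.+1%:R) <= 1 :> R.
  by rewrite -ler_pdivlMl// mulr1 lnS_sub_le.
have -> : n.+2%:R = n.+1%:R + 1 :> R by rewrite natr1.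
have E : n.+1%:R + 1 = n.+2%:R :> R by rewrite natr1.
move: IH h; rewrite E; move: (ln (n.+1`!%:R : R)) (ln (n.+2%:R : R)) (ln (n.+1%:R : R)) => a b c.
by rewrite -E; move: (n.+1%:R : R) => k; lra.
Qed.

Lemma ln_fact_primes (n : nat) :
  ln n`!%:R = \sum_(0 <= q < n.+1 | prime q) (logn q n`!)%:R * ln q%:R :> R.
Proof.
have f0 := fact_gt0 n.
have E : n`! = (\prod_(0 <= q < n.+1 | prime q) q ^ logn q n`!)%N.
  rewrite -{1}(partnT f0) /partn.
  rewrite (@big_cat_nat _ _ _ n.+1)//=; last by rewrite ltnS fact_geq.
  rewrite [X in (_ * X)%N]big_nat_cond [X in (_ * X)%N]big1 ?muln1.
    rewrite [RHS]big_mkcond; apply: eq_bigr => q _; case: ifP => // pq.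
    by rewrite lognE pq.
  move=> q /andP[/andP[nq _] _]; case: (boolP (prime q)) => pq; last by rewrite lognE (negPf pq).
  have -> : logn q n`! = 0%N; last by [].
  apply/eqP; rewrite -leqn0 leqNgt logn_gt0 mem_primes pq f0 /=.
  by apply/negP => /(prime_dvd_fact pq); rewrite leqNgt nq.
rewrite {1}E natr_prod ln_prod; last by move=> q pq; rewrite ltr0n expn_gt0 prime_gt0.
by apply: eq_bigr => q pq; rewrite natrX lnXn ?ltr0n ?prime_gt0// mulr_natl.
Qed.

(** Odd primes are -1 mod 2, so Chebyshev's bound is the case p = 2 of [theta_class_le], together
    with the term ln 2. *)
Lemma theta_le (n : nat) : (0 < n)%N ->
  \sum_(0 <= q < n.+1 | prime q) ln q%:R <= 7 * n%:R :> R.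
Proof.
move=> n0.
have h := @theta_class_le R 2 isT n.
have l2 := @ln2_le1 R; have l2' := @ln2_ge_half R.
have nR : 1 <= n%:R :> R by rewrite ler1n.
rewrite (bigID (fun q => 2 %| q.+1)%N) /= -/(theta_class n).
have h2 : \sum_(0 <= q < n.+1 | prime q && ~~ (2 %| q.+1)%N) ln q%:R <= ln 2 :> R.
  rewrite (eq_bigl (fun q => q == 2)%N); last first.
    move=> q /=; apply/andP/eqP => [[pq]|->//].
    rewrite dvdn2 /= negbK => oq; apply/eqP; have := even_prime pq.
    by case=> [->//|]; rewrite (negPf oq).
  by rewrite big_nat1_eq; case: ifP => _//; lra.
have h3 : 12 * n%:R * ln 2 / 2 <= 6 * n%:R :> R by nra.
have h4 : theta_class 2 n <= 6 * n%:R :> R by apply: le_trans h3.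
by apply: (le_trans (lerD h4 h2)); lra.
Qed.

(** Both bounds compare n ln n with ln n!, the sum of [logn q n!] ln q: the exponent is at least n /
    q - 1, and at most n / (q - 1) <= n / q + 2 n / q^2. *)
Lemma mertens_first (n : nat) : (0 < n)%N ->
  `|\sum_(0 <= q < n.+1 | prime q) ln q%:R / q%:R - ln n%:R| <= 7 :> R.
Proof.
move=> n0; have nR : 0 < n%:R :> R by rewrite ltr0n.
set S := \sum_(0 <= q < _ | _) _.
have H1 : n%:R * S - 7 * n%:R <= n%:R * ln n%:R.
  apply: le_trans (ln_fact_ub n); rewrite ln_fact_primes.
  apply: (@le_trans _ _ (n%:R * S - \sum_(0 <= q < n.+1 | prime q) ln q%:R)).
    by rewrite lerD2l lerN2 theta_le.
  rewrite /S mulr_sumr -sumrB; apply: ler_sum => q pq.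
  have q0 := prime_gt0 pq; have qR : 0 < q%:R :> R by rewrite ltr0n.
  have -> : n%:R * (ln q%:R / q%:R) - ln q%:R = (n%:R / q%:R - 1) * ln q%:R :> R by ring.
  rewrite ler_wpM2r ?ln_nat_ge0//.
  apply: (@le_trans _ _ (n %/ q)%:R); last by rewrite ler_nat logn_fact_lb.
  rewrite lerBlDr natr1 ler_pdivrMr// -natrM ler_nat ltnW// ltn_ceil//.
have H2 : n%:R * ln n%:R - n%:R <= n%:R * S + 4 * n%:R.
  apply: (le_trans (ln_fact_lb n)); rewrite ln_fact_primes.
  have T : \sum_(0 <= q < n.+1 | prime q) ln q%:R / q%:R ^+ 2 <= 2 :> R.
    have := sum_ln_inv_sqr_tail n (ltn0Sn 0); rewrite ln1 add0r divr1.
    apply: le_trans; case: (ltnP n 2) => n2.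
      rewrite big_nat_cond big1; last by move=> q /andP[/andP[_ qn] /prime_gt1]; lia.
      by apply: sumr_ge0 => q _; rewrite divr_ge0 ?ln_nat_ge0 ?exprn_ge0.
    rewrite (@big_cat_nat _ _ _ 2)//=.
    rewrite big_nat_cond big1 ?add0r => [|q /andP[/andP[_ q2] /prime_gt1]]; last by lia.
    rewrite big_mkcond; apply: ler_sum => q _; case: ifP => // _.
    by rewrite divr_ge0 ?ln_nat_ge0 ?exprn_ge0.
  apply: (@le_trans _ _ (n%:R * S + 2 * n%:R * \sum_(0 <= q < n.+1 | prime q) ln q%:R / q%:R ^+ 2)); last first.
    by rewrite lerD2l; have := ler_wpM2l (mulr_ge0 (ler0n R 2) (ltW nR)) T; lra.
  rewrite /S !mulr_sumr -big_split /=; apply: ler_sum => q pq.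
  have q0 := prime_gt0 pq; have qR : 0 < q%:R :> R by rewrite ltr0n.
  have q2 : 2 <= q%:R :> R by rewrite ler_nat prime_gt1.
  have -> : n%:R * (ln q%:R / q%:R) + 2 * n%:R * (ln q%:R / q%:R ^+ 2) =
    (n%:R * (q%:R + 2) / q%:R ^+ 2) * ln q%:R :> R by field; rewrite gt_eqF.
  rewrite ler_wpM2r ?ln_nat_ge0// ler_pdivlMr ?exprn_gt0//.
  have : q.-1%:R * (logn q n`!)%:R <= n%:R :> R by rewrite -natrM ler_nat logn_fact_ub.
  have -> : q.-1%:R = q%:R - 1 :> R by rewrite -subn1 natrB.
  have : 0 <= (logn q n`!)%:R :> R by [].
  by move: ((logn q n`!)%:R : R) (q%:R : R) (n%:R : R) q2 => v k N k2 v0 h; nra.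
rewrite ler_norml; apply/andP; split.
  rewrite lerBrDr -(ler_pM2l nR) mulrDr; lra.
by rewrite lerBlDr -(ler_pM2l nR) mulrDr; lra.
Qed.

End MertensFirst.

(** * Dyadic blocks of primes and partial summation *)

Section MertensBlocks.
Context {R : realType}.

Definition prime_wt (q : nat) : R := ln (1 + (q%:R)^-1).

(** On the primes in (2^(m-1), 2^m] ln q is m ln 2 up to ln 2, so summation by parts can run over m.
    For m = 0 the predecessor convention makes the block empty. *)
Definition blk (F : nat -> R) (m : nat) : R :=
  \sum_((2 ^ m.-1).+1 <= q < (2 ^ m).+1 | prime q) F q.

Lemma sum_blk F (M N : nat) : (M <= N)%N ->
  \sum_(M.+1 <= m < N.+1) blk F m = \sum_((2 ^ M).+1 <= q < (2 ^ N).+1 | prime q) F q.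
Proof.
move=> /subnK <-; elim: (N - M)%N => [|k IH]; first by rewrite !big_geq.
rewrite addSn big_nat_recr ?ltnS ?leq_addl//= IH /blk /=.
by rewrite -big_cat_nat//= ltnS leq_exp2l// ?leq_addl.
Qed.

Lemma sum_blk1 F (N : nat) :
  \sum_(1 <= m < N.+1) blk F m = \sum_(0 <= q < (2 ^ N).+1 | prime q) F q.
Proof.
rewrite sum_blk// [RHS](@big_cat_nat _ _ _ 2)//= ?ltnS ?expn_gt0//.
rewrite [X in _ = X + _]big_nat_cond [X in _ = X + _]big1 ?add0r//.
by move=> q /andP[/andP[_ q2] /prime_gt1]; lia.
Qed.

Lemma prime_wt_ub (q : nat) : (0 < q)%N -> prime_wt q <= (q%:R)^-1.
Proof.
move=> q0; have qi : 0 < (q%:R)^-1 :> R by rewrite invr_gt0 ltr0n.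
by apply: (le_trans (le_ln1Dx _)); lra.
Qed.

Lemma prime_wt_gt0 (q : nat) : (0 < q)%N -> 0 < prime_wt q.
Proof. by move=> q0; rewrite ln_gt0// ltrDl invr_gt0 ltr0n. Qed.

Lemma prime_wt_lb (q : nat) : (0 < q)%N -> (q%:R)^-1 - (q%:R) ^- 2 <= prime_wt q.
Proof.
move=> q0; have qi : 0 < (q%:R)^-1 :> R by rewrite invr_gt0 ltr0n.
have h : 0 < 1 + (q%:R)^-1 :> R by lra.
apply: le_trans _ (ln_ge_1subV h); rewrite -exprVn.
move: qi h; move: (q%:R)^-1 => x x0 h.
have -> : 1 - (1 + x)^-1 = x / (1 + x) by field; rewrite gt_eqF.
by rewrite ler_pdivlMr//; nra.
Qed.

(* mertens_first controls the partial sums of beta, hence, by partial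
   summation, those of beta m / (m ln 2), which approximates alpha m. *)
Local Notation beta := (blk (fun q => ln q%:R / q%:R)).
Local Notation alpha := (blk prime_wt).

Lemma blk_ln (m q : nat) : ((2 ^ m).+1 <= q < (2 ^ m.+1).+1)%N ->
  (m%:R : R) * ln 2 <= ln (q%:R : R) <= m.+1%:R * ln 2.
Proof.
move=> /andP[mq qm]; have q0 : (0 < q)%N by lia.
have E k : k%:R * ln 2 = ln (2 ^ k)%:R :> R by rewrite natrX lnXn// mulr_natl.
by rewrite !E !ler_ln ?posrE ?ltr0n ?expn_gt0// !ler_nat ltnW.
Qed.

Lemma beta_ge0 m : 0 <= beta m.
Proof. by apply: sumr_ge0 => q _; rewrite divr_ge0// ln_nat_ge0. Qed.

Lemma sum_beta (N : nat) : `|\sum_(1 <= m < N.+1) beta m - N%:R * ln 2| <= 7.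
Proof.
have := @mertens_first R (2 ^ N); rewrite expn_gt0 => /(_ isT).
by rewrite sum_blk1 natrX lnXn// -[ln 2 *+ N]mulr_natl.
Qed.

Lemma beta_le m : (0 < m)%N -> beta m <= 15.
Proof.
case: m => // m _; have := sum_beta m.+1; have := sum_beta m.
rewrite (big_nat_recr m.+1)//= !ler_norml -(natr1 m) => /andP[h1 h2] /andP[h3 h4].
have := @ln2_le1 R; move: h1 h2 h3 h4.
by move: (\sum_(1 <= m0 < m.+1) _) (beta m.+1) (ln 2) => a b c; lra.
Qed.

Lemma alpha_beta (m : nat) : (1 < m)%N ->
  `|alpha m - beta m / (m%:R * ln 2)| <=
  30 * ((m.-1%:R)^-1 - (m%:R)^-1) + blk (fun q => (q%:R) ^- 2) m.
Proof.
case: m => // -[//|m] _ /=; set k := m.+1.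
have l2 := @ln2_ge_half R; have l0 : 0 < ln 2 :> R by lra.
have kR : 0 < k%:R :> R by []. have kR1 : 0 < k.+1%:R :> R by [].
have b0 := beta_ge0 k.+1.
have -> : k%:R^-1 - k.+1%:R^-1 = (k%:R * k.+1%:R)^-1 :> R.
  move: kR kR1; have -> : k.+1%:R = k%:R + 1 :> R by rewrite natr1.
  by move: (k%:R : R) => x x0 x1; field; rewrite ?gt_eqF.
have E : beta k.+1 / (k.+1%:R * ln 2) =
   \sum_((2 ^ k).+1 <= q < (2 ^ k.+1).+1 | prime q) (ln q%:R / q%:R) / (k.+1%:R * ln 2).
  by rewrite /blk mulr_suml.
have g0 : 0 <= blk (fun q => (q%:R) ^- 2) k.+1.
  by apply: sumr_ge0 => q _; rewrite invr_ge0 exprn_ge0.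
rewrite ler_norml; apply/andP; split.
  apply: (@le_trans _ _ (- blk (fun q => (q%:R) ^- 2) k.+1)).
    by rewrite lerN2 lerDr mulr_ge0// invr_ge0 mulr_ge0.
  rewrite E /blk -sumrB -sumrN big_nat_cond [leRHS]big_nat_cond.
  apply: ler_sum => q /andP[qk pq]; have /andP[h1 h2] := blk_ln qk.
  have q0 := prime_gt0 pq.
  have hX : ln q%:R / q%:R / (k.+1%:R * ln 2) <= (q%:R)^-1 :> R.
    by rewrite ler_pdivrMr ?mulr_gt0// [leLHS]mulrC ler_wpM2l ?invr_ge0.
  by apply: le_trans _ (lerB (prime_wt_lb q0) hX); rewrite addrAC subrr add0r.
apply: (@le_trans _ _ (beta k.+1 / (k%:R * ln 2) / k.+1%:R)).
  rewrite E /blk 2!mulr_suml -sumrB big_nat_cond [leRHS]big_nat_cond.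
  apply: ler_sum => q /andP[qk pq]; have /andP[h1 h2] := blk_ln qk.
  have q0 := prime_gt0 pq; have qR : 0 < q%:R :> R by rewrite ltr0n.
  have := prime_wt_ub q0; set a := prime_wt q => ha.
  rewrite lerBlDr (le_trans ha)//.
  have -> : ln q%:R / q%:R / (k%:R * ln 2) / k.+1%:R + ln q%:R / q%:R / (k.+1%:R * ln 2)
    = q%:R^-1 * (ln q%:R * (1 + k%:R) / (k%:R * ln 2 * k.+1%:R)) :> R.
    by field; rewrite !gt_eqF.
  rewrite ler_peMr ?invr_ge0// addrC natr1 ler_pdivlMr ?mulr_gt0// mul1r.
  by rewrite ler_pM2r.
apply: ler_wpDr => //.
rewrite -mulrA -invfM mulrAC ler_pdivrMr ?mulr_gt0//.
have -> : 30 / (k%:R * k.+1%:R) * (k%:R * k.+1%:R * ln 2) = 30 * ln 2 :> R.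
  by field; rewrite !gt_eqF.
have := @beta_le k.+1 isT; lra.
Qed.

(** [alpha m] - 1/m is the error of [alpha_beta] plus ([beta m] - ln 2) / (m ln 2). The second part
    is handled by Dirichlet's test, since the partial sums of [beta] - ln 2 are bounded. *)
Lemma alpha_harmonic_tail (M N : nat) : (0 < M <= N)%N ->
  `|\sum_(M.+1 <= m < N.+1) (alpha m - (m%:R)^-1)| <= 64 / M%:R.
Proof.
move=> /andP[M0 MN]; have MR : 0 < M%:R :> R by rewrite ltr0n.
have l2 := @ln2_ge_half R; have l2' := @ln2_le1 R; have l0 : 0 < ln 2 :> R by lra.
have -> : \sum_(M.+1 <= m < N.+1) (alpha m - (m%:R)^-1) =
   \sum_(M.+1 <= m < N.+1) (alpha m - beta m / (m%:R * ln 2)) +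
   (\sum_(M.+1 <= m < N.+1) (beta m - ln 2) * (m%:R)^-1) / ln 2.
  rewrite mulr_suml -big_split /=; apply: eq_big_nat => m /andP[mM _].
  have m0 : m%:R != 0 :> R by rewrite pnatr_eq0; lia.
  by field; rewrite m0 gt_eqF.
have h1 : `|\sum_(M.+1 <= m < N.+1) (alpha m - beta m / (m%:R * ln 2))| <= 31 / M%:R.
  rewrite (le_trans (ler_norm_sum _ _ _))//.
  apply: (@le_trans _ _ (\sum_(M.+1 <= m < N.+1)
    (30 * ((m.-1%:R)^-1 - (m%:R)^-1) + blk (fun q => (q%:R) ^- 2) m))).
    by rewrite !big_nat; apply: ler_sum => m /andP[mM _]; apply: alpha_beta; lia.
  rewrite big_split /= sum_blk// -mulr_sumr big_add1 /= telescope_sumr_nat//.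
  have g : \sum_((2 ^ M).+1 <= q < (2 ^ N).+1 | prime q) (q%:R : R) ^- 2 <= M%:R^-1.
    apply: (@le_trans _ _ (\sum_((2 ^ M).+1 <= q < (2 ^ N).+1) (q%:R : R) ^- 2)).
      by rewrite big_mkcond; apply: ler_sum => q _; case: ifP; rewrite ?invr_ge0 ?exprn_ge0.
    have := @powRN2_tail R (2 ^ M) (2 ^ N); rewrite expn_gt0 => /(_ isT)/le_trans; apply.
    by rewrite lef_pV2 ?posrE ?ltr0n ?expn_gt0// ler_nat ltnW// ltn_expl.
  have : 0 <= N%:R^-1 :> R by rewrite invr_ge0.
  by lra.
have h2 : `|\sum_(M.+1 <= m < N.+1) (beta m - ln 2) * (m%:R)^-1| <= 16 / M%:R.
  pose chi m : R[i]%C := ((beta m - ln 2)%:C)%C.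
  (* The index 0 contributes - ln 2, which raises the bound 7 of [sum_beta] to 8. *)
  have H K : normc (\sum_(0 <= i < K) chi i) <= 8.
    have -> : \sum_(0 <= i < K) chi i = ((\sum_(0 <= i < K) (beta i - ln 2))%:C)%C.
      by rewrite rmorph_sum.
    rewrite normc_real sumrB sumr_const_nat subn0 -[ln 2 *+ K]mulr_natl.
    case: K => [|K]; first by rewrite big_geq// mul0r subr0 normr0.
    rewrite big_ltn// [beta 0]big_geq// add0r -natr1.
    have := sum_beta K; rewrite !ler_norml => /andP[a1 a2]; apply/andP; split; lra.
  have := @chi_weighted_sum R chi 8 H (fun m => (m%:R)^-1) M.+1 N.+1.
  have -> : \sum_(M.+1 <= i < N.+1) chi i * ((i%:R)^-1)%:C%C =
      ((\sum_(M.+1 <= m < N.+1) (beta m - ln 2) * (m%:R)^-1)%:C)%C.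
    by rewrite rmorph_sum /=; apply: eq_bigr => i _; rewrite rmorphM.
  rewrite normc_real => /(_ _ _)/le_trans; apply.
  - by move=> i _; rewrite invr_ge0.
  - by move=> i Mi; rewrite lef_pV2 ?posrE ?ltr0n// ?ler_nat//; lia.
  - rewrite (_ : 2 * 8 = 16 :> R); last by ring.
    by rewrite ler_pM2l// lef_pV2 ?posrE// ler_nat.
rewrite (le_trans (ler_normD _ _))//.
have -> : 64 / M%:R = 31 / M%:R + 33 / M%:R :> R by ring.
have nl : `|(ln 2)^-1| = (ln 2)^-1 :> R by rewrite ger0_norm// invr_ge0 ltW.
rewrite lerD// normrM nl ler_pdivrMr//.
apply: (le_trans h2); have : 0 < M%:R^-1 :> R by rewrite invr_gt0.
by move: (M%:R^-1 : R) => x x0; nra.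
Qed.

Lemma alpha_harmonic_cvg :
  cvgn (fun M => \sum_(1 <= m < M.+1) (alpha m - (m%:R)^-1)).
Proof.
apply: (@real_cauchy_tail R _ (fun M => 64 / M%:R) 1).
  rewrite -[X in _ --> X](mulr0 64); apply: cvgMr.
  by rewrite -cvg_shiftS; exact: cvg_harmonic.
move=> M N /andP[M0 MN]; rewrite (@big_cat_nat _ _ _ M.+1 1 N.+1)//=.
by rewrite addrAC subrr add0r alpha_harmonic_tail// M0.
Qed.

End MertensBlocks.

(** * Abel's theorem and the logarithmic series *)

Section AbelAndLogSeries.
Context {R : realType}.

(** Stated for partial sums, uniformly in M and r, so that M can be taken large for a given r before
    r tends to 1. K collects the first M0 deviations, each weighted by at most 1 - r. *)
Lemma abel_theorem (c : nat -> R) (d eta : R) : 0 < eta ->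
  (fun M => \sum_(1 <= m < M.+1) c m) @ \oo --> d ->
  exists K M0, 0 <= K /\ forall M r, (M0 <= M)%N -> 0 <= r <= 1 ->
  `|\sum_(1 <= m < M.+1) c m * r ^+ m - d| <= (1 - r) * K + eta.
Proof.
move=> eta0 /cvgrPdist_le/(_ _ eta0)[M0 _ H].
pose Cs i := \sum_(1 <= m < i.+1) c m.
pose k i := if (i < M0)%N then `|Cs i - d| else 0.
have k0 i : 0 <= k i by rewrite /k; case: ifP.
exists (\sum_(1 <= i < M0) k i + `|d|), M0; split.
  by rewrite addr_ge0 ?sumr_ge0.
move=> M r M0M /andP[r0 r1].
have st i : 0 <= r ^+ i - r ^+ i.+1 by rewrite subr_ge0 ler_wiXn2l.
have Ck i : `|Cs i - d| <= k i + eta.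
  rewrite /k; case: (ltnP i M0) => iM; first by rewrite lerDl ltW.
  by rewrite add0r distrC; apply: H.
rewrite abel_summation//.
have tel : \sum_(1 <= i < M.+1) (r ^+ i - r ^+ i.+1) = r - r ^+ M.+1.
  by rewrite telescope_sumr_nat.
have -> : \sum_(1 <= i < M.+1) (\sum_(1 <= j < i.+1) c j) * (r ^+ i - r ^+ i.+1)
    + (\sum_(1 <= j < M.+1) c j) * r ^+ M.+1 - d =
   \sum_(1 <= i < M.+1) (Cs i - d) * (r ^+ i - r ^+ i.+1) + (Cs M - d) * r ^+ M.+1 - d * (1 - r).
  have -> : \sum_(1 <= i < M.+1) (Cs i - d) * (r ^+ i - r ^+ i.+1) =
     \sum_(1 <= i < M.+1) Cs i * (r ^+ i - r ^+ i.+1) - d * (r - r ^+ M.+1).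
    by rewrite -tel mulr_sumr -sumrB; apply: eq_bigr => i _; rewrite mulrBl.
  by rewrite -/(Cs M) /Cs; ring.
have h1 : `|\sum_(1 <= i < M.+1) (Cs i - d) * (r ^+ i - r ^+ i.+1)| <=
    (1 - r) * \sum_(1 <= i < M0) k i + eta * (r - r ^+ M.+1).
  rewrite (le_trans (ler_norm_sum _ _ _))// -tel !mulr_sumr.
  have -> : \sum_(1 <= i < M0) (1 - r) * k i = \sum_(1 <= i < M.+1) (1 - r) * k i.
    case: M0 M0M @k k0 {H Ck} => [|N0] NM k k0.
      by rewrite big_geq// big1// => i _; rewrite /k ltn0 mulr0.
    rewrite [RHS](@big_cat_nat _ _ _ N0.+1)//=; last exact: leqW.
    rewrite [X in _ = _ + X]big_nat_cond [X in _ = _ + X]big1 ?addr0// => i /andP[/andP[iN _] _].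
    by rewrite /k ltnNge iN mulr0.
  rewrite -big_split /= !big_nat; apply: ler_sum => i /andP[i1 _].
  rewrite normrM [`|r ^+ i - _|]ger0_norm//.
  apply: (le_trans (ler_wpM2r (st i) (Ck i))); rewrite mulrDl lerD2r mulrC.
  rewrite ler_wpM2r// exprS -{1}[r ^+ i]mul1r -mulrBl ler_piMr ?subr_ge0//.
  exact: exprn_ile1.
have h2 : `|(Cs M - d) * r ^+ M.+1| <= eta * r ^+ M.+1.
  rewrite normrM [`|r ^+ _|]ger0_norm ?exprn_ge0// ler_wpM2r ?exprn_ge0//.
  by have := Ck M; rewrite /k ltnNge M0M add0r.
have h3 : `|d * (1 - r)| = `|d| * (1 - r) by rewrite normrM [`|1 - r|]ger0_norm ?subr_ge0.
rewrite (le_trans (ler_normB _ _))// h3 (le_trans (lerD (ler_normD _ _) (lexx _)))//.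
have : eta * r <= eta by rewrite ler_piMr// ltW.
by move: h1 h2; lra.
Qed.

(** The remainder vanishes at 0 and has derivative x^M / (1 - x); the mean value theorem does the
    rest. *)
Lemma log_series_bounds (r : R) (M : nat) : 0 < r < 1 ->
  0 <= - ln (1 - r) - \sum_(1 <= m < M.+1) r ^+ m / m%:R <= r ^+ M / (1 - r).
Proof.
move=> /andP[r0 r1].
pose g (x : R) := - ln (1 - x) - \sum_(1 <= m < M.+1) x ^+ m / m%:R.
have d1 (x : R) : x < 1 -> is_derive x (1 : R) (fun x : R => ln (1 - x)) (- (1 - x)^-1).
  move=> x1; have x10 : 0 < 1 - x by rewrite subr_gt0.
  have h := is_derive1_ln x10.
  have h' : is_derive x (1 : R) (fun y : R => 1 - y) (-1).
    rewrite (_ : (fun y : R => 1 - y) = cst 1 - id)//.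
    by apply: is_derive_eq; rewrite sub0r.
  have := @is_derive1_comp _ (@ln R) (fun y : R => 1 - y) x _ _ h h'.
  by rewrite mulrN1.
have d2 (x : R) : is_derive x (1 : R) (fun x : R => \sum_(1 <= m < M.+1) x ^+ m / m%:R) (\sum_(0 <= m < M) x ^+ m).
  elim: (M) => [|k IH].
    rewrite (_ : (fun _ => _) = cst 0); last by apply/funext => y; rewrite big_geq.
    by rewrite big_geq//; exact: is_derive_cst.

  have hX : is_derive x (1 : R) (fun x : R => x ^+ k.+1) (k.+1%:R *: x ^+ k *: (1 : R)).
    rewrite (_ : (fun x : R => x ^+ k.+1) = id ^+ k.+1); last by apply/funext => y; rewrite fctE.
    exact: is_deriveX.
  have hZ : is_derive x (1 : R) (k.+1%:R^-1 *: (fun x : R => x ^+ k.+1)) (x ^+ k).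
    apply: is_derive_eq; rewrite /GRing.scale /= mulr1 mulrA mulVf// mul1r.
    by [].
  have hD := is_deriveD IH hZ.
  have E : \sum_(0 <= m < k.+1) x ^+ m = \sum_(0 <= m < k) x ^+ m + x ^+ k.
    by rewrite big_nat_recr.
  rewrite E; move: hD; congr (is_derive _ _ _ _).
  by apply/funext => y; rewrite [RHS]big_nat_recr//= mulrC.
have dg (x : R) : x < 1 -> is_derive x (1 : R) g (x ^+ M / (1 - x)).
  move=> x1; have x10 : 1 - x != 0 by rewrite gt_eqF// subr_gt0.
  apply: is_derive_eq; first exact: (is_deriveB (is_deriveN (d1 x x1)) (d2 x)).
  rewrite big_mkord; apply: (mulIf x10); rewrite divfK// mulrBl opprK mulVf//.
  have -> : (\sum_(i < M) x ^+ i) * (1 - x) = 1 - x ^+ M.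
    by rewrite mulrC -opprB mulNr -subrX1 opprB.
  by rewrite opprB addrC subrK.
have g0 : g 0 = 0.
  rewrite /g subr0 ln1 oppr0 sub0r big_nat big1 ?oppr0// => m /andP[m0 _].
  by rewrite expr0n gtn_eqF// mul0r.
have [||c] := @MVT R g (fun x => x ^+ M / (1 - x)) 0 r r0.
- by move=> x; rewrite in_itv /= => /andP[_ xr]; apply: dg; exact: lt_trans xr r1.
- apply: derivable_within_continuous => x; rewrite in_itv /= => /andP[_ xr].
  by apply: ex_derive; apply: dg; exact: le_lt_trans xr r1.
rewrite in_itv /= => /andP[c0 cr]; rewrite g0 !subr0 -/(g r) => ->.
have c1 : 0 < 1 - c by lra.
have r10 : 0 < 1 - r by lra.
apply/andP; split; first by rewrite mulr_ge0 ?divr_ge0 ?exprn_ge0 ?ltW.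
apply: (@le_trans _ _ (r ^+ M / (1 - r) * 1)); last by rewrite mulr1.
apply: ler_pM; [by rewrite divr_ge0 ?exprn_ge0// ltW|exact: ltW| |exact: ltW].
apply: ler_pM; [by rewrite exprn_ge0// ltW|by rewrite invr_ge0 ltW| |].
  by rewrite lerXn2r ?nnegrE// ltW.
by rewrite lef_pV2 ?posrE//; lra.
Qed.

Lemma log_series_near (r eta : R) : 0 < r < 1 -> 0 < eta ->
  \forall M \near \oo, `|\sum_(1 <= m < M.+1) (m%:R)^-1 * r ^+ m + ln (1 - r)| <= eta.
Proof.
move=> r01 eta0; have /andP[r0 r1] := r01.
have r10 : 0 < 1 - r by lra.
have : (fun M => r ^+ M) @ \oo --> (0 : R) by apply: cvg_expr; rewrite ger0_norm// ltW.
move=> /cvgrPdist_le/(_ (eta * (1 - r)) (mulr_gt0 eta0 r10)) H.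
near=> M; have h : `|0 - r ^+ M| <= eta * (1 - r) by near: M.
have /andP[a1 a2] := log_series_bounds M r01.
have E : \sum_(1 <= m < M.+1) (m%:R)^-1 * r ^+ m = \sum_(1 <= m < M.+1) r ^+ m / m%:R.
  by apply: eq_bigr => m _; rewrite mulrC.
have h' : r ^+ M / (1 - r) <= eta.
  rewrite ler_pdivrMr// (le_trans _ h)// sub0r normrN; exact: ler_norm.
by rewrite E ler_norml; apply/andP; split; lra.
Unshelve. all: by end_near. Qed.

End AbelAndLogSeries.

(** * Zeta near 1 and the weighted prime sum *)

Section MertensConstant.
Context {R : realType}.

Definition zpart (e : R) (N : nat) : R := \sum_(1 <= n < N.+1) (n%:R : R) `^ (- (1 + e)).

Lemma zpart_cvg e : 0 < e -> cvgn (zpart e).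
Proof.
move=> e0; apply: (@real_cauchy_tail R _ (fun M => (M%:R : R) `^ (- e) / e) 1).
  exact: powRN_div_cvg0.
move=> M N /andP[M0 MN]; rewrite /zpart (@big_cat_nat _ _ _ M.+1 1 N.+1)//=.
rewrite addrAC subrr add0r ger0_norm; last by apply: sumr_ge0 => i _; exact: powR_ge0.
exact: powRN_tail.
Qed.

(** This is zeta (1 + e); in particular [zeta1 1] is zeta (2). *)
Definition zeta1 (e : R) : R := limn (zpart e).

Lemma zeta1_cvg e : 0 < e -> zpart e @ \oo --> zeta1 e.
Proof. exact: zpart_cvg. Qed.

Lemma zeta1_le e : 0 < e -> zeta1 e <= 1 + e^-1.
Proof.
move=> e0; apply: limr_le; first exact: zpart_cvg.
by near=> N; exact: powRN_partial_sum_le.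
Unshelve. all: by end_near. Qed.

Lemma zeta1_ge e : 0 < e -> e^-1 <= zeta1 e.
Proof.
move=> e0; have h : (fun N => zpart e N + (N.+1%:R : R) `^ (- e) / e) @ \oo --> zeta1 e + 0.
  apply: cvgD; first exact: zeta1_cvg.
  by rewrite (cvg_shiftS (fun N => (N%:R : R) `^ (- e) / e)); exact: powRN_div_cvg0.
rewrite addr0 in h; rewrite -(cvg_lim _ h)//; apply: limr_ge; first by apply/cvg_ex; exists (zeta1 e).
near=> N; have := powRN_partial_sum_ge N e0.
by rewrite mulrBl mul1r /zpart; lra.
Unshelve. all: by end_near. Qed.

Lemma zeta1_ge1 e : 0 < e -> 1 <= zeta1 e.
Proof.
move=> e0; apply: limr_ge; first exact: zpart_cvg.
near=> N; have N1 : (0 < N)%N by near: N; exists 1%N.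
rewrite /zpart big_ltn// powR1 lerDl; apply: sumr_ge0 => i _; exact: powR_ge0.
Unshelve. all: by end_near. Qed.

Lemma zeta1_1 : zeta1 1 = pi ^+ 2 / 6.
Proof.
rewrite /zeta1 -(cvg_lim _ (@basel R))//; congr (lim (_ @ \oo)).
apply/funext => N; rewrite /zpart; apply: eq_bigr => n _.
rewrite (_ : 1 + 1 = 2%:R :> R)// powR_invn//.
Qed.

Lemma zeta1_near1 e : 0 < e -> e <= 1 ->
  0 <= ln (zeta1 1) - ln (zeta1 (1 + 2 * e)) <= 4 * e.
Proof.
move=> e0 e1; have e2 : 0 < 1 + 2 * e by lra.
have z0 := zeta1_ge1 e2; have z1 := @zeta1_ge1 1 ltr01.
have le : zeta1 (1 + 2 * e) <= zeta1 1.
  apply: ler_lim; [exact: zpart_cvg|exact: zpart_cvg|near=> N].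
  rewrite /zpart !big_nat; apply: ler_sum => n /andP[n0 _].
  by apply: powRN_le => //; lra.
have ge : zeta1 1 - 4 * e <= zeta1 (1 + 2 * e).
  rewrite lerBlDr; have h : (fun N => zpart (1 + 2 * e) N + 4 * e) @ \oo --> zeta1 (1 + 2 * e) + 4 * e.
    by apply: cvgD; [exact: zeta1_cvg|exact: cvg_cst].
  rewrite -(cvg_lim _ h)//; apply: ler_lim; [exact: zpart_cvg|by apply/cvg_ex; exists (zeta1 (1 + 2 * e) + 4 * e)|near=> N].
  have N1 : (0 < N)%N by near: N; exists 1%N.
  rewrite -lerBlDl /zpart -sumrB big_ltn// !powR1 subrr add0r.
  apply: (@le_trans _ _ (\sum_(2 <= n < N.+1) 2 * e * (ln n%:R / n%:R ^+ 2))); last first.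
    rewrite -mulr_sumr; have := @sum_ln_inv_sqr_tail R 1 N isT; rewrite ln1 add0r divr1 => h2.
    have -> : 4 * e = 2 * e * 2 by ring.
    by rewrite ler_pM2l//; lra.
  rewrite !big_nat; apply: ler_sum => n /andP[n2 _].
  have n0 : (0 < n)%N by lia.
  have nR : 0 < n%:R :> R by rewrite ltr0n.
  rewrite (powRN1D _ n0) [X in _ - X](powRN1D _ n0) powR_inv1// !powRNE//.
  have -> : - ((1 + 2 * e) * ln n%:R) = - ln n%:R - 2 * e * ln n%:R :> R by ring.
  rewrite expRB expRN lnK ?posrE// mulrAC.
  have h3 := @expR_ge1Dx R (- (2 * e * ln n%:R)); rewrite -expRN.
  have -> : n%:R^-1 / n%:R - n%:R^-1 / n%:R * expR (- (2 * e * ln n%:R)) =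
     (1 - expR (- (2 * e * ln n%:R))) / n%:R ^+ 2 by field; rewrite gt_eqF.
  by rewrite mulrA ler_pM2r ?invr_gt0 ?exprn_gt0//; lra.
apply/andP; split; first by rewrite subr_ge0 ler_ln ?posrE//; lra.
have p0 : 0 < zeta1 1 by lra.
have p1 : 0 < zeta1 (1 + 2 * e) by lra.
rewrite -ln_div ?posrE// (le_trans (ln_le_subr1 _)) ?divr_gt0//.
by rewrite lerBlDr ler_pdivrMr//; nra.
Unshelve. all: by end_near. Qed.

Lemma zeta1_euler e : 0 < e ->
  (fun N => - \sum_(0 <= q < N.+1 | prime q) ln (1 - (q%:R : R) `^ (- (1 + e)))) @ \oo
    --> ln (zeta1 e).
Proof.
move=> e0.
pose f n : R[i]%C := ((n%:R `^ (- (1 + e)))%:C)%C.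
have z1 := zeta1_ge1 e0.
have q2 q : prime q -> (q%:R : R) `^ (- (1 + e)) <= 2^-1.
  move=> pq; rewrite (le_trans _ (invr_prime_le2 pq))// -[leRHS]powR_inv1//.
  by apply: powRN_le; [exact: prime_gt0|lra].
have key N : (1 < N)%N ->
    `|zeta1 e * \prod_(0 <= q < N.+1 | prime q) (1 - (q%:R : R) `^ (- (1 + e))) - 1| <=
    (N%:R : R) `^ (- e) / e.
  move=> N1.
  have := @euler_product_bound R f _ _ ((zeta1 e)%:C)%C N ((N%:R : R) `^ (- e) / e) N1.
  have -> : (zeta1 e)%:C%C * \prod_(0 <= q < N.+1 | prime q) (1 - f q) - 1 =
    ((zeta1 e * \prod_(0 <= q < N.+1 | prime q) (1 - (q%:R : R) `^ (- (1 + e))) - 1)%:C)%C.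
    rewrite rmorphB rmorphM rmorph_prod /=; congr (_ * _ - _).
    by apply: eq_bigr => q _; rewrite rmorphB.
  rewrite normc_real; apply.
  - by rewrite /f powR1.
  - by move=> a b; rewrite /f natrM powRM// rmorphM.
  - apply: (@ccvg_ext _ (fun X => ((zpart e X)%:C)%C)); last exact: ccvg_real (zeta1_cvg e0).
    by move=> X; rewrite /zpart rmorph_sum.
  - move=> X NX; apply: le_trans (powRN_tail e0 (ltnW N1) NX).
    by apply: ler_sum => n _; rewrite /f normc_real ger0_norm// powR_ge0.
apply/cvgrPdist_le => eta eta0.
pose b := Num.min 2^-1 (eta / 2).
have b0 : 0 < b by rewrite lt_min invr_gt0 ltr0n divr_gt0.
have b1 : b <= 2^-1 by rewrite ge_min lexx.
have b2 : 2 * b <= eta.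
  have : b <= eta / 2 by rewrite ge_min lexx orbT.
  by lra.
have /cvgrPdist_le/(_ b b0) H := powRN_div_cvg0 e0.
near=> N; have N1 : (1 < N)%N by near: N; exists 2%N.
have Nb : (N%:R : R) `^ (- e) / e <= b.
  have : `|0 - (N%:R : R) `^ (- e) / e| <= b by near: N.
  by rewrite sub0r normrN => /(le_trans (ler_norm _)).
have [y0 yb] := ln_abs_le (le_trans (key N N1) Nb) b1.
have P0 q : prime q -> 0 < 1 - (q%:R : R) `^ (- (1 + e)) by move=> /q2; lra.
rewrite opprK -ln_prod// -lnM ?posrE//; first by apply: le_trans b2.
- by lra.
- by rewrite big_seq_cond; apply: prodr_gt0 => q /andP[_ /P0].
Unshelve. all: by end_near. Qed.

(* As ln (1 + x) = ln (1 - x ^ 2) - ln (1 - x), this is ln zeta (1 + e) -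
   ln zeta (2 + 2 e) up to O(e). *)
Definition Tpart (e : R) (N : nat) : R :=
  \sum_(0 <= q < N.+1 | prime q) prime_wt q * (q%:R : R) `^ (- e).

(** The Euler product yields ln (1 + q^(-1-e)), while the blocks need ln (1 + 1/q) with a separate
    factor q^(-e). With X = 1/q and s = q^(-e), positivity is the concavity of ln; the difference is
    at most (1 - s) X^2, and 1 - s <= e ln q. *)
Lemma prime_wt_scaled (e : R) q : 0 < e -> prime q ->
  0 <= ln (1 + (q%:R : R) `^ (- (1 + e))) - prime_wt q * (q%:R : R) `^ (- e)
    <= e * (ln q%:R / q%:R ^+ 2).
Proof.
move=> e0 pq; have q0 := prime_gt0 pq; have qR : 0 < q%:R :> R by rewrite ltr0n.
rewrite powRN1D// /prime_wt.
have s1 : (q%:R : R) `^ (- e) <= 1 by rewrite -[leRHS](powRr0 (q%:R : R)) -[X in _ <= _ `^ X]oppr0 powRN_le// ltW.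
have s0 : 0 <= (q%:R : R) `^ (- e) by exact: powR_ge0.
have s2 : 1 - (q%:R : R) `^ (- e) <= e * ln q%:R.
  by rewrite powRNE//; have := @expR_ge1Dx R (- (e * ln q%:R)); lra.
have -> : e * (ln q%:R / q%:R ^+ 2) = (e * ln q%:R) * (q%:R^-1 * q%:R^-1).
  by field; rewrite gt_eqF.
have X0 : 0 < q%:R^-1 :> R by rewrite invr_gt0.
move: s1 s0 s2 X0; move: (_ `^ (- e)) (q%:R^-1) (e * ln q%:R) => s X w s1 s0 s2 X0.
have sX : 0 <= s * X by rewrite mulr_ge0// ltW.
have a0 : 0 < 1 + X by lra.
have a1 : 0 < 1 + s * X by lra.
have u1 : ln (1 + s * X) - ln (1 + X) <= - ((1 - s) * X / (1 + X)).
  rewrite -ln_div ?posrE//; apply: le_trans (ln_le_subr1 _) _; first exact: divr_gt0.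
  by rewrite le_eqVlt; apply/orP; left; apply/eqP; field; rewrite gt_eqF.
have u2 : - ((1 - s) * X / (1 + s * X)) <= ln (1 + s * X) - ln (1 + X).
  rewrite -ln_div ?posrE//; apply: le_trans _ (ln_ge_1subV _); last exact: divr_gt0.
  by rewrite invf_div le_eqVlt; apply/orP; left; apply/eqP; field; rewrite gt_eqF.
have u3 : ln (1 + s * X) <= s * X by apply: le_ln1Dx; lra.
have u4 : s * X / (1 + s * X) <= ln (1 + s * X).
  apply: le_trans _ (ln_ge_1subV a1).
  by rewrite le_eqVlt; apply/orP; left; apply/eqP; field; rewrite gt_eqF.
have E : ln (1 + s * X) - ln (1 + X) * s =
   s * (ln (1 + s * X) - ln (1 + X)) + (1 - s) * ln (1 + s * X) by ring.
rewrite E; apply/andP; split.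
  have := ler_wpM2l s0 u2; have t0 : 0 <= 1 - s by lra.
  have := ler_wpM2l t0 u4.
  have -> : s * - ((1 - s) * X / (1 + s * X)) = - ((1 - s) * (s * X / (1 + s * X))) by ring.
  by lra.
have t0 : 0 <= 1 - s by lra.
have v1 := ler_wpM2l s0 u1; have v2 := ler_wpM2l t0 u3.
have v3 : s * - ((1 - s) * X / (1 + X)) + (1 - s) * (s * X) = (1 - s) * s * (X * (X / (1 + X))).
  by field; rewrite gt_eqF.
have v4 : X / (1 + X) <= X by rewrite ler_pdivrMr//; nra.
have v5 : (1 - s) * s * (X * (X / (1 + X))) <= (1 - s) * 1 * (X * X).
  apply: ler_pM; [by rewrite mulr_ge0|by rewrite !mulr_ge0 ?invr_ge0// ltW| |].
    by rewrite ler_wpM2l.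
  by rewrite ler_wpM2l// ltW.
have v6 : (1 - s) * 1 * (X * X) <= w * (X * X).
  by rewrite mulr1 ler_wpM2r// mulr_ge0// ltW.
by lra.
Qed.

Lemma ln_euler_factor (e : R) q : 0 < e -> prime q ->
  ln (1 - (q%:R : R) `^ (- (1 + (1 + 2 * e)))) - ln (1 - (q%:R : R) `^ (- (1 + e))) =
  ln (1 + (q%:R : R) `^ (- (1 + e))).
Proof.
move=> e0 pq; have q0 := prime_gt0 pq.
have q2 : (q%:R : R) `^ (- (1 + e)) <= 2^-1.
  rewrite (le_trans _ (invr_prime_le2 pq))// -[leRHS]powR_inv1//.
  by apply: powRN_le => //; lra.
have E : (q%:R : R) `^ (- (1 + (1 + 2 * e))) = ((q%:R : R) `^ (- (1 + e))) ^+ 2.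
  by rewrite -powR_mulrn ?powR_ge0// -powRrM; congr (_ `^ _); ring.
rewrite E; have := powR_ge0 (q%:R : R) (- (1 + e)); move: q2.
move: (_ `^ (- (1 + e))) => x q2 x0.
have -> : 1 - x ^+ 2 = (1 - x) * (1 + x) by ring.
have h1 : 0 < 1 - x by lra.
have h2 : 0 < 1 + x by lra.
by rewrite lnM ?posrE// addrAC subrr add0r.
Qed.

Lemma Tpart_near e eta : 0 < e -> e <= 1 -> 0 < eta ->
  \forall N \near \oo, `|Tpart e N - (ln e^-1 - ln (zeta1 1))| <= 8 * e + eta.
Proof.
move=> e0 e1 eta0; have e2 : 0 < 1 + 2 * e by lra.
have /andP[d1 d2] := zeta1_near1 e0 e1.
have [c1 c2] : ln e^-1 <= ln (zeta1 e) /\ ln (zeta1 e) <= ln e^-1 + e.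
  move: (zeta1 e) (zeta1_ge1 e0) (zeta1_le e0) (zeta1_ge e0) => z z1 z2 z3.
  have z0 : 0 < z := lt_le_trans ltr01 z1.
  have ei : 0 < e^-1 by rewrite invr_gt0.
  split; first by rewrite ler_ln ?posrE.
  apply: (@le_trans _ _ (ln (1 + e^-1))); first by rewrite ler_ln ?posrE ?addr_gt0.
  have -> : 1 + e^-1 = e^-1 * (1 + e) by field; rewrite gt_eqF.
  rewrite lnM ?posrE ?addr_gt0// lerD2l; apply: le_ln1Dx.
  by rewrite (lt_trans _ e0)// ltrN10.
have /cvgrPdist_le/(_ (eta / 2)) H1 := zeta1_euler e0.
have /cvgrPdist_le/(_ (eta / 2)) H2 := zeta1_euler e2.
have {}H1 := H1 (divr_gt0 eta0 (ltr0n _ 2)).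
have {}H2 := H2 (divr_gt0 eta0 (ltr0n _ 2)).
near=> N.
have N2 : (2 <= N.+1)%N by near: N; exists 1%N.
have hA : `|ln (zeta1 e) - - \sum_(0 <= q < N.+1 | prime q) ln (1 - (q%:R : R) `^ (- (1 + e)))| <= eta / 2 by near: N.
have hB : `|ln (zeta1 (1 + 2 * e)) - - \sum_(0 <= q < N.+1 | prime q) ln (1 - (q%:R : R) `^ (- (1 + (1 + 2 * e))))| <= eta / 2 by near: N.
set A := (X in `|_ - X|) in hA; set B := (X in `|_ - X|) in hB.
have AB : 0 <= A - B - Tpart e N <= 2 * e.
  have -> : A - B - Tpart e N = \sum_(0 <= q < N.+1 | prime q)
     (ln (1 + (q%:R : R) `^ (- (1 + e))) - prime_wt q * (q%:R : R) `^ (- e)).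
    rewrite /A /B /Tpart opprK addrC addrA -!sumrN -!big_split /=.
    apply: eq_bigr => q pq; rewrite -(ln_euler_factor e0 pq); ring.
  have pt q : prime q -> _ := @prime_wt_scaled e q e0.
  apply/andP; split; first by apply: sumr_ge0 => q /pt /andP[].
  apply: (@le_trans _ _ (\sum_(0 <= q < N.+1 | prime q) e * (ln q%:R / q%:R ^+ 2))).
    by apply: ler_sum => q /pt /andP[].
  rewrite -mulr_sumr mulrC ler_pM2r// .
  have T := @sum_ln_inv_sqr_tail R 1 N isT; rewrite ln1 add0r divr1 in T.
  apply: le_trans T.
  rewrite (@big_cat_nat _ _ _ 2)//= big_nat_cond big1 ?add0r.
    by rewrite big_mkcond; apply: ler_sum => q _; case: ifP; rewrite ?divr_ge0 ?ln_nat_ge0 ?exprn_ge0.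
  by move=> q /andP[/andP[_ q2] /prime_gt1]; rewrite ltnNge -ltnS q2.
have /andP[ab1 ab2] := AB.
move: hA hB; rewrite !ler_norml => /andP[a1 a2] /andP[b1 b2].
move: ab1 ab2 a1 a2 b1 b2 c1 c2 d1 d2 e0; clear.
move: A B (Tpart e N) (ln (zeta1 e)) (ln (zeta1 1)) (ln (zeta1 (1 + 2 * e))) (ln e^-1).
by move=> a b t x y z w *; apply/andP; split; lra.
Unshelve. all: by end_near. Qed.

End MertensConstant.

(** * Identification of the limit and Mertens' third theorem *)

Section MertensThird.
Context {R : realType}.
Local Notation alpha := (blk (@prime_wt R)).

(** For q in (2^(m-1), 2^m] one has r^m <= q^(-e) <= r^(m-1), so the two sums agree up to a factor
    r. *)
Lemma Tpart_blocks (e : R) (M : nat) : 0 < e ->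
  let r := expR (- (e * ln 2)) in
  \sum_(1 <= m < M.+1) alpha m * r ^+ m <= Tpart e (2 ^ M) /\
  r * Tpart e (2 ^ M) <= \sum_(1 <= m < M.+1) alpha m * r ^+ m.
Proof.
move=> e0 r; rewrite /Tpart -sum_blk1.
have rE m : r ^+ m = expR (- (e * (m%:R * ln 2))).
  by rewrite /r -expRM_natl; congr expR; ring.
split; last rewrite mulr_sumr; rewrite !big_nat; apply: ler_sum => m /andP[m0 _].
  rewrite /blk mulr_suml big_nat_cond [leRHS]big_nat_cond; apply: ler_sum => q /andP[qm pq].
  have q0 := prime_gt0 pq; apply: ler_wpM2l; first exact/ltW/prime_wt_gt0.
  rewrite powRNE// rE ler_expR lerN2 ler_pM2l//.
  by case: m m0 qm => // m _ qm; have /andP[] := blk_ln (R := R) qm.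
rewrite /blk mulr_suml mulr_sumr big_nat_cond [leRHS]big_nat_cond; apply: ler_sum => q /andP[qm pq].
have q0 := prime_gt0 pq; rewrite mulrCA; apply: ler_wpM2l; first exact/ltW/prime_wt_gt0.
rewrite powRNE// rE /r -expRD ler_expR.
case: m m0 qm => // m _ qm; have /andP[h _] := blk_ln (R := R) qm.
have : e * (m%:R * ln 2) <= e * ln q%:R by rewrite ler_pM2l.
by rewrite -(natr1 m) mulrDl; lra.
Qed.

Definition mertens_lim : R := limn (fun M => \sum_(1 <= m < M.+1) (alpha m - (m%:R)^-1)).

(* The limit is identified by Abel's theorem: at r = 2 ^ (- e), e = s ^ 2, the
   sum of alpha m * r ^ m is close to Tpart e, and that of r ^ m / m to
   - ln (1 - r). *)
Lemma mertens_lim_near (s eta : R) K : 0 < s -> s <= 2^-1 -> 0 < eta -> 0 <= K ->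
  (\forall M \near \oo, forall r : R, 0 <= r <= 1 ->
   `|\sum_(1 <= m < M.+1) (alpha m - (m%:R)^-1) * r ^+ m - mertens_lim| <= (1 - r) * K + eta) ->
  `|mertens_lim - (ln (ln 2) - ln (zeta1 1))| <= eta + s * (K + 40).
Proof.
move=> s0 s2 eta0 K0 HA.
(* The factor r costs about e ln (1/e); with e = s^2 this is at most 2 s, so every error becomes
   linear in s. *)
pose e := s ^+ 2; have e0 : 0 < e by rewrite exprn_gt0.
have es : e <= s / 2 by rewrite /e expr2; nra.
have e1 : e <= 1 by lra.
have l2 := @ln2_ge_half R; have l2' := @ln2_le1 R.
pose r := expR (- (e * ln 2)).
have a0 : 0 < e * ln 2 by rewrite mulr_gt0//; lra.
have ae : e * ln 2 <= e by rewrite ler_piMr// ltW.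
have r01 : 0 < r < 1 by rewrite expR_gt0 expR_lt1 oppr_lt0.
have /andP[r0 r1] := r01.
have T1 := Tpart_near e0 e1 e0.
have T2 := log_series_near r01 e0.
have expoo : (fun n => 2 ^ n)%N @ \oo --> \oo.
  apply/cvgnyPge => A; near=> n; apply: (@leq_trans n); last by rewrite ltnW// ltn_expl.
  by near: n; exists A.
have T1' := expoo _ T1.
have [M [h1 [h2 h3]]] : exists M,
   `|Tpart e (2 ^ M) - (ln e^-1 - ln (zeta1 1))| <= 8 * e + e /\
   `|\sum_(1 <= m < M.+1) (m%:R)^-1 * r ^+ m + ln (1 - r)| <= e /\
   `|\sum_(1 <= m < M.+1) (alpha m - (m%:R)^-1) * r ^+ m - mertens_lim| <= (1 - r) * K + eta.
  suff : \forall M \near \oo,  `|Tpart e (2 ^ M) - (ln e^-1 - ln (zeta1 1))| <= 8 * e + e /\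
   `|\sum_(1 <= m < M.+1) (m%:R)^-1 * r ^+ m + ln (1 - r)| <= e /\
   `|\sum_(1 <= m < M.+1) (alpha m - (m%:R)^-1) * r ^+ m - mertens_lim| <= (1 - r) * K + eta.
    by move=> /filter_ex.
  near=> M; split; first by near: M.
  split; first by near: M.
  have : forall r : R, 0 <= r <= 1 ->
   `|\sum_(1 <= m < M.+1) (alpha m - (m%:R)^-1) * r ^+ m - mertens_lim| <= (1 - r) * K + eta.
    by near: M.
  by apply; rewrite !ltW.
have [B1 B2] := Tpart_blocks M e0.
have X : \sum_(1 <= m < M.+1) alpha m * r ^+ m =
   \sum_(1 <= m < M.+1) (alpha m - (m%:R)^-1) * r ^+ m + \sum_(1 <= m < M.+1) (m%:R)^-1 * r ^+ m.
  by rewrite -big_split /=; apply: eq_bigr => m _; rewrite -mulrDl subrK.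
have rub : 1 - r <= e * ln 2 by have := @expR_ge1Dx R (- (e * ln 2)); rewrite -/r; lra.
have rlb : e * ln 2 / (1 + e * ln 2) <= 1 - r.
  rewrite /r expRN; have h := @expR_ge1Dx R (e * ln 2).
  have p1 : 0 < 1 + e * ln 2 by lra.
  have : (expR (e * ln 2))^-1 <= (1 + e * ln 2)^-1 by rewrite lef_pV2 ?posrE ?expR_gt0.
  have -> : e * ln 2 / (1 + e * ln 2) = 1 - (1 + e * ln 2)^-1 by field; rewrite gt_eqF.
  by lra.
have r10 : 0 < 1 - r by lra.
have ll : ln (e * ln 2) = ln e + ln (ln 2) by rewrite lnM ?posrE//; lra.
have lub : ln (1 - r) <= ln e + ln (ln 2) by rewrite -ll ler_ln ?posrE.
have llb : ln e + ln (ln 2) - e <= ln (1 - r).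
  rewrite -ll; apply: (@le_trans _ _ (ln (e * ln 2 / (1 + e * ln 2)))).
    rewrite ln_div ?posrE//; last by lra.
    rewrite lerD2l lerN2 (le_trans (le_ln1Dx _))//; lra.
  rewrite ler_ln ?posrE// divr_gt0//; lra.
have lei : ln e^-1 = - ln e by rewrite lnV ?posrE.
have z1 : 0 <= ln (zeta1 1) :> R by rewrite ln_ge0 ?zeta1_ge1.
have elne : e * - ln e <= 2 * s.
  have -> : ln e = ln s *+ 2 by rewrite /e lnXn.
  have : - ln s <= s^-1.
    by rewrite -lnV ?posrE// (le_trans (ln_le_subr1 _)) ?invr_gt0//; lra.
  move=> /(ler_wpM2l (ltW e0)); have -> : e * s^-1 = s by rewrite /e; field; rewrite gt_eqF.
  by lra.
have T0 : 0 <= Tpart e (2 ^ M).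
  by apply: sumr_ge0 => q /prime_gt0 q0; rewrite mulr_ge0 ?powR_ge0// ltW// prime_wt_gt0.
rewrite -/r in B1 B2; rewrite X in B1 B2; rewrite lei in h1.
have K1 : (1 - r) * K <= e * K by apply: ler_wpM2r => //; lra.
have K2 : e * K <= s * K by apply: ler_wpM2r => //; lra.
have rT : Tpart e (2 ^ M) - e * Tpart e (2 ^ M) <= r * Tpart e (2 ^ M).
  have -> : Tpart e (2 ^ M) - e * Tpart e (2 ^ M) = (1 - e) * Tpart e (2 ^ M) by ring.
  apply: ler_wpM2r => //; lra.
have eT : e * Tpart e (2 ^ M) <= 2 * s + 9 * e.
  move: h1; rewrite ler_norml => /andP[_ h1].
  apply: (@le_trans _ _ (e * (- ln e + 9 * e))).
    by apply: ler_wpM2l; [exact: ltW|lra].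
  have : e * e <= e by rewrite ler_piMl// ltW.
  by lra.
move: h1 h2 h3; rewrite !ler_norml => /andP[h1 h1'] /andP[h2 h2'] /andP[h3 h3'].
move: B1 B2 h1 h1' h2 h2' h3 h3' lub llb K1 K2 rT eT es s0.
move: (e * Tpart e (2 ^ M)) ((1 - r) * K) (e * K) => u1 u2 u3.
move: (r * Tpart e (2 ^ M)) (Tpart e _) (ln (1 - r)) (ln (ln 2)) (ln (zeta1 1)) (ln e) mertens_lim.
move=> rt t x1 x2 x3 x4 x5; rewrite mulrDr; move: (s * K) => sK.
by clear; move=> *; apply/andP; split; lra.
Unshelve. all: by end_near. Qed.

Lemma mertens_limE : mertens_lim = ln (ln 2) - ln (zeta1 1).
Proof.
apply/eqP; rewrite -subr_eq0 -normr_le0; apply/ler_addgt0Pr => eta eta0; rewrite add0r.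
have e2 : 0 < eta / 2 by lra.
have [K [M0 [K0 H]]] := abel_theorem e2 (@alpha_harmonic_cvg R).
pose s := Num.min 2^-1 (eta / 2 / (K + 40)).
have K40 : 0 < K + 40 by lra.
have s0 : 0 < s by rewrite lt_min invr_gt0 ltr0n !divr_gt0.
have s2 : s <= 2^-1 by rewrite ge_min lexx.
have s3 : s * (K + 40) <= eta / 2.
  by rewrite -ler_pdivlMr// ge_min lexx orbT.
apply: (le_trans (mertens_lim_near s0 s2 e2 K0 _)).
  by exists M0 => // M /= M0M r r01; exact: H.
by lra.
Qed.

Definition prime_sum (n : nat) : R := \sum_(0 <= q < n.+1 | prime q) prime_wt q.

(** Its exponential is the constant 6 e^gamma / pi^2. The harmonic sum supplies gamma, and the ln
    (ln 2) in [mertens_limE] cancels against ln (M ln 2). *)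
Definition mertens_const : R := euler_gamma R - ln (pi ^+ 2 / 6).

Lemma prime_sum_le (m n : nat) : (m <= n)%N -> prime_sum m <= prime_sum n.
Proof.
move=> mn; rewrite /prime_sum [leRHS](@big_cat_nat _ _ _ m.+1)//= lerDl.
by apply: sumr_ge0 => q /prime_gt0 q0; apply/ltW/prime_wt_gt0.
Qed.

Lemma prime_sum_pow2 : (fun M => prime_sum (2 ^ M) - ln (M%:R * ln 2)) @ \oo --> mertens_const.
Proof.
have l2 := @ln2_ge_half R; have l0 : 0 < ln 2 :> R by lra.
have h1 : (fun M => \sum_(1 <= m < M.+1) (alpha m - (m%:R)^-1)) @ \oo --> (ln (ln 2) - ln (zeta1 1) : R).
  by rewrite -mertens_limE; exact: alpha_harmonic_cvg.
have h2 := @is_cvg_euler_gamma R.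
have h3 : (fun M => \sum_(1 <= m < M.+1) (alpha m - (m%:R)^-1) +
   (series (@harmonic R) M - ln M%:R) - ln (ln 2)) @ \oo --> mertens_const.
  rewrite /mertens_const (_ : _ - _ = (ln (ln 2) - ln (zeta1 1)) + euler_gamma R - ln (ln 2)); last first.
    by rewrite zeta1_1; ring.
  by apply: cvgB; [apply: cvgD|exact: cvg_cst].
apply: cvg_trans h3; apply: near_eq_cvg; near=> M.
have M0 : (0 < M)%N by near: M; exists 1%N.
rewrite lnM ?posrE ?ltr0n// sumrB sum_blk1 -/(prime_sum _).
have -> : series (@harmonic R) M = \sum_(1 <= m < M.+1) (m%:R)^-1.
  by rewrite /series /= big_add1.
by ring.
Unshelve. all: by end_near. Qed.

(** [prime_sum] is monotone, so n is enclosed between 2^M and 2^(M+1), where ln ln varies by at most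
    1/M. *)
Lemma mertens_third : (fun n => prime_sum n - ln (ln n%:R)) @ \oo --> mertens_const.
Proof.
have l2 := @ln2_ge_half R; have l0 : 0 < ln 2 :> R by lra.
apply/cvgrPdist_le => eta eta0.
have e2 : 0 < eta / 2 by lra.
have /cvgrPdist_le/(_ _ e2)[M0 _ H] := prime_sum_pow2.
pose M1 := (Num.truncn (2 / eta)).+1.
exists (2 ^ (maxn M0 M1).+1)%N => // n /= nM.
have n1 : (1 < n)%N by apply: leq_trans nM; rewrite -(expn0 2) ltn_exp2l.
pose M := trunc_log 2 n.
have /andP[Mn nM'] : (2 ^ M <= n < 2 ^ M.+1)%N by apply: trunc_log_bounds => //; lia.
have MM : ((maxn M0 M1).+1 <= M)%N by apply: trunc_log_max.
have M0M : (M0 <= M)%N by apply: leq_trans (leq_maxl M0 M1) _; exact: ltnW.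
have M1M : (M1 <= M)%N by apply: leq_trans (leq_maxr M0 M1) _; exact: ltnW.
have Mp : (0 < M)%N by exact: leq_trans MM.
have MR : 0 < M%:R :> R by rewrite ltr0n.
have hM := H M M0M; have hM1 := H M.+1 (leqW M0M).
have p1 := prime_sum_le Mn; have p2 := prime_sum_le (ltnW nM').
have nR : 1 < n%:R :> R by rewrite ltr1n.
have lnn : 0 < ln n%:R :> R by exact: ln_gt0.
have E k : k%:R * ln 2 = ln (2 ^ k)%:R :> R by rewrite natrX lnXn// mulr_natl.
have l1 : ln (M%:R * ln 2) <= ln (ln n%:R) :> R.
  rewrite ler_ln ?posrE ?mulr_gt0// E ler_ln ?posrE ?ltr0n ?expn_gt0 ?ler_nat//.
  exact: ltnW.
have l3 : ln (ln n%:R) <= ln (M.+1%:R * ln 2) :> R.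
  rewrite ler_ln ?posrE ?mulr_gt0// E ler_ln ?posrE ?ltr0n ?expn_gt0 ?ler_nat//; exact: ltnW.
have l4 : ln (M.+1%:R * ln 2) <= ln (M%:R * ln 2) + eta / 2 :> R.
  rewrite !lnM ?posrE// addrAC lerD2r -lerBlDl -ln_div ?posrE//.
  apply: (le_trans (ln_le_subr1 _)); first exact: divr_gt0.
  rewrite -(natr1 M) mulrDl divff ?gt_eqF// addrC addKr mul1r.
  have h : 2 / eta <= M%:R by apply: (@le_trans _ _ M1%:R); [rewrite ltW// truncnS_gt|rewrite ler_nat].
  rewrite -[leRHS]invrK lef_pV2 ?posrE ?invr_gt0// invf_div//.
move: hM hM1; rewrite !ler_norml => /andP[a1 a2] /andP[b1 b2].
by apply/andP; split; lra.
Qed.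

End MertensThird.

(** * Prime factors of psi n *)

Section PsiFacts.
Local Open Scope nat_scope.

Lemma psi_divE n : psi n = (n %/ \prod_(q <- primes n) q) * \prod_(q <- primes n) q.+1.
Proof. by rewrite /psi mulnC -muln_divA ?dvdn_prod_primes// mulnC. Qed.

Lemma prod_primes_gt0 n : 0 < \prod_(q <- primes n) q.
Proof.
rewrite big_seq; apply: prodn_cond_gt0 => q.
by rewrite mem_primes => /and3P[/prime_gt0].
Qed.

Lemma psi_gt0 n : 0 < n -> 0 < psi n.
Proof.
move=> n0; rewrite psi_divE muln_gt0 divn_gt0 ?prod_primes_gt0//.
by rewrite dvdn_leq ?dvdn_prod_primes//= prodn_gt0.
Qed.

Lemma psi_le_sqr n : psi n <= n ^ 2.
Proof.
case: (posnP n) => [->|n0]; first by rewrite psi_divE div0n.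
rewrite psi_divE; set r := \prod_(q <- primes n) q.
have rn : r %| n := dvdn_prod_primes n.
have H : \prod_(q <- primes n) q.+1 <= r * r.
  rewrite /r -big_split /= big_seq [leqRHS]big_seq; apply: leq_prod => q.
  by rewrite mem_primes => /and3P[/prime_gt1 q1 _ _]; nia.
apply: (leq_trans (leq_mul (leqnn _) H)); rewrite mulnA divnK// -mulnn leq_mul2l.
by rewrite dvdn_leq ?orbT.
Qed.

Lemma dvdn_psi_prime n p q : 0 < n -> prime q -> q %| n -> p %| q.+1 -> p %| psi n.
Proof.
move=> n0 pq qn pq1; rewrite psi_divE dvdn_mull//.
have qm : q \in primes n by rewrite mem_primes pq n0 qn.
by rewrite (big_rem q)//= dvdn_mulr.
Qed.

Lemma dvdn_prod_seq_prime (s : seq nat) (F : nat -> nat) p : prime p ->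
  p %| \prod_(q <- s) F q -> exists2 q, q \in s & p %| F q.
Proof.
move=> pp; elim: s => [|q s IH]; first by rewrite big_nil dvdn1 => /eqP p1; rewrite p1 in pp.
rewrite big_cons Euclid_dvdM// => /orP[pq|/IH[r rs pr]].
  by exists q; rewrite ?mem_head.
by exists r; rewrite // inE rs orbT.
Qed.

Lemma prime_dvd_psi n p : 0 < n -> prime p -> p %| psi n ->
  p ^ 2 %| n \/ exists q, [/\ prime q, q %| n & p %| q.+1].
Proof.
move=> n0 pp; rewrite psi_divE Euclid_dvdM// => /orP[pm|/(dvdn_prod_seq_prime pp)[q]].
  left; set r := \prod_(q <- primes n) q in pm.
  have rn : r %| n := dvdn_prod_primes n.
  rewrite -(divnK rn) -mulnn dvdn_mul//.
  have pn : p \in primes n.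
    by rewrite mem_primes pp n0 -(divnK rn) dvdn_mulr.
  by rewrite /r (big_rem p)//= dvdn_mulr.
by rewrite mem_primes => /and3P[pq _ qn] pq1; right; exists q.
Qed.

Lemma prime_dvd_psi_le n p : 0 < n -> prime p -> p %| psi n -> p <= n.+1.
Proof.
move=> n0 pp /(prime_dvd_psi n0 pp)[/(dvdn_leq n0)|[q [pq /(dvdn_leq n0) qn /dvdn_leq]]].
  by have := prime_gt0 pp; nia.
by move=> /(_ isT) h; apply: leq_trans h _.
Qed.

End PsiFacts.

Section Counting.
Context {R : realType}.
Variable N : nat.

Lemma count_dvdn (d : nat) : (0 < d)%N ->
  \sum_(1 <= n < N.+1) ((d %| n)%N%:R : R) = (N %/ d)%:R.
Proof.
move=> d0; transitivity (\sum_(1 <= n < N.+1 | (d %| n)%N && true) (1 : R)).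
  by rewrite [RHS]big_mkcond; apply: eq_bigr => n _; rewrite andbT; case: ifP.
by rewrite big_nat_dvd// sumr_const_nat subn1.
Qed.

Lemma divn_le_div (n d : nat) : (n %/ d)%:R <= n%:R / d%:R :> R.
Proof.
case: (posnP d) => [->|d0]; first by rewrite divn0 invr0 mulr0.
by rewrite ler_pdivlMr ?ltr0n// -natrM ler_nat leq_divM.
Qed.

(* Second moment around S of the number of prime factors of n satisfying P: each
   n without such a factor contributes S ^ 2. *)
Lemma turan_count (P : pred nat) (S : R) :
  S = \sum_(0 <= q < N.+1 | prime q && P q) (q%:R)^-1 ->
  S * \sum_(1 <= n < N.+1) (\sum_(0 <= q < N.+1 | prime q && P q) ((q %| n)%N%:R : R) == 0)%:R
    <= 3 * N%:R.
Proof.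
move=> SE.
pose om n : R := \sum_(0 <= q < N.+1 | prime q && P q) (q %| n)%N%:R.
have S0 : 0 <= S by rewrite SE sumr_ge0.
have Sqr : \sum_(1 <= n < N.+1) om n ^+ 2 <= N%:R * S ^+ 2 + N%:R * S.
  have -> : \sum_(1 <= n < N.+1) om n ^+ 2 = \sum_(0 <= q < N.+1 | prime q && P q)
     \sum_(0 <= r < N.+1 | prime r && P r) \sum_(1 <= n < N.+1) ((q %| n)%N && (r %| n)%N)%:R.
    under [RHS]eq_bigr do rewrite exchange_big /=.
    rewrite [RHS]exchange_big /=; apply: eq_bigr => n _.
    rewrite /om expr2 mulr_suml; apply: eq_bigr => q _.
    rewrite mulr_sumr; apply: eq_bigr => r _.
    by case: (q %| n)%N; case: (r %| n)%N; rewrite ?mulr1 ?mulr0.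
  have -> : N%:R * S ^+ 2 + N%:R * S = \sum_(0 <= q < N.+1 | prime q && P q)
     (\sum_(0 <= r < N.+1 | prime r && P r) N%:R / (q%:R * r%:R) + N%:R / q%:R).
    rewrite big_split /= -!mulr_sumr -SE; congr (_ + _).
    rewrite expr2 {1}SE mulr_suml mulr_sumr; apply: eq_bigr => q _.
    rewrite SE 2!mulr_sumr; apply: eq_bigr => r _.
    by rewrite invfM.
  apply: ler_sum => q /andP[pq Pq]; have q0 := prime_gt0 pq.
  (* The diagonal term is spread as a sum over r supported at r = q, so that the comparison can be
     made term by term in r. *)
  have -> : N%:R / q%:R = \sum_(0 <= r < N.+1 | prime r && P r) (if r == q then N%:R / q%:R else 0) +
     (if (q < N.+1)%N then 0 else N%:R / q%:R) :> R.
    rewrite -big_mkcondr /= (eq_bigl (fun r => r == q)); last first.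
      by move=> r; case: eqP => [->|]; rewrite ?pq ?Pq ?andbF.
    by rewrite big_nat1_eq /=; case: ifP; rewrite ?addr0 ?add0r.
  rewrite addrA -big_split /= ler_wpDr//; first by case: ifP; rewrite ?divr_ge0.
  apply: ler_sum => r /andP[pr Pr]; have r0 := prime_gt0 pr.
  case: eqVneq => [->|rq].
    apply: (@le_trans _ _ (N%:R / q%:R)); last by rewrite lerDr divr_ge0// mulr_ge0.
    under eq_bigr do rewrite andbb.
    by rewrite count_dvdn// divn_le_div.
  rewrite addr0 -natrM; apply: le_trans (divn_le_div _ _).
  rewrite -count_dvdn ?muln_gt0 ?q0//; apply: ler_sum => n _.
  by rewrite Gauss_dvd// prime_coprime// dvdn_prime2// eq_sym.
have Sum1 : N%:R * S - N%:R <= \sum_(1 <= n < N.+1) om n.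
  rewrite /om exchange_big /= {1}SE mulr_sumr.
  have card : \sum_(0 <= q < N.+1 | prime q && P q) (1 : R) <= N%:R.
    rewrite big_mkcond big_ltn//= add0r.
    apply: (@le_trans _ _ (\sum_(1 <= q < N.+1) (1 : R))).
      by apply: ler_sum => q _; case: ifP.
    by rewrite sumr_const_nat subn1.
  apply: (@le_trans _ _ (\sum_(0 <= q < N.+1 | prime q && P q) (N%:R * (q%:R)^-1 - 1))).
    by rewrite sumrB lerD2l lerN2.
  apply: ler_sum => q /andP[pq _]; rewrite count_dvdn ?prime_gt0//.
  rewrite lerBlDr natr1 ler_pdivrMr ?ltr0n ?prime_gt0// -natrM ler_nat ltnW//.
  by rewrite ltn_ceil// prime_gt0.
have Var : \sum_(1 <= n < N.+1) (om n - S) ^+ 2 <= 3 * N%:R * S.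
  have -> : \sum_(1 <= n < N.+1) (om n - S) ^+ 2 =
     \sum_(1 <= n < N.+1) om n ^+ 2 - 2 * S * \sum_(1 <= n < N.+1) om n + N%:R * S ^+ 2.
    have -> : N%:R * S ^+ 2 = \sum_(1 <= n < N.+1) S ^+ 2.
      by rewrite sumr_const_nat subn1 mulr_natl.
    by rewrite mulr_sumr -sumrB -big_split /=; apply: eq_bigr => n _; ring.
  have := ler_wpM2l (mulr_ge0 (ler0n R 2) S0) Sum1.
  by move: Sqr; lra.
have Cnt : S ^+ 2 * \sum_(1 <= n < N.+1) (om n == 0)%:R <= \sum_(1 <= n < N.+1) (om n - S) ^+ 2.
  rewrite mulr_sumr; apply: ler_sum => n _.
  case: eqP => [->|_]; first by rewrite sub0r sqrrN mulr1.
  by rewrite mulr0 sqr_ge0.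
rewrite -/om; move: S0; rewrite le_eqVlt => /orP[/eqP <-|Sp]; first by rewrite mul0r mulr_ge0.
rewrite -(ler_pM2l Sp); move: (le_trans Cnt Var); rewrite expr2 /om -mulrA.
by rewrite [S * (3 * _)]mulrC.
Qed.

(** Such an n has no prime factor q = -1 mod p; [turan_count] with S >= t / (4 p) gives 3 N / S <=
    12 N p / t. *)
Lemma count_ndvd_psi (p : nat) : prime p ->
  252 * p%:R * ln (2 * p%:R) <= ln (ln N%:R) :> R ->
  \sum_(1 <= n < N.+1) ((~~ (p %| psi n)%N)%:R : R) <= 12 * N%:R * p%:R / ln (ln N%:R).
Proof.
move=> pp Hp; have pR : 2 <= p%:R :> R by rewrite ler_nat prime_gt1.
have h := recip_class_lower pp Hp.
set t := ln (ln _) in Hp h *.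
have L1 := @Lam_ge1 R p pp.
have t0 : 0 < t.
  have c0 := ltr0Sn R 251; move: c0 Hp; move: (252%:R : R) => c c0 Hp.
  apply: lt_le_trans Hp; rewrite mulr_gt0//; last exact: lt_le_trans L1.
  by rewrite mulr_gt0// ltr0n prime_gt0.
have p0 : 0 < p%:R :> R by lra.
set S := \sum_(0 <= q < N.+1 | _) _ in h.
have S0 : 0 < S by apply: lt_le_trans h; rewrite divr_gt0// mulr_gt0.
have T := @turan_count (fun q => p %| q.+1)%N S erefl.
set C := \sum_(1 <= n < N.+1) _ in T.
apply: (@le_trans _ _ C).
  rewrite /C !big_nat; apply: ler_sum => n /andP[n0 nN].
  case: (boolP (p %| psi n)%N) => //= pn; rewrite big1 ?eqxx// => q /andP[pq pq1].
  have -> : (q %| n)%N = false; last by [].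
  by apply: contraNF pn => qn; exact: dvdn_psi_prime pq1.
have C0 : 0 <= C by apply: sumr_ge0 => n _; case: (_ == _).
rewrite ler_pdivlMr//.
have h' : t <= 4 * p%:R * S by move: h; rewrite ler_pdivrMr ?mulr_gt0// mulrC.
apply: (le_trans (ler_wpM2l C0 h')).
have := ler_wpM2l (ltW p0) T; lra.
Qed.

(** Either p^2 divides n or n has a prime factor q = -1 mod p. The second case costs 192 by
    [class_recip_upper]; the first, at most N / p^2, is absorbed by raising 192 to 194. *)
Lemma count_dvd_psi (p : nat) : prime p -> 1 <= ln (ln N%:R) :> R ->
  \sum_(1 <= n < N.+1) ((p %| psi n)%N%:R : R) <= 194 * N%:R * ln (ln N%:R) * (ln p%:R / p%:R).
Proof.
move=> pp t1; have p0 := prime_gt0 pp.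
have pR : 2 <= p%:R :> R by rewrite ler_nat prime_gt1.
have U := @class_recip_upper R p pp N t1.
set t := ln (ln _) in t1 U *.
apply: (@le_trans _ _ (\sum_(1 <= n < N.+1) ((p ^ 2 %| n)%N%:R +
    \sum_(0 <= q < N.+1 | prime q && (p %| q.+1)%N) (q %| n)%N%:R))).
  rewrite !big_nat; apply: ler_sum => n /andP[n0 nN].
  have s0 : 0 <= \sum_(0 <= q < N.+1 | prime q && (p %| q.+1)%N) ((q %| n)%N%:R : R) by apply: sumr_ge0.
  case: (boolP (p %| psi n)%N) => [pn|_]; last by rewrite addr_ge0.
  case: (prime_dvd_psi n0 pp pn) => [->|[q [pq qn pq1]]]; first by rewrite lerDl.
  apply: ler_wpDl => //.
  rewrite (big_rem q)/=; last by rewrite mem_index_iota /= (leq_ltn_trans (dvdn_leq n0 qn)).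
  by rewrite pq pq1 qn lerDl sumr_ge0.
rewrite big_split /= count_dvdn ?expn_gt0 ?p0// exchange_big /=.
have h2 : \sum_(0 <= q < N.+1 | prime q && (p %| q.+1)%N) \sum_(1 <= n < N.+1) ((q %| n)%N%:R : R)
   <= N%:R * (192 * (ln p%:R / p%:R) * t).
  apply: le_trans (ler_wpM2l _ U); last by [].
  rewrite mulr_sumr; apply: ler_sum => q /andP[pq _].
  by rewrite count_dvdn ?prime_gt0// divn_le_div.
have h1 : (N %/ p ^ 2)%:R <= N%:R * (2 * (ln p%:R / p%:R) * t).
  apply: (le_trans (divn_le_div _ _)); rewrite ler_wpM2l//.
  have lp : 2^-1 <= ln p%:R :> R.
    apply: le_trans (@ln2_ge_half R) _; rewrite ler_ln ?posrE//; lra.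
  have p1 : p%:R^-1 <= 1 :> R by rewrite invf_le1; lra.
  have pi0 : 0 < p%:R^-1 :> R by rewrite invr_gt0; lra.
  rewrite natrX -exprVn expr2.
  clear U h2; move: p1 pi0 lp t1; move: (p%:R^-1 : R) (ln (p%:R : R)) t => x l t' x1 x0 l2 t1.
  have : 1 <= 2 * l * t' by nra.
  by nra.
by apply: (le_trans (lerD h1 h2)); lra.
Qed.

End Counting.

Lemma primes_size_le (m : nat) : (0 < m)%N -> (2 ^ size (primes m) <= m)%N.
Proof.
move=> m0; apply: leq_trans (dvdn_leq m0 (dvdn_prod_primes m)).
rewrite -sum1_size expn_sum big_seq [leqRHS]big_seq; apply: leq_prod => q.
by rewrite mem_primes => /and3P[/prime_gt1].
Qed.

(** * Weights of the prime factors of psi n and their means *)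

Section Averages.
Context {R : realType}.
Variables N M : nat.
(** A prime dividing [psi n] is at most n + 1, so for n <= N all of them lie below M. *)
Hypothesis NM : (N.+2 <= M)%N.
Local Notation t := (ln (ln N%:R) : R).

(* psi_wt 0 M n is the logarithm of psi (psi n) / psi n, see psi_ratioE. *)
Definition psi_wt a b n : R := \sum_(a <= p < b | prime p && (p %| psi n)%N) prime_wt p.
Definition psi_defect y n : R := \sum_(0 <= p < y.+1 | prime p && ~~ (p %| psi n)%N) prime_wt p.

Lemma psi_wt_ge0 a b n : 0 <= psi_wt a b n.
Proof. by apply: sumr_ge0 => p /andP[/prime_gt0 /(@prime_wt_gt0 R) /ltW]. Qed.

Lemma psi_defect_ge0 y n : 0 <= psi_defect y n.
Proof. by apply: sumr_ge0 => p /andP[/prime_gt0 /(@prime_wt_gt0 R) /ltW]. Qed.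

Lemma primes_psi_perm n : (0 < n <= N)%N ->
  perm_eq (primes (psi n)) [seq p <- index_iota 0 M | prime p && (p %| psi n)%N].
Proof.
move=> /andP[n0 nN]; apply: uniq_perm; first exact: primes_uniq.
  by rewrite filter_uniq// iota_uniq.
move=> p; rewrite mem_primes mem_filter mem_index_iota psi_gt0//=.
case: (boolP (prime p)) => //= pp; case: (boolP (p %| psi n)%N) => //= pn.
by apply/esym; apply: (leq_ltn_trans (prime_dvd_psi_le n0 pp pn)); apply: leq_trans NM; rewrite !ltnS.
Qed.

Lemma psi_ratioE n : (0 < n <= N)%N ->
  (psi (psi n))%:R / (psi n)%:R = expR (psi_wt 0 M n).
Proof.
move=> nN; have /andP[n0 _] := nN.
rewrite psiE mulrAC divff ?mul1r; last by rewrite pnatr_eq0 -lt0n psi_gt0.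
rewrite /psi_wt expR_sum -[RHS]big_filter -(perm_big _ (primes_psi_perm nN)) /=.
apply: eq_big_seq => p; rewrite mem_primes => /and3P[pp _ _].
by rewrite /prime_wt lnK// posrE ltr_wpDr.
Qed.

Lemma psi_wt_split y n : (y < M)%N ->
  psi_wt 0 M n = prime_sum y - psi_defect y n + psi_wt y.+1 M n.
Proof.
move=> yM; rewrite /psi_wt (big_cat_nat (n := y.+1))//=; congr (_ + _).
rewrite /prime_sum /psi_defect; apply/eqP; rewrite eq_sym subr_eq; apply/eqP.
by rewrite [LHS](bigID (fun p => p %| psi n)%N).
Qed.

Lemma psi_wt_le a b n : (a <= b)%N -> psi_wt a.+1 b.+1 n <= prime_sum b - prime_sum a.
Proof.
move=> ab; rewrite /prime_sum (big_cat_nat (n := a.+1) (p := b.+1))//= addrAC subrr add0r.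
rewrite /psi_wt big_mkcond [leRHS]big_mkcond; apply: ler_sum => p _.
case: (boolP (prime p)) => //= pp; case: ifP => // _.
exact/ltW/prime_wt_gt0/prime_gt0.
Qed.

(** Primes up to Y weigh at most [prime_sum Y]. Since psi n <= N^2, it has at most 2 ln N / ln 2 <=
    4 ln N <= Y prime factors, and those beyond Y weigh at most 1/Y each. *)
Lemma psi_wt_tail_le (a Y n : nat) : (0 < n <= N)%N -> (0 < Y)%N -> 4 * ln N%:R <= Y%:R :> R ->
  psi_wt a M n <= prime_sum Y + 1.
Proof.
move=> nN Y0 hY; have /andP[n0 nN'] := nN.
have Y0R : 0 < Y%:R :> R by rewrite ltr0n.
apply: (@le_trans _ _ (psi_wt 0 M n)).
  case: (leqP a M) => aM; last by rewrite /psi_wt (big_geq (ltnW aM)) psi_wt_ge0.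
  by rewrite {2}/psi_wt (big_cat_nat (n := a))//= lerDr psi_wt_ge0.
rewrite /psi_wt (bigID (fun p => p < Y.+1)%N) /= lerD//.
  rewrite /prime_sum big_mkcond [leRHS]big_mkcond /=.
  case: (leqP M Y.+1) => MY.
    rewrite [leRHS](big_cat_nat (n := M))//= ler_wpDr//.
      by apply: sumr_ge0 => p _; case: ifP => // /prime_gt0 /(@prime_wt_gt0 R) /ltW.
    apply: ler_sum => p _; case: (boolP (prime p)) => //= pp; case: ifP => // _.
    exact/ltW/prime_wt_gt0/prime_gt0.
  rewrite [leLHS](big_cat_nat (n := Y.+1) _ (ltnW MY))//= [X in _ + X]big_nat [X in _ + X]big1 ?addr0; last first.
    by move=> p /andP[Yp _]; rewrite ltnNge Yp andbF.
  apply: ler_sum => p _; case: (boolP (prime p)) => //= pp; case: ifP => // _.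
  exact/ltW/prime_wt_gt0/prime_gt0.
apply: (@le_trans _ _ (\sum_(p <- primes (psi n)) Y%:R^-1)).
  rewrite (perm_big _ (primes_psi_perm nN)) big_filter.
  rewrite big_mkcondr /=; apply: ler_sum => p /andP[pp _].
  case: ifP => [|_]; last by rewrite invr_ge0 ltW.
  rewrite -leqNgt => Yp; apply: (le_trans (prime_wt_ub (prime_gt0 pp))).
  by rewrite lef_pV2 ?posrE ?ltr0n ?(leq_trans _ Yp)// ler_nat ltnW.
rewrite big_const_seq count_predT iter_addr_0 -[_ *+ _]mulr_natl ler_pdivrMr// mul1r.
apply: le_trans hY; set k := size _.
have kN : (2 ^ k <= N ^ 2)%N.
  apply: (leq_trans (primes_size_le (psi_gt0 n0))); apply: (leq_trans (psi_le_sqr n)).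
  by rewrite leq_exp2r.
have N0 : (0 < N)%N by exact: leq_trans nN'.
have : k%:R * ln 2 <= 2 * ln N%:R :> R.
  rewrite !mulr_natl -!lnXn ?posrE ?ltr0n// -!natrX ler_ln ?posrE ?ltr0n ?expn_gt0 ?N0//.
  by rewrite ler_nat.
have := @ln2_ge_half R; have : 0 <= k%:R :> R by [].
move: (k%:R : R) (ln N%:R : R) (ln 2 : R) => a' b c; nra.
Qed.

(** The weight of p is at most 1/p, which cancels the factor p in the number of exceptions, so each
    p <= y costs at most 12 N / t. *)
Lemma sum_psi_defect y : 252 * y%:R * ln (2 * y%:R) <= t -> 0 < t ->
  \sum_(1 <= n < N.+1) psi_defect y n <= N%:R * (12 * y%:R / t).
Proof.
move=> hy t0.
have -> : N%:R * (12 * y%:R / t) = \sum_(1 <= p < y.+1) 12 * N%:R / t.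
  by rewrite sumr_const_nat subn1 /= -[RHS]mulr_natl; ring.
under eq_bigr do rewrite /psi_defect big_mkcondr /=.
rewrite exchange_big /= big_mkcond big_ltn//= add0r !big_nat; apply: ler_sum => p /andP[p0 py].
have h0 : 0 <= 12 * N%:R / t :> R by rewrite divr_ge0 ?mulr_ge0// ltW.
case: ifP => // pp; have w0 := @prime_wt_gt0 R p p0.
have -> : \sum_(1 <= n < N.+1) (if ~~ (p %| psi n)%N then prime_wt p else 0) =
   prime_wt p * \sum_(1 <= n < N.+1) (~~ (p %| psi n)%N)%:R :> R.
  by rewrite mulr_sumr; apply: eq_bigr => n _; case: ifP; rewrite ?mulr1 ?mulr0.
have p0R : 0 < p%:R :> R by rewrite ltr0n.
apply: (@le_trans _ _ (prime_wt p * (12 * N%:R * p%:R / t))).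
  rewrite ler_pM2l//; apply: count_ndvd_psi => //; apply: le_trans hy.
  rewrite -!mulrA ler_wpM2l ?(ler0n R 252)// ler_pM//.
  - by apply: ln_ge0; rewrite -natrM ler1n muln_gt0.
  - by rewrite ler_nat -ltnS.
  by rewrite -!natrM ler_ln ?posrE ?ltr0n ?muln_gt0 ?p0 ?ler_nat ?leq_pmul2l//= -ltnS// (leq_trans _ py).
have := prime_wt_ub (R := R) p0; rewrite -(ler_pM2r p0R) mulVf ?gt_eqF// => h.
have := ler_wpM2r h0 h; rewrite mul1r; apply: le_trans; lra.
Qed.

Lemma sum_psi_wt y b : 1 <= t -> (0 < y)%N ->
  \sum_(1 <= n < N.+1) psi_wt y.+1 b.+1 n <= N%:R * (194 * t * ((ln y%:R + 2) / y%:R)).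
Proof.
move=> t1 y0; have t0 : 0 <= t by apply: le_trans t1.
under eq_bigr do rewrite /psi_wt big_mkcondr /=.
rewrite exchange_big /=.
apply: (@le_trans _ _ (\sum_(y.+1 <= p < b.+1) (194 * N%:R * t) * (ln p%:R / p%:R ^+ 2))).
  rewrite big_mkcond !big_nat; apply: ler_sum => p /andP[py _].
  have p0 : (0 < p)%N by exact: leq_trans py.
  have p0R : 0 < p%:R :> R by rewrite ltr0n.
  have h0 : 0 <= (194 * N%:R * t) * (ln p%:R / p%:R).
    apply: mulr_ge0; last by rewrite divr_ge0// ln_ge0// ler1n.
    exact: mulr_ge0 (mulr_ge0 (ler0n R 194) (ler0n R N)) t0.
  have -> : 194 * N%:R * t * (ln p%:R / p%:R ^+ 2) = p%:R^-1 * (194 * N%:R * t * (ln p%:R / p%:R)).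
    by rewrite expr2 invfM; ring.
  case: ifP => [pp|_]; last by rewrite mulr_ge0// invr_ge0 ltW.
  have -> : \sum_(1 <= n < N.+1) (if (p %| psi n)%N then prime_wt p else 0) =
     prime_wt p * \sum_(1 <= n < N.+1) (p %| psi n)%N%:R :> R.
    by rewrite mulr_sumr; apply: eq_bigr => n _; case: ifP; rewrite ?mulr1 ?mulr0.
  have w0 := @prime_wt_gt0 R p p0.
  apply: (@le_trans _ _ (prime_wt p * (194 * N%:R * t * (ln p%:R / p%:R)))).
    by rewrite ler_pM2l//; apply: count_dvd_psi.
  by apply: ler_wpM2r; [exact: h0|exact: prime_wt_ub].
rewrite -mulr_sumr.
have -> : N%:R * (194 * t * ((ln y%:R + 2) / y%:R)) = (194 * N%:R * t) * ((ln y%:R + 2) / y%:R) by ring.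
by rewrite ler_wpM2l ?sum_ln_inv_sqr_tail// !mulr_ge0.
Qed.

End Averages.

(** * Mean values *)

Section MeanBounds.
Context {R : realType}.

(** This linearises exponentials of bounded weights, so that means of the weights suffice. *)
Lemma expR_le1DM (x b : R) : 0 <= x -> x <= b -> expR x <= 1 + x * expR b.
Proof.
move=> x0 xb; apply: (@le_trans _ _ (1 + x * expR x)); last first.
  by rewrite lerD2l ler_wpM2l// ler_expR.
have := ler_wpM2r (expR_ge0 x) (expR_ge1Dx (- x)).
by rewrite -expRD addNr expR0; lra.
Qed.

Variables N y1 y2 y3 Y : nat.
Local Notation t := (ln (ln N%:R) : R).
Hypothesis t1 : 1 <= t.
Hypothesis Hy1 : 252 * y1%:R * ln (2 * y1%:R) <= t.
Hypothesis y20 : (0 < y2)%N.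
Hypothesis y23 : (y2 <= y3)%N.
Hypothesis Y0 : (0 < Y)%N.
Hypothesis HY : 4 * ln N%:R <= Y%:R :> R.

Let M := (N + y1 + y2 + y3).+2.
Let NM : (N.+2 <= M)%N. Proof. by rewrite /M; lia. Qed.
Let y1M : (y1 < M)%N. Proof. by rewrite /M; lia. Qed.
Let y2M : (y2 < M)%N. Proof. by rewrite /M; lia. Qed.
Let y3M : (y3 < M)%N. Proof. by rewrite /M; lia. Qed.

Local Notation P1 := (@prime_sum R y1).
Local Notation P2 := (@prime_sum R y2).
Definition mean_defect : R := 12 * y1%:R / t.
Definition mean_excess (y : nat) : R := 194 * t * ((ln y%:R + 2) / y%:R).
Local Notation d1 := mean_defect.
Local Notation d2 := (mean_excess y2).
Definition mean_exp_excess : R := expR (prime_sum y3 - P2) * d2 +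
  expR (prime_sum y3 - P2) * expR (prime_sum Y + 1) * mean_excess y3.
Local Notation e2 := mean_exp_excess.

Let G := @psi_wt R 0 M.
Let d := @psi_defect R y1.
Let W := @psi_wt R y2.+1 M.
Let Wa := @psi_wt R y2.+1 y3.+1.
Let Wb := @psi_wt R y3.+1 M.

Let t0 : 0 < t. Proof. exact: lt_le_trans t1. Qed.

Let sum_d : \sum_(1 <= n < N.+1) d n <= N%:R * d1.
Proof. exact: sum_psi_defect. Qed.
Let sum_W : \sum_(1 <= n < N.+1) W n <= N%:R * d2.
Proof. exact: sum_psi_wt. Qed.
Let sum_Wa : \sum_(1 <= n < N.+1) Wa n <= N%:R * d2.
Proof. exact: sum_psi_wt. Qed.
Let sum_Wb : \sum_(1 <= n < N.+1) Wb n <= N%:R * mean_excess y3.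
Proof. by apply: sum_psi_wt => //; exact: leq_trans y23. Qed.

Let G_ge n : P1 - d n <= G n.
Proof. by rewrite /G (psi_wt_split n y1M) lerDl psi_wt_ge0. Qed.
Let G_le n : G n <= P2 + W n.
Proof. by rewrite /G (psi_wt_split n y2M) lerD2r gerBl psi_defect_ge0. Qed.

Let d_le n : d n <= P1.
Proof.
rewrite /d /psi_defect /prime_sum big_mkcondr /=; apply: ler_sum => p pp.
by case: ifP => // _; exact/ltW/prime_wt_gt0/prime_gt0.
Qed.

(** exp Wb is linearised first. In the product with exp Wa, the factor standing before 1 is
    linearised too, and the one standing before Wb is replaced by its maximum. *)
Let expW n : (0 < n <= N)%N -> expR (W n) <=
  1 + expR (prime_sum y3 - P2) * Wa n + expR (prime_sum y3 - P2) * expR (prime_sum Y + 1) * Wb n.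
Proof.
move=> nN; have -> : W n = Wa n + Wb n.
  by rewrite /W /psi_wt (big_cat_nat (n := y3.+1))//= ltnS.
have ha := expR_le1DM (psi_wt_ge0 _ _ n) (@psi_wt_le R y2 y3 n y23).
have hb := expR_le1DM (psi_wt_ge0 _ _ n) (@psi_wt_tail_le R N M NM y3.+1 Y n nN Y0 HY).
have ha' : expR (Wa n) <= expR (prime_sum y3 - P2) by rewrite ler_expR psi_wt_le.
have Wb0 : 0 <= Wb n := psi_wt_ge0 _ _ n.
rewrite -/(Wa n) -/(Wb n) in ha hb *; rewrite expRD.
apply: (le_trans (ler_wpM2l (expR_ge0 _) hb)).
rewrite mulrDr mulr1; apply: lerD; first by apply: le_trans ha _; rewrite mulrC.
rewrite [Wb n * _]mulrC mulrA ler_wpM2r// ler_wpM2r// expR_ge0.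
Qed.

Let sum_le (F K : nat -> R) : (forall n, (0 < n <= N)%N -> F n <= K n) ->
  \sum_(1 <= n < N.+1) F n <= \sum_(1 <= n < N.+1) K n.
Proof. by move=> h; rewrite !big_nat; apply: ler_sum => n; rewrite ltnS; exact: h. Qed.

Let sum1 (c : R) : \sum_(1 <= n < N.+1) c = N%:R * c.
Proof. by rewrite sumr_const_nat subn1 mulr_natl. Qed.

Let gE n : (0 < n <= N)%N -> (psi (psi n))%:R / (psi n)%:R = expR (G n).
Proof. exact: psi_ratioE. Qed.

(* Primes up to y1 contribute prime_sum y1 up to their mean defect. Those in
   (y2, y3] contribute a bounded amount, and those beyond y3 at most
   prime_sum Y + 1, so that the exponential only multiplies their mean
   contributions by the factors in mean_exp_excess. *)
Lemma sum_ratio_bounds :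
  expR P1 * N%:R * (1 - d1) <= \sum_(1 <= n < N.+1) (psi (psi n))%:R / (psi n)%:R
  <= expR P2 * N%:R * (1 + e2).
Proof.
apply/andP; split.
  apply: (@le_trans _ _ (\sum_(1 <= n < N.+1) expR P1 * (1 - d n))).
    by rewrite -mulr_sumr -mulrA ler_wpM2l ?expR_ge0// sumrB sum1; move: sum_d; lra.
  apply: sum_le => n nN; rewrite gE//; apply: (@le_trans _ _ (expR P1 * expR (- d n))).
    by rewrite ler_wpM2l ?expR_ge0// expR_ge1Dx.
  by rewrite -expRD ler_expR.
apply: (@le_trans _ _ (\sum_(1 <= n < N.+1) expR P2 * (1 + expR (prime_sum y3 - P2) * Wa n +
    expR (prime_sum y3 - P2) * expR (prime_sum Y + 1) * Wb n))).
  apply: sum_le => n nN; rewrite gE//; apply: (@le_trans _ _ (expR P2 * expR (W n))).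
    by rewrite -expRD ler_expR.
  by rewrite ler_wpM2l ?expR_ge0// expW.
rewrite -mulr_sumr -mulrA ler_wpM2l ?expR_ge0// !big_split /= sum1 -!mulr_sumr /mean_exp_excess.
have := ler_wpM2l (expR_ge0 (prime_sum y3 - P2)) sum_Wa.
have := ler_wpM2l (mulr_ge0 (expR_ge0 (prime_sum y3 - P2)) (expR_ge0 (prime_sum Y + 1))) sum_Wb.
move: (mean_excess y2) (mean_excess y3) (bigop _ _ _) (bigop _ _ _).
by move: (expR _) (expR (_ + 1)) => a b e f g h; lra.
Qed.

(** Here the defect is exponentiated. It is at most [prime_sum y1], so linearising multiplies its
    mean by exp ([prime_sum y1]), which is of order l. Hence the mean defect must be o (1/l). *)
Lemma sum_ratioV_bounds :
  expR (- P2) * N%:R * (1 - d2) <= \sum_(1 <= n < N.+1) (psi n)%:R / (psi (psi n))%:R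
  <= expR (- P1) * N%:R * (1 + d1 * expR P1).
Proof.
have gVE n : (0 < n <= N)%N -> (psi n)%:R / (psi (psi n))%:R = expR (- G n).
  by move=> nN; rewrite expRN -gE// invf_div.
apply/andP; split.
  apply: (@le_trans _ _ (\sum_(1 <= n < N.+1) expR (- P2) * (1 - W n))).
    by rewrite -mulr_sumr -mulrA ler_wpM2l ?expR_ge0// sumrB sum1; move: sum_W; lra.
  apply: sum_le => n nN; rewrite gVE//; apply: (@le_trans _ _ (expR (- P2) * expR (- W n))).
    by rewrite ler_wpM2l ?expR_ge0// expR_ge1Dx.
  by rewrite -expRD ler_expR -opprD lerN2.
apply: (@le_trans _ _ (\sum_(1 <= n < N.+1) expR (- P1) * (1 + d n * expR P1))).
  apply: sum_le => n nN; rewrite gVE//; apply: (@le_trans _ _ (expR (- P1) * expR (d n))).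
    by rewrite -expRD ler_expR; have := G_ge n; move: (G n) (d n) P1 => a b c; lra.
  by rewrite ler_wpM2l ?expR_ge0// expR_le1DM// psi_defect_ge0.
rewrite -mulr_sumr -mulrA ler_wpM2l ?expR_ge0// big_split /= sum1 -mulr_suml.
have := ler_wpM2r (expR_ge0 P1) sum_d.
by move: (bigop _ _ _) d1 (expR _) => a b c; lra.
Qed.

Lemma sum_ln_ratio_bounds :
  N%:R * (P1 - d1) <= \sum_(1 <= n < N.+1) ln ((psi (psi n))%:R / (psi n)%:R)
  <= N%:R * (P2 + d2).
Proof.
apply/andP; split.
  apply: (@le_trans _ _ (\sum_(1 <= n < N.+1) (P1 - d n))).
    by rewrite sumrB sum1; move: sum_d; lra.
  by apply: sum_le => n nN; rewrite gE// expRK.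
apply: (@le_trans _ _ (\sum_(1 <= n < N.+1) (P2 + W n))).
  by apply: sum_le => n nN; rewrite gE// expRK.
by rewrite big_split sum1 /=; move: sum_W; lra.
Qed.

End MeanBounds.

(** * Asymptotics *)

Section FilterLimits.
Context {R : realType} {T : Type} {F : set_system T} {FF : Filter F}.
Implicit Types f g : T -> R.

Lemma cvgry_ln f : f x @[x --> F] --> +oo -> ln (f x) @[x --> F] --> +oo.
Proof.
move=> fy; apply/cvgryPge => A; near=> x.
rewrite -(expRK A) ler_ln ?posrE ?expR_gt0//; first by near: x; apply: cvgry_ge.
by near: x; apply: cvgry_gt.
Unshelve. all: by end_near. Qed.

Lemma cvgry_inv0 f : f x @[x --> F] --> +oo -> (f x)^-1 @[x --> F] --> (0 : R).
Proof. by move=> fy; apply/gtr0_cvgV0 => //; exact: cvgry_gt. Qed.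

Lemma cvgry_ln_div f : f x @[x --> F] --> +oo -> ln (f x) / f x @[x --> F] --> (0 : R).
Proof.
move=> fy; have uy := cvgry_ln fy.
have h0 : 2 * (ln (f x))^-1 @[x --> F] --> (0 : R).
  by rewrite -[X in _ --> X](mulr0 2); apply: cvgM; [exact: cvg_cst|exact: cvgry_inv0].
apply: squeeze_cvgr (cvg_cst 0) h0; near=> x.
have f0 : 0 < f x by near: x; exact: cvgry_gt.
have u0 : 0 < ln (f x) by near: x; exact: cvgry_gt.
rewrite divr_ge0 ?(ltW u0) ?(ltW f0)//= ler_pdivrMr// mulrAC ler_pdivlMr//.
have := @expR_ge1Dxn R (ln (f x)) 1 (ltW u0); rewrite lnK ?posrE//.
by rewrite -[(_.+1)`!]/2%N expr2; lra.
Unshelve. all: by end_near. Qed.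

Lemma cvg_sub0_ratio1 f g : g x @[x --> F] --> +oo -> f x - g x @[x --> F] --> (0:R) ->
  f x / g x @[x --> F] --> (1 : R).
Proof.
move=> gy fg; have h : 1 + (f x - g x) / g x @[x --> F] --> (1 : R).
  rewrite -[X in _ --> X]addr0; apply: cvgD; first exact: cvg_cst.
  by rewrite -[X in _ --> X](mul0r 0); apply: cvgM => //; exact: cvgry_inv0.
apply: cvg_trans h; apply: near_eq_cvg; near=> x.
have g0 : 0 < g x by near: x; exact: cvgry_gt.
by rewrite mulrBl divff ?gt_eqF// subrKC.
Unshelve. all: by end_near. Qed.

Lemma cvg_ratio1_ln f g : f x @[x --> F] --> +oo -> g x @[x --> F] --> +oo ->
  f x / g x @[x --> F] --> (1 : R) -> ln (f x) - ln (g x) @[x --> F] --> (0 : R).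
Proof.
move=> fy gy fg; have h : ln (f x / g x) @[x --> F] --> ln 1.
  by apply: (@continuous_cvg _ _ _ F FF (fun x => f x / g x) (@ln R)) fg; exact: continuous_ln.
rewrite ln1 in h; apply: cvg_trans h; apply: near_eq_cvg; near=> x.
by rewrite ln_div// posrE; near: x; exact: cvgry_gt.
Unshelve. all: by end_near. Qed.

Lemma cvg_truncn_ratio f : f x @[x --> F] --> +oo -> (Num.truncn (f x))%:R / f x @[x --> F] --> (1 : R).
Proof.
move=> fy; have h : 1 - (f x)^-1 @[x --> F] --> (1 : R).
  by rewrite -[X in _ --> X]subr0; apply: cvgB; [exact: cvg_cst|exact: cvgry_inv0].
apply: squeeze_cvgr h (cvg_cst (1 : R)); near=> x.
have f0 : 0 < f x by near: x; exact: cvgry_gt.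
have /andP[a b] := truncn_itv (ltW f0).
rewrite ler_pdivrMr// mul1r a andbT ler_pdivlMr// mulrBl mulVf ?gt_eqF// mul1r.
by move: b; rewrite -natr1; lra.
Unshelve. all: by end_near. Qed.

Lemma cvg_truncn f : f x @[x --> F] --> +oo -> Num.truncn (f x) @[x --> F] --> \oo.
Proof.
move=> fy; apply/cvgnyPge => A; near=> x.
have f1 : A%:R <= f x by near: x; exact: cvgry_ge.
by rewrite truncn_ge_nat// (le_trans _ f1).
Unshelve. all: by end_near. Qed.

Lemma cvg_truncnr f : f x @[x --> F] --> +oo ->
  ((Num.truncn (f x))%:R : R) @[x --> F] --> +oo.
Proof.
move=> fy; exact: (@cvg_comp _ _ _ _ (fun n : nat => n%:R : R) _ _ _ (cvg_truncn fy) cvgr_idn).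
Qed.

(** Mertens' theorem with ln (ln y) written as ln s + ln (ln y / s): only the order of ln y matters,
    so cutoffs differing by powers of l give the same limit. *)
Lemma prime_sum_cvg (y : T -> nat) (s : T -> R) (a : R) : y x @[x --> F] --> \oo ->
  s x @[x --> F] --> +oo -> 0 < a -> ln (y x)%:R / s x @[x --> F] --> a ->
  prime_sum (y x) - ln (s x) @[x --> F] --> mertens_const + ln a.
Proof.
move=> yy sy a0 ys.
have h1 := @cvg_comp _ _ _ y _ _ _ _ yy (@mertens_third R).
have h2 : ln (ln (y x)%:R / s x) @[x --> F] --> ln a.
  by apply: (@continuous_cvg _ _ _ F FF (fun x => ln (y x)%:R / s x) (@ln R)) ys; exact: continuous_ln.
apply: cvg_trans (cvgD h1 h2); apply: near_eq_cvg; near=> x.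
have s0 : 0 < s x by near: x; exact: cvgry_gt.
have l0 : 0 < ln (y x)%:R :> R.
  near: x; apply: cvgry_gt; apply: cvgry_ln.
  exact: (@cvg_comp _ _ _ _ (fun n : nat => n%:R : R) _ _ _ yy cvgr_idn).
by rewrite [LHS](_ : _ = prime_sum (y x) - ln (ln (y x)%:R) + ln (ln (y x)%:R / s x))// ln_div ?posrE//; ring.
Unshelve. all: by end_near. Qed.

Lemma expR_cvg_div f g a : g x @[x --> F] --> +oo -> f x - ln (g x) @[x --> F] --> a ->
  expR (f x) / g x @[x --> F] --> expR a.
Proof.
move=> gy fg; pose proof (continuous_cvg _ (@continuous_expR R a) fg) as H; move: H.
apply: cvg_trans; apply: near_eq_cvg; near=> x.
have g0 : 0 < g x by near: x; exact: cvgry_gt.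
by rewrite /= expRD expRN lnK.
Unshelve. all: by end_near. Qed.

End FilterLimits.

Section LogTruncn.
Context {R : realType} {T : Type} {F : set_system T} {FF : Filter F}.

Lemma cvg_ln_truncn (z s : T -> R) (a : R) : z x @[x --> F] --> +oo -> s x @[x --> F] --> +oo ->
  ln (z x) / s x @[x --> F] --> a -> ln (Num.truncn (z x))%:R / s x @[x --> F] --> a.
Proof.
move=> zy sy zs.
pose proof (cvg_ratio1_ln (cvg_truncnr zy) zy (cvg_truncn_ratio zy)) as h.
pose proof (cvgD (cvgM h (cvgry_inv0 sy)) zs) as H; move: H.
rewrite mulr0 add0r; apply: cvg_trans; apply: near_eq_cvg; near=> x.
by rewrite [LHS](_ : _ = (ln (Num.truncn (z x))%:R - ln (z x)) / s x + ln (z x) / s x)// mulrBl subrK.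
Unshelve. all: by end_near. Qed.

Lemma prime_sum_truncn_cvg (z s : T -> R) (a : R) : z x @[x --> F] --> +oo ->
  s x @[x --> F] --> +oo -> 0 < a -> ln (z x) / s x @[x --> F] --> a ->
  prime_sum (Num.truncn (z x)) - ln (s x) @[x --> F] --> mertens_const + ln a.
Proof.
by move=> zy sy a0 zs; apply: prime_sum_cvg (cvg_truncn zy) sy a0 (cvg_ln_truncn zy sy zs).
Qed.

End LogTruncn.

Section Cutoffs.
Context {R : realType}.
Local Notation L N := (ln N%:R : R).
Local Notation t N := (ln (L N)).
Local Notation l N := (ln (t N)).

Lemma cvg_ln_nat : L N @[N --> \oo] --> +oo.
Proof. exact/cvgry_ln/cvgr_idn. Qed.
Lemma cvg_lnln_nat : t N @[N --> \oo] --> +oo.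
Proof. exact/cvgry_ln/cvg_ln_nat. Qed.
Lemma cvg_lnlnln_nat : l N @[N --> \oo] --> +oo.
Proof. exact/cvgry_ln/cvg_lnln_nat. Qed.
Let Ly := cvg_ln_nat.
Let ty := cvg_lnln_nat.
Let ly := cvg_lnlnln_nat.

(** The square of l makes the mean defect of order 1 / l^2, still negligible after multiplication by
    l in the reciprocal sum. In [cut2] it makes the mean excess of order 1 / l, as the numerator ln
    y is of order l. *)
Definition cut1 N := Num.truncn (t N / l N ^+ 2).
Definition cut2 N := Num.truncn (t N * l N ^+ 2).
Definition cut3 N := Num.truncn (t N ^+ 3).
(** The 5 leaves room for truncation: the integer part still exceeds 4 ln N. *)
Definition cut4 N := Num.truncn (5 * L N).

Let t_gt N (N' : 1 < l N) : l N ^+ 3 / 6 <= t N.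
Proof.
have l0 : 0 < l N by lra.
have t0 : 0 < t N by rewrite ltNge; apply: contraTN l0 => h; rewrite ln0// ltxx.
have := @expR_ge1Dxn R (l N) 2 (ltW l0); rewrite lnK ?posrE//.
by rewrite -[(_.+1)`!]/6%N; lra.
Qed.

Let z1y : t N / l N ^+ 2 @[N --> \oo] --> +oo.
Proof.
apply/cvgryPge => A; near=> N.
have l1 : 1 < l N by near: N; exact: cvgry_gt.
have lA : 6 * A <= l N by near: N; exact: cvgry_ge.
have := t_gt l1; rewrite ler_pdivlMr ?exprn_gt0//; last by lra.
apply: le_trans; have : A * l N ^+ 2 <= (l N / 6) * l N ^+ 2.
  by rewrite ler_wpM2r ?exprn_ge0//; lra.
by move/le_trans; apply; rewrite mulrAC -exprS.
Unshelve. all: by end_near. Qed.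

Let z2y : t N * l N ^+ 2 @[N --> \oo] --> +oo.
Proof.
apply/cvgryPge => A; near=> N.
have l1 : 1 < l N by near: N; exact: cvgry_gt.
have tA : A <= t N by near: N; exact: cvgry_ge.
have t0 : 0 < t N by near: N; exact: cvgry_gt.
by apply: (le_trans tA); rewrite ler_peMr ?(ltW t0)// expr_ge1// ?ltW//; lra.
Unshelve. all: by end_near. Qed.

Let z3y : t N ^+ 3 @[N --> \oo] --> +oo.
Proof.
apply/cvgryPge => A; near=> N.
have t1 : 1 < t N by near: N; exact: cvgry_gt.
have tA : A <= t N by near: N; exact: cvgry_ge.
by apply: (le_trans tA); rewrite exprS ler_peMr ?exprn_ege1//; lra.
Unshelve. all: by end_near. Qed.

Let z4y : 5 * L N @[N --> \oo] --> +oo.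
Proof.
apply/cvgryPge => A; near=> N.
have t1 : 0 < L N by near: N; exact: cvgry_gt.
have tA : A <= L N by near: N; exact: cvgry_ge.
lra.
Unshelve. all: by end_near. Qed.

Let lnl : ln (l N) / l N @[N --> \oo] --> (0 : R).
Proof. exact: cvgry_ln_div. Qed.

Let lz1 : ln (t N / l N ^+ 2) / l N @[N --> \oo] --> (1 : R).
Proof.
pose proof (cvgB (cvg_cst (1 : R)) (cvgM (cvg_cst (2 : R)) lnl)) as H; move: H; rewrite mulr0 subr0.
apply: cvg_trans; apply: near_eq_cvg; near=> N.
have l0 : 0 < l N by near: N; exact: cvgry_gt.
have t0 : 0 < t N by near: N; exact: cvgry_gt.
rewrite [LHS](_ : _ = 1 - 2 * (ln (l N) / l N))// ln_div ?posrE ?exprn_gt0// lnXn//.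
by rewrite mulrBl divff ?gt_eqF// -(mulr_natl (ln _)) mulrA.
Unshelve. all: by end_near. Qed.

Let lz2 : ln (t N * l N ^+ 2) / l N @[N --> \oo] --> (1 : R).
Proof.
pose proof (cvgD (cvg_cst (1 : R)) (cvgM (cvg_cst (2 : R)) lnl)) as H; move: H; rewrite mulr0 addr0.
apply: cvg_trans; apply: near_eq_cvg; near=> N.
have l0 : 0 < l N by near: N; exact: cvgry_gt.
have t0 : 0 < t N by near: N; exact: cvgry_gt.
rewrite [LHS](_ : _ = 1 + 2 * (ln (l N) / l N))// lnM ?posrE ?exprn_gt0// lnXn//.
by rewrite [RHS]mulrDl divff ?gt_eqF// -(mulr_natl (ln _)) mulrA.
Unshelve. all: by end_near. Qed.

Let lz3 : ln (t N ^+ 3) / l N @[N --> \oo] --> (3 : R).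
Proof.
suff h : \forall N \near \oo, cst (3 : R) N = ln (t N ^+ 3) / l N.
  by apply: cvg_trans (near_eq_cvg h) _; exact: cvg_cst.
near=> N.
have l0 : 0 < l N by near: N; exact: cvgry_gt.
have t0 : 0 < t N by near: N; exact: cvgry_gt.
by rewrite lnXn// -(mulr_natl (ln _)) mulfK ?gt_eqF.
Unshelve. all: by end_near. Qed.

Let lz4 : ln (5 * L N) / t N @[N --> \oo] --> (1 : R).
Proof.
pose proof (cvgD (cvgM (cvg_cst (ln (5 : R))) (cvgry_inv0 ty)) (cvg_cst (1 : R))) as H; move: H.
rewrite mulr0 add0r; apply: cvg_trans; apply: near_eq_cvg; near=> N.
have l0 : 0 < L N by near: N; exact: cvgry_gt.
have t0 : 0 < t N by near: N; exact: cvgry_gt.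
by rewrite [LHS](_ : _ = ln 5 / t N + 1)// lnM ?posrE// [RHS]mulrDl divff ?gt_eqF.
Unshelve. all: by end_near. Qed.

Lemma prime_sum_cut1 : prime_sum (cut1 N) - ln (l N) @[N --> \oo] --> (mertens_const : R).
Proof. by rewrite -[X in _ --> X]addr0 -ln1; exact: prime_sum_truncn_cvg. Qed.
Lemma prime_sum_cut2 : prime_sum (cut2 N) - ln (l N) @[N --> \oo] --> (mertens_const : R).
Proof. by rewrite -[X in _ --> X]addr0 -ln1; exact: prime_sum_truncn_cvg. Qed.
Lemma prime_sum_cut3 : prime_sum (cut3 N) - ln (l N) @[N --> \oo] --> mertens_const + ln (3 : R).
Proof. exact: prime_sum_truncn_cvg. Qed.
Lemma prime_sum_cut4 : prime_sum (cut4 N) - ln (t N) @[N --> \oo] --> (mertens_const : R).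
Proof. by rewrite -[X in _ --> X]addr0 -ln1; exact: prime_sum_truncn_cvg. Qed.

Lemma expR_cut1 : expR (prime_sum (cut1 N)) / l N @[N --> \oo] --> expR (mertens_const : R).
Proof. exact: expR_cvg_div ly prime_sum_cut1. Qed.
Lemma expR_cut2 : expR (prime_sum (cut2 N)) / l N @[N --> \oo] --> expR (mertens_const : R).
Proof. exact: expR_cvg_div ly prime_sum_cut2. Qed.
Lemma expR_cut4 : expR (prime_sum (cut4 N)) / t N @[N --> \oo] --> expR (mertens_const : R).
Proof. exact: expR_cvg_div ty prime_sum_cut4. Qed.

(** The factor l is kept because [sum_ratioV_bounds] multiplies the defect by a quantity of that
    order. *)
Lemma mean_defect_cut : mean_defect N (cut1 N) * l N @[N --> \oo] --> (0 : R).
Proof.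
pose proof (cvgM (cvgM (cvg_cst (12 : R)) (cvg_truncn_ratio z1y)) (cvgry_inv0 ly)) as H; move: H.
rewrite mulr0; apply: cvg_trans; apply: near_eq_cvg; near=> N.
have l0 : 0 < l N by near: N; exact: cvgry_gt.
have t0 : 0 < t N by near: N; exact: cvgry_gt.
rewrite [LHS](_ : _ = 12 * ((cut1 N)%:R / (t N / l N ^+ 2)) / l N)// /mean_defect.
by move: ((cut1 N)%:R : R) => y; field; rewrite !gt_eqF.
Unshelve. all: by end_near. Qed.

Lemma mean_excess_cut2 : mean_excess N (cut2 N) @[N --> \oo] --> (0 : R).
Proof.
pose proof (cvgM (cvgV (oner_neq0 R) (cvg_truncn_ratio z2y))
  (cvgD (cvg_ln_truncn z2y ly lz2) (cvgM (cvg_cst (2 : R)) (cvgry_inv0 ly)))) as h.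
pose proof (cvgM (cvgM (cvg_cst (194 : R)) h) (cvgry_inv0 ly)) as H; move: H.
rewrite mulr0; apply: cvg_trans; apply: near_eq_cvg; near=> N.
have l0 : 0 < l N by near: N; exact: cvgry_gt.
have t0 : 0 < t N by near: N; exact: cvgry_gt.
have y0 : 0 < (cut2 N)%:R :> R by near: N; apply: cvgry_gt; exact: cvg_truncnr.
rewrite [LHS](_ : _ = 194 * (((cut2 N)%:R / (t N * l N ^+ 2))^-1 *
   (ln (cut2 N)%:R / l N + 2 * (l N)^-1)) / l N)// /mean_excess.
by move: ((cut2 N)%:R : R) y0 => y y0; field; rewrite !gt_eqF.
Unshelve. all: by end_near. Qed.

(** Between [cut2] and [cut3] the total weight tends to ln 3, since ln (t^3) = 3 l. The bound for
    the tail weight exponentiates to order t, while the mean excess beyond [cut3] is of order l /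
    t^2; the product is of order l / t. *)
Lemma mean_exp_excess_cut :
  mean_exp_excess N (cut2 N) (cut3 N) (cut4 N) @[N --> \oo] --> (0 : R).
Proof.
have ha : expR (prime_sum (cut3 N) - prime_sum (cut2 N)) @[N --> \oo] --> expR (ln (3 : R)).
  apply: (continuous_cvg _ (@continuous_expR R (ln (3 : R)))).
  pose proof (cvgB prime_sum_cut3 prime_sum_cut2) as H; move: H; rewrite [_ + ln 3]addrC addrK.
  apply: cvg_trans; apply: near_eq_cvg; near=> N.
  by rewrite [LHS](_ : _ = prime_sum (cut3 N) - ln (l N) - (prime_sum (cut2 N) - ln (l N)))//; ring.
pose proof (cvgM (cvgV (oner_neq0 R) (cvg_truncn_ratio z3y))
  (cvgD (cvg_ln_truncn z3y ly lz3) (cvgM (cvg_cst (2 : R)) (cvgry_inv0 ly)))) as h.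
pose proof (cvgM (cvgM (cvg_cst (194 * expR 1 : R)) (cvgM h expR_cut4)) (cvgry_ln_div ty)) as hb.
rewrite mulr0 in hb.
pose proof (cvgM ha (cvgD mean_excess_cut2 hb)) as H; move: H; rewrite addr0 mulr0.
apply: cvg_trans; apply: near_eq_cvg; near=> N.
have l0 : 0 < l N by near: N; exact: cvgry_gt.
have t0 : 0 < t N by near: N; exact: cvgry_gt.
have y0 : 0 < (cut3 N)%:R :> R by near: N; apply: cvgry_gt; exact: cvg_truncnr.
rewrite [LHS](_ : _ = expR (prime_sum (cut3 N) - prime_sum (cut2 N)) * (mean_excess N (cut2 N) +
  194 * expR 1 * (((cut3 N)%:R / (t N ^+ 3))^-1 *
   (ln (cut3 N)%:R / l N + 2 * (l N)^-1) * (expR (prime_sum (cut4 N)) / t N)) * (l N / t N)))//.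
rewrite /mean_exp_excess [X in _ = _ + _ * _ * X]/mean_excess (expRD _ 1) mulrDr; congr (_ + _).
move: (expR (_ - _)) (expR (prime_sum _)) (expR 1) ((cut3 N)%:R : R) y0 => a b c y y0.
by field; rewrite !gt_eqF.
Unshelve. all: by end_near. Qed.

Definition cuts_ok N := [/\ 1 <= t N,
  252 * (cut1 N)%:R * ln (2 * (cut1 N)%:R) <= t N, (0 < cut2 N <= cut3 N)%N,
  (0 < cut4 N)%N & 4 * L N <= (cut4 N)%:R].

Lemma near_cuts_ok : \forall N \near \oo, cuts_ok N.
Proof.
near=> N.
have L1 : 1 <= L N by near: N; exact: cvgry_ge.
have t1 : 1 <= t N by near: N; exact: cvgry_ge.
(* The size condition on [cut1] reduces to 252 t / l <= t. *)
have l1 : 252 <= l N by near: N; exact: cvgry_ge.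
have z1 : 1 <= t N / l N ^+ 2 by near: N; exact: cvgry_ge.
have z2 : 1 <= t N * l N ^+ 2 by near: N; exact: cvgry_ge.
have l0 : 0 < l N by lra.
have t0 : 0 < t N by lra.
split => //.
- have [y0 yz] : 0 < (cut1 N)%:R :> R /\ (cut1 N)%:R <= t N / l N ^+ 2.
    by rewrite ltr0n truncn_gt0 truncn_le; split => //; lra.
  have lnle : ln (2 * (cut1 N)%:R) <= l N.
    rewrite ler_ln ?posrE ?mulr_gt0//; apply: (@le_trans _ _ (2 * (t N / l N ^+ 2))).
      by rewrite ler_pM2l.
    rewrite mulrA ler_pdivrMr ?exprn_gt0// mulrC ler_pM2l// expr2.
    by move: (l N) l1 => b; nra.
  apply: (@le_trans _ _ (252 * (t N / l N ^+ 2) * l N)).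
    by apply: (@le_trans _ _ (252 * (cut1 N)%:R * l N)); nra.
  have -> : 252 * (t N / l N ^+ 2) * l N = t N * (252 / l N) by field; rewrite gt_eqF.
  by apply: ler_piMr; [exact: ltW|rewrite ler_pdivrMr; [rewrite mul1r; exact: l1|exact: l0]].
- rewrite truncn_gt0 z2/= le_truncn// [leRHS]exprS ler_pM2l// lerXn2r ?nnegrE ?(ltW l0) ?(ltW t0)//.
  by have := le_ln1Dx (x := t N - 1); rewrite subrKC; lra.
- by rewrite truncn_gt0; lra.
- have L5 : 0 <= 5 * L N by lra.
  have /andP[_] := truncn_itv L5; rewrite -/(cut4 N) -(natr1 (cut4 N)).
  by move: L1; move: ((cut4 N)%:R : R) (L N) => a b; lra.
Unshelve. all: by end_near. Qed.

End Cutoffs.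

(** * The three asymptotic formulas along the integers *)

Section NatAsymptotics.
Context {R : realType}.
Local Notation K := (@mertens_const R).
Local Notation l N := (ln (ln (ln (N%:R : R)))).
Local Notation cut1 := (@cut1 R).
Local Notation cut2 := (@cut2 R).
Local Notation cut3 := (@cut3 R).
Local Notation cut4 := (@cut4 R).

Let d1 : @mean_defect R N (cut1 N) @[N --> \oo] --> (0 : R).
Proof.
pose proof (cvgM (@mean_defect_cut R) (cvgry_inv0 (@cvg_lnlnln_nat R))) as H; move: H.
rewrite mul0r; apply: cvg_trans; apply: near_eq_cvg; near=> N.
have l0 : 0 < l N by near: N; exact: cvgry_gt (@cvg_lnlnln_nat R) 0.
by rewrite [LHS](_ : _ = mean_defect N (cut1 N) * l N / l N)// mulfK// gt_eqF.
Unshelve. all: by end_near. Qed.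

Let d1_exp : mean_defect N (cut1 N) * expR (prime_sum (cut1 N)) @[N --> \oo] --> (0 : R).
Proof.
pose proof (cvgM (@mean_defect_cut R) (@expR_cut1 R)) as H; move: H.
rewrite mul0r; apply: cvg_trans; apply: near_eq_cvg; near=> N.
have l0 : 0 < l N by near: N; exact: cvgry_gt (@cvg_lnlnln_nat R) 0.
rewrite [LHS](_ : _ = mean_defect N (cut1 N) * l N * (expR (prime_sum (cut1 N)) / l N))//.
by rewrite mulrACA divff ?gt_eqF// mulr1.
Unshelve. all: by end_near. Qed.

Lemma sum_ratio_nat :
  (\sum_(1 <= n < N.+1) (psi (psi n))%:R / (psi n)%:R) / (N%:R * (expR K * l N))
    @[N --> \oo] --> (1 : R).
Proof.
pose proof (cvgM (cvgM (@expR_cut1 R) (cvg_cst (expR K)^-1)) (cvgB (cvg_cst (1 : R)) d1)) as lo.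
pose proof (cvgM (cvgM (@expR_cut2 R) (cvg_cst (expR K)^-1)) (cvgD (cvg_cst (1 : R)) (@mean_exp_excess_cut R))) as hi.
rewrite subr0 mulr1 divff ?gt_eqF ?expR_gt0// in lo.
rewrite addr0 mulr1 divff ?gt_eqF ?expR_gt0// in hi.
apply: squeeze_cvgr lo hi; near=> N.
have l0 : 0 < l N by near: N; exact: cvgry_gt (@cvg_lnlnln_nat R) 0.
have N0 : 0 < N%:R :> R by near: N; exact: cvgry_gt (@cvgr_idn R) 0.
have [c1 c2 /andP[c3 c4] c5 c6] : @cuts_ok R N by near: N; exact: near_cuts_ok.
have /andP[a b] := sum_ratio_bounds c1 c2 c3 c4 c5 c6.
have E0 := expR_gt0 K; have D0 : 0 < N%:R * (expR K * l N) by rewrite !mulr_gt0.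
rewrite ler_pdivlMr// ler_pdivrMr//; apply/andP; split.
  apply: le_trans a; rewrite le_eqVlt; apply/orP; left; apply/eqP.
  rewrite [X in X * _ = _](_ : _ = (expR (prime_sum (cut1 N)) / l N / expR K) * (1 - mean_defect N (cut1 N)))//.
  move: (expR (prime_sum _)) (mean_defect _ _) => u v; field; rewrite !gt_eqF//.
apply: (le_trans b); rewrite le_eqVlt; apply/orP; left; apply/eqP.
rewrite [X in _ = X * _](_ : _ = (expR (prime_sum (cut2 N)) / l N / expR K) *
  (1 + mean_exp_excess N (cut2 N) (cut3 N) (cut4 N)))//.
move: (expR (prime_sum _)) (mean_exp_excess _ _ _ _) => u v; field; rewrite !gt_eqF//.
Unshelve. all: by end_near. Qed.

Lemma sum_ratioV_nat :
  (\sum_(1 <= n < N.+1) (psi n)%:R / (psi (psi n))%:R) / (N%:R * (expR (- K) / l N))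
    @[N --> \oo] --> (1 : R).
Proof.
have E0 := expR_gt0 K.
pose proof (cvgM (cvgM (cvgV (lt0r_neq0 E0) (@expR_cut2 R)) (cvg_cst (expR K))) (cvgB (cvg_cst (1 : R)) (@mean_excess_cut2 R))) as lo.
pose proof (cvgM (cvgM (cvgV (lt0r_neq0 E0) (@expR_cut1 R)) (cvg_cst (expR K))) (cvgD (cvg_cst (1 : R)) d1_exp)) as hi.
rewrite subr0 mulr1 mulVf ?gt_eqF// in lo.
rewrite addr0 mulr1 mulVf ?gt_eqF// in hi.
apply: squeeze_cvgr lo hi; near=> N.
have l0 : 0 < l N by near: N; exact: cvgry_gt (@cvg_lnlnln_nat R) 0.
have N0 : 0 < N%:R :> R by near: N; exact: cvgry_gt (@cvgr_idn R) 0.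
have [c1 c2 /andP[c3 c4] c5 c6] : @cuts_ok R N by near: N; exact: near_cuts_ok.
have /andP[a b] := sum_ratioV_bounds c1 c2 c3 c4 c5 c6.
have D0 : 0 < N%:R * (expR (- K) / l N) by rewrite mulr_gt0// divr_gt0// expR_gt0.
rewrite ler_pdivlMr// ler_pdivrMr//; rewrite !expRN in a b *; apply/andP; split.
  apply: le_trans a; rewrite le_eqVlt; apply/orP; left; apply/eqP.
  rewrite [X in X * _ = _](_ : _ = ((expR (prime_sum (cut2 N)) / l N)^-1 * expR K) * (1 - mean_excess N (cut2 N)))//.
  move: (expR (prime_sum _)) (expR_gt0 (prime_sum (R := R) (cut2 N))) (mean_excess _ _) => u u0 v; field; rewrite !gt_eqF//.
apply: (le_trans b); rewrite le_eqVlt; apply/orP; left; apply/eqP.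
rewrite [X in _ = X * _](_ : _ = ((expR (prime_sum (cut1 N)) / l N)^-1 * expR K) *
  (1 + mean_defect N (cut1 N) * expR (prime_sum (cut1 N))))//.
move: (expR (prime_sum _)) (expR_gt0 (prime_sum (R := R) (cut1 N))) (mean_defect _ _) => u u0 v; field; rewrite !gt_eqF//.
Unshelve. all: by end_near. Qed.

Lemma sum_ln_ratio_nat :
  (\sum_(1 <= n < N.+1) ln ((psi (psi n))%:R / (psi n)%:R)) / (N%:R * ln (l N))
    @[N --> \oo] --> (1 : R).
Proof.
pose proof (cvgry_ln (@cvg_lnlnln_nat R)) as lly.
pose proof (cvgD (cvgM (cvgB (@prime_sum_cut1 R) d1) (cvgry_inv0 lly)) (cvg_cst (1 : R))) as lo.
pose proof (cvgD (cvgM (cvgD (@prime_sum_cut2 R) (@mean_excess_cut2 R)) (cvgry_inv0 lly)) (cvg_cst (1 : R))) as hi.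
rewrite mulr0 add0r in lo; rewrite mulr0 add0r in hi.
apply: squeeze_cvgr lo hi; near=> N.
have l0 : 0 < ln (l N) by near: N; exact: cvgry_gt lly 0.
have N0 : 0 < N%:R :> R by near: N; exact: cvgry_gt (@cvgr_idn R) 0.
have [c1 c2 /andP[c3 c4] c5 c6] : @cuts_ok R N by near: N; exact: near_cuts_ok.
have /andP[a b] := sum_ln_ratio_bounds c1 c2 c3 c4 c5 c6.
have D0 : 0 < N%:R * ln (l N) by rewrite mulr_gt0.
rewrite ler_pdivlMr// ler_pdivrMr//; apply/andP; split.
  apply: le_trans a; rewrite le_eqVlt; apply/orP; left; apply/eqP.
  rewrite [X in X * _ = _](_ : _ = (prime_sum (cut1 N) - ln (l N) - mean_defect N (cut1 N)) / ln (l N) + 1)//.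
  by move: (prime_sum _) (mean_defect _ _) => u v; field; rewrite !gt_eqF.
apply: (le_trans b); rewrite le_eqVlt; apply/orP; left; apply/eqP.
rewrite [X in _ = X * _](_ : _ = (prime_sum (cut2 N) - ln (l N) + mean_excess N (cut2 N)) / ln (l N) + 1)//.
by move: (prime_sum _) (mean_excess _ _) => u v; field; rewrite !gt_eqF.
Unshelve. all: by end_near. Qed.

End NatAsymptotics.

(** * Passage from integers to real x *)

Section Transfer.
Context {R : realType}.

Lemma log_iter_cvgry {T : Type} {F : set_system T} {FF : Filter F} (f : T -> R) k :
  f x @[x --> F] --> +oo -> log_iter k (f x) @[x --> F] --> +oo.
Proof. by move=> fy; elim: k => // k IH; exact: cvgry_ln IH. Qed.

(** A ratio tending to 1 makes the logarithms differ by o(1); as they tend to infinity, their ratio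
    tends to 1 again, and the step repeats. *)
Lemma log_iter_sub_cvg {T : Type} {F : set_system T} {FF : Filter F} (f g : T -> R) k :
  f x @[x --> F] --> +oo -> g x @[x --> F] --> +oo -> f x / g x @[x --> F] --> (1 : R) ->
  log_iter k.+1 (f x) - log_iter k.+1 (g x) @[x --> F] --> (0 : R).
Proof.
move=> fy gy fg; elim: k => [|k IH]; first exact: cvg_ratio1_ln.
pose proof (log_iter_cvgry k.+1 fy) as fk; pose proof (log_iter_cvgry k.+1 gy) as gk.
exact: cvg_ratio1_ln fk gk (cvg_sub0_ratio1 gk IH).
Qed.

Lemma log_iter_truncn_ratio k :
  log_iter k.+1 (Num.truncn x)%:R / log_iter k.+1 x @[x --> +oo] --> (1 : R).
Proof.
have xy : x @[x --> +oo] --> (+oo : set_system R) by exact: cvg_id.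
apply: cvg_sub0_ratio1; first exact: log_iter_cvgry.
exact: log_iter_sub_cvg (cvg_truncnr xy) xy (cvg_truncn_ratio xy).
Qed.

(** The sum depends on x only through its integer part, so what has to be compared is x h(x) at x
    and at that integer. *)
Lemma asymp_equiv_sum_upto (f : nat -> R) (h : R -> R) :
  (\sum_(1 <= n < N.+1) f n) / (N%:R * h N%:R) @[N --> \oo] --> (1 : R) ->
  h (Num.truncn x)%:R / h x @[x --> +oo] --> (1 : R) ->
  (\forall x \near +oo, h x != 0) ->
  asymp_equiv (sum_upto f) (fun x => x * h x).
Proof.
move=> fh hh h0; rewrite /asymp_equiv /sum_upto.
have xy : x @[x --> +oo] --> (+oo : set_system R) by exact: cvg_id.
pose proof (cvg_truncnr xy) as ty.
pose proof (@cvg_comp _ _ _ (fun x : R => Num.truncn x) _ _ _ _ (cvg_truncn xy) fh) as H1.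
pose proof (cvgM (cvgM H1 (cvg_truncn_ratio xy)) hh) as H; rewrite !mulr1 in H.
apply: cvg_trans H; apply: near_eq_cvg; near=> x.
have x0 : 0 < x by near: x; exact: nbhs_pinfty_gt.
have hx : h x != 0 by near: x.
have t0 : 0 < (Num.truncn x)%:R :> R by near: x; exact: cvgry_gt.
have ht : h (Num.truncn x)%:R != 0 by near: x; exact: (ty _ h0).
rewrite [LHS](_ : _ = (\sum_(1 <= n < (Num.truncn x).+1) f n) /
   ((Num.truncn x)%:R * h (Num.truncn x)%:R) * ((Num.truncn x)%:R / x) * (h (Num.truncn x)%:R / h x))//.
move: (bigop _ _ _) ((Num.truncn x)%:R : R) t0 ht => s y t0 ht.
by field; rewrite hx ht !gt_eqF.
Unshelve. all: by end_near. Qed.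

End Transfer.

Theorem theorem1p1 (R : realType) :
  [/\ asymp_equiv
        (sum_upto (fun n : nat => (psi (psi n))%:R / (psi n)%:R))
        (fun x : R =>
           6 * expR (euler_gamma R) / pi ^+ 2 * (x * log_iter 3 x)),
      asymp_equiv
        (sum_upto (fun n : nat => (psi n)%:R / (psi (psi n))%:R))
        (fun x : R =>
           pi ^+ 2 * expR (- euler_gamma R) / 6 * (x / log_iter 3 x))
    & asymp_equiv
        (sum_upto (fun n : nat => ln ((psi (psi n))%:R / (psi n)%:R)))
        (fun x : R => x * log_iter 4 x)].
Proof.
have xy : x @[x --> +oo] --> (+oo : set_system R) by exact: cvg_id.
have pos k : \forall x \near +oo, log_iter k x != 0 :> R.
  by near=> x; rewrite gt_eqF//; near: x; exact: cvgry_gt (log_iter_cvgry k xy) 0.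
have pi2 : 0 < pi ^+ 2 / 6 :> R by rewrite divr_gt0// exprn_gt0// pi_gt0.
have E0 c : expR c != 0 :> R by rewrite gt_eqF ?expR_gt0.
split.
(* The stated constant is rewritten as exp ([mertens_const]), and the factor x is isolated for
   [asymp_equiv_sum_upto]. *)
- have -> : (fun x : R => 6 * expR (euler_gamma R) / pi ^+ 2 * (x * log_iter 3 x)) =
    (fun x : R => x * (expR mertens_const * log_iter 3 x)).
    apply/funext => x; rewrite /mertens_const expRD expRN lnK ?posrE// invf_div; ring.
  apply: asymp_equiv_sum_upto; first exact: sum_ratio_nat.
    apply: cvg_trans (@log_iter_truncn_ratio R 2); apply: near_eq_cvg; near=> x.
    by rewrite -mulf_div divff ?mul1r.
  by near=> x; rewrite mulf_neq0//; near: x; exact: pos.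
- have -> : (fun x : R => pi ^+ 2 * expR (- euler_gamma R) / 6 * (x / log_iter 3 x)) =
    (fun x : R => x * (expR (- mertens_const) / log_iter 3 x)).
    apply/funext => x; rewrite /mertens_const opprB addrC expRD lnK ?posrE//; ring.
  apply: asymp_equiv_sum_upto; first exact: sum_ratioV_nat.
    pose proof (cvgV (oner_neq0 R) (@log_iter_truncn_ratio R 2)) as H; rewrite invr1 in H.
    apply: cvg_trans H; apply: near_eq_cvg; near=> x.
    rewrite [LHS](_ : _ = (log_iter 3 (Num.truncn x)%:R / log_iter 3 x)^-1)//.
    by rewrite !invf_div [RHS]mulrC -[RHS]mulrA mulKf.
  by near=> x; rewrite mulf_neq0// invr_neq0//; near: x; exact: pos.
- apply: asymp_equiv_sum_upto; [exact: sum_ln_ratio_nat|exact: log_iter_truncn_ratio|exact: pos].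
Unshelve. all: by end_near. Qed.
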